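(* Let $\lambda>-1$, $t\in\mathbb{R}$, let $m\ge2$ be an integer, and let $P_n$ be the monic polynomials orthogonal with respect to the generalised higher order Freud weight $|x|^{2\lambda+1}\exp(tx^2-x^{2m})$ on $\mathbb{R}$. Let $\phi(n)=n^{1/(2m)}$ and assume that $n,N$ tend to infinity in such a way that $n/N\to\ell$, where $\ell>0$. Then, for the scaled monic polynomials $P_{n,N}(x)=(\phi(N))^{-n}P_n(\phi(N)x)$, the asymptotic zero distribution, as $n\to\infty$, has density $$a_m(\ell)=\frac{2m}{c\pi(2m-1)}\left(1-\frac{x^2}{c^2}\right)^{1/2}{}_2F_1\!\left(1,1-m;\tfrac32-m;\frac{x^2}{c^2}\right),$$ as a function of $x$ on the interval $(-2a\ell^{1/(2m)},\,2a\ell^{1/(2m)})$, where $$c=2a\ell^{1/(2m)},\qquad a=\frac12\left(\frac{(m-1)!}{(\tfrac12)_m}\right)^{1/(2m)}.$$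
   Context: ''The asymptotic zero distribution has density $f$ on an interval $I$'' means that the normalised zero counting measures $\frac1n\sum_{j=1}^n\delta_{x_{j}}$, with $x_1,\dots,x_n$ the zeros of $P_{n,N}$, converge weakly to the probability measure $f(x)\,dx$ on $I$. $(a)_m=a(a+1)\cdots(a+m-1)$ is the Pochhammer symbol and ${}_2F_1$ is the Gauss hypergeometric function (here a polynomial of degree $m-1$ in its argument). *)

(* Defs.v *)
From HB Require Import structures.
From mathcomp Require Import all_boot all_order all_algebra.
From mathcomp Require Import all_classical all_reals all_analysis.

Set Implicit Arguments.
Unset Strict Implicit.
Unset Printing Implicit Defensive.

Import Order.TTheory GRing.Theory Num.Theory.
Import numFieldNormedType.Exports.

Local Open Scope classical_set_scope.
Local Open Scope ring_scope.

Definition pochhammer (R : realType) (a : R) (m : nat) : R :=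
  \prod_(i < m) (a + i%:R).

Definition hypergeometric2F1 (R : realType) (a b c z : R) : R :=
  limn (pseries (fun k => pochhammer a k * pochhammer b k /
                          (pochhammer c k * k`!%:R)) z).

(* At x = 0 the value of [`|x| `^ r] is a convention of [powR]; it concerns a
   single point and so does not affect any integral against Lebesgue measure. *)
Definition freud_weight (R : realType) (lam t : R) (m : nat) (x : R) : R :=
  `|x| `^ (2 * lam + 1) * expR (t * x ^+ 2 - x ^+ (2 * m)).

Definition monic_orthogonal_polynomials (R : realType) (w : R -> R)
    (P : nat -> {poly R}) : Prop :=
  (forall n, P n \is monic /\ size (P n) = n.+1) /\
  (forall i j, i <> j ->
     (\int[lebesgue_measure]_(x in setT) ((P i).[x] * (P j).[x] * w x)%:E
      = 0)%E).

Definition freud_scale (R : realType) (m n : nat) : R :=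
  n%:R `^ (2 * m)%:R^-1.

Definition scaled_polynomial (R : realType) (phi : nat -> R)
    (P : nat -> {poly R}) (n N : nat) : {poly R} :=
  (phi N) ^- n *: (P n \Po (phi N *: 'X)).

Definition zero_counting_measure (R : realType) (xs : seq R) :
    {measure set (measurableTypeR R) -> \bar R} :=
  mscale ((size xs)%:R^-1)%:nng
    (msum (fun j => dirac (xs`_j : measurableTypeR R)) (size xs)).

Definition weak_convergence (R : realType)
    (mu_ : nat -> {measure set (measurableTypeR R) -> \bar R})
    (mu : {measure set (measurableTypeR R) -> \bar R}) : Prop :=
  forall g : R -> R, continuous g -> (exists M, forall x, `|g x| <= M) ->
    (\int[mu_ k]_(x in setT) (g x)%:E)%E @[k --> \oo]
      --> (\int[mu]_(x in setT) (g x)%:E)%E.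

(* The zeros are required to be real and are listed with multiplicity. The
   factorisation is only asked for eventually, since the first few terms of the
   sequence [p] do not influence the limit and may be degenerate. *)
Definition asymptotic_zero_density (R : realType) (p : nat -> {poly R})
    (I : set R) (f : R -> R) : Prop :=
  exists (xs : nat -> seq R) (mu : probability (measurableTypeR R) R),
    [/\ \forall k \near \oo, p k = \prod_(z <- xs k) ('X - z%:P),
        forall A : set (measurableTypeR R), measurable A ->
          mu A = (\int[lebesgue_measure]_(x in A `&` I) (f x)%:E)%E
      & weak_convergence (fun k => zero_counting_measure (xs k)) mu].

Definition freud_a (R : realType) (m : nat) : R :=
  2^-1 * (((m.-1)`!)%:R / pochhammer (2^-1) m) `^ (2 * m)%:R^-1.

Definition freud_c (R : realType) (m : nat) (l : R) : R :=
  2 * freud_a R m * l `^ (2 * m)%:R^-1.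

Definition freud_density (R : realType) (m : nat) (l x : R) : R :=
  let c := freud_c m l in
  (2 * m)%:R / (c * pi * (2 * m%:R - 1)) *
  Num.sqrt (1 - x ^+ 2 / c ^+ 2) *
  hypergeometric2F1 1 (1 - m%:R) (3 / 2 - m%:R) (x ^+ 2 / c ^+ 2).

(* Main.v *)
Require Import Defs.
From HB Require Import structures.
From mathcomp Require Import all_boot all_order all_algebra.
From mathcomp Require Import all_classical all_reals all_analysis.
From mathcomp Require Import measurable_realfun polyrcf complex.
From mathcomp Require Import ring lra zify.

Set Implicit Arguments.
Unset Strict Implicit.
Unset Printing Implicit Defensive.

Import Order.TTheory GRing.Theory Num.Theory.
Import numFieldNormedType.Exports.

Local Open Scope classical_set_scope.
Local Open Scope ring_scope.

(* The zeros of [P n] are the eigenvalues of the truncated Jacobi matrix J built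
   from the recurrence coefficients b_k, so the moments of the zeros are traces
   of powers of J. Integration by parts against the weight yields the Freud
   equation 2m b_k (J^(2m-1))_(k-1,k) = k + (2 lam + 1) [k odd] + 2 t b_k, whose
   left-hand side is the derivative of tr J^(2m) along log b_k. As tr J^(2m) is a
   sum of exponentials of linear forms in the log b_k, it is convex in them, and
   its gradient is monotone. Comparing b_k with the model A k^(1/m), which
   satisfies the same equation to leading order, gives b_k ~ A k^(1/m) in the
   mean (a weak form of Freud's conjecture), and this is enough to compute the
   limits of the traces: they are averages over s in [0,1] of the moments of
   arcsine laws on [-s^(1/2m) c, s^(1/2m) c].
   The moments of the density are obtained by a telescoping sum over the
   hypergeometric coefficients and agree with these averages. Since all zeros stay
   in a fixed compact interval, Weierstrass approximation turns convergence of
   moments into weak convergence. *)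

(** * Walks and Jacobi matrices *)

(** The rows of J(x) - J(y) have at most one nonzero entry each, so tr J^p changes by at most a
    constant times the sum of |x_k - y_k|, and after division by n only the mean error counts.
    Convexity alone gives no rate; the closed walks that cross one edge to and fro, with weight
    b_k^m in tr J^(2m), make the monotonicity strong enough to bound the sum of |x_k - y_k|^(2m) by
    O(N^(1-1/m)). This rests on a priori bounds c k <= b_k^m <= K k, which keep the differences of
    logarithms bounded, and it tolerates boundedly many bad rows at both ends, where walks feel the
    truncation or the origin. J is taken in its monic, nonsymmetric form, so that its entries are 1
    and b_k, without square roots. The Freud equation is obtained from the dilation x d/dx rather
    than from d/dx, because |x|^(2 lam + 1) may be singular at 0. The constant A solves 2m C(2m-1,
    m-1) A^m = 1, the leading-order equation for slowly varying coefficients; it equals a^2, whence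
    the endpoints 2 a s^(1/2m) of the arcsine laws. *)

Section Walks.
Variable R : realFieldType.
Implicit Types (b c : nat -> R) (i j k n : nat).

(* The (j, k) entry of the i-th power of the infinite Jacobi matrix with ones
   above the diagonal and the b_s below it; in row 0 this presupposes b_0 = 0,
   since [0.-1 = 0]. *)
Fixpoint walk b i j k : R :=
  if i is i'.+1 then walk b i' j.+1 k + b j * walk b i' j.-1 k
  else (j == k)%:R.

Lemma walk_bound b K i j k : 0 <= K ->
  (forall s, (s <= j + i)%N -> `|b s| <= K) -> `|walk b i j k| <= (1 + K) ^+ i.
Proof.
move=> K0; elim: i j => [|i IHi] j hb /=; first by rewrite expr0; case: eqP;
  rewrite ?normr1 ?normr0.
apply: (le_trans (ler_normD _ _)); rewrite normrM exprS mulrDl mul1r lerD//.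
  by apply: IHi => s hs; apply: hb; lia.
apply: ler_pM => //; first by apply: hb; lia.
by apply: IHi => s hs; apply: hb; lia.
Qed.

Lemma walk_ge0 b i j k : (forall s, 0 <= b s) -> 0 <= walk b i j k.
Proof.
by move=> b0; elim: i j => [|i IHi] j /=; rewrite ?ler0n// addr_ge0 ?mulr_ge0.
Qed.

(** All terms are nonnegative, so it is enough to keep the single walk that crosses the edge between
    j and j+1 to and fro: its i steps down carry the weight [b j.+1] each, its i+1 steps up carry
    1. *)
Lemma walk_zigzag b i j : (forall s, 0 <= b s) ->
  b j.+1 ^+ i <= walk b i.*2.+1 j j.+1.
Proof.
move=> b0; elim: i => [|i IHi].
  by rewrite expr0 /= eqxx lerDl mulr_ge0 ?ler0n.
rewrite exprS doubleS -addn1 addn1.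
change (walk b i.*2.+3 j j.+1) with
  (walk b i.*2.+1 j.+2 j.+1 + b j.+1 * walk b i.*2.+1 j j.+1
   + b j * walk b i.*2.+2 j.-1 j.+1).
apply: (@le_trans _ _ (b j.+1 * walk b i.*2.+1 j j.+1)); first exact: ler_wpM2l.
by rewrite [walk b i.*2.+1 j.+2 j.+1 + _]addrC -addrA lerDl addr_ge0 ?walk_ge0// mulr_ge0//
  walk_ge0.
Qed.

(** The steps are exchanged one at a time. Only indices within distance i of j matter, which allows
    slowly varying coefficients to be frozen at one index. *)
Lemma walk_dist b c K e i j k : 0 <= K -> 0 <= e ->
  (forall s, (s <= j + i)%N -> (j <= s + i)%N ->
     [/\ `|b s| <= K, `|c s| <= K & `|b s - c s| <= e]) ->
  `|walk b i j k - walk c i j k| <= i%:R * (1 + K) ^+ i * e.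
Proof.
move=> K0 e0.
have bound a i' j' : (forall s, (s <= j' + i')%N -> (j' <= s + i')%N -> `|a s| <= K) ->
  `|walk a i' j' k| <= (1 + K) ^+ i'.
  elim: i' j' => [|i' IHi] j' hb /=; first by rewrite expr0; case: eqP; rewrite ?normr1 ?normr0.
  apply: (le_trans (ler_normD _ _)); rewrite normrM exprS mulrDl mul1r lerD//.
    by apply: IHi => s h1 h2; apply: hb; lia.
  apply: ler_pM => //; first by apply: hb; lia.
  by apply: IHi => s h1 h2; apply: hb; lia.
elim: i j => [|i IHi] j h /=; first by rewrite subrr normr0 !mul0r.
have -> : walk b i j.+1 k + b j * walk b i j.-1 k -
   (walk c i j.+1 k + c j * walk c i j.-1 k) =
   (walk b i j.+1 k - walk c i j.+1 k) + ((b j - c j) * walk b i j.-1 k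
   + c j * (walk b i j.-1 k - walk c i j.-1 k)) by ring.
have [hb hc hd] := h j ltac:(lia) ltac:(lia).
have h1 := IHi j.+1 (fun s h1 h2 => h s ltac:(lia) ltac:(lia)).
have h2 := IHi j.-1 (fun s h1 h2 => h s ltac:(lia) ltac:(lia)).
have h3 : `|walk b i j.-1 k| <= (1 + K) ^+ i.
  by apply: bound => s a1 a2; case: (h s ltac:(lia) ltac:(lia)).
apply: (le_trans (ler_normD _ _)); apply: (le_trans (lerD h1 (ler_normD _ _))).
rewrite !normrM.
have p1 := ler_pM (normr_ge0 _) (normr_ge0 _) hd h3.
have p2 := ler_pM (normr_ge0 _) (normr_ge0 _) hc h2.
apply: (le_trans (lerD (lexx _) (lerD p1 p2))).
rewrite exprS; set E := (1 + K) ^+ i.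
have E0 : 0 <= E by rewrite exprn_ge0// addr_ge0.
rewrite -[i.+1]addn1 natrD.
have : 0 <= K * (e * E) by rewrite !mulr_ge0.
lra.
Qed.

Lemma walk_far b i j k : (j + i < k)%N -> walk b i j k = 0.
Proof.
elim: i j => [|i IHi] j h /=; first by case: eqP => //; lia.
by rewrite !IHi ?mulr0 ?addr0//; lia.
Qed.

(** The relation j + i = k + 2d says that the walk makes exactly d steps down, so its weight is
    homogeneous of degree d. The condition on [b 0] removes the spurious step from 0 to [0.-1 = 0],
    which would break this count. *)
Lemma walk_scale b (a : R) i j k d : b 0%N = 0 -> (j + i = k + d.*2)%N ->
  walk (fun s => a * b s) i j k = a ^+ d * walk b i j k.
Proof.
move=> b0; elim: i j d => [|i IHi] j d h /=.
  case: eqP => jk; last by rewrite mulr0.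
  have d0 : d = 0%N by lia.
  by rewrite d0 expr0 mul1r.
rewrite (IHi _ d); last by lia.
case: d h => [|d] h.
  rewrite (@walk_far _ i j.-1) ?(@walk_far b i j.-1) ?mulr0; [by ring|lia..].
case: j h => [|j] h; first by rewrite b0 !(mulr0,mul0r,addr0).
by rewrite /= (IHi _ d) ?exprS; [ring|lia].
Qed.

Lemma walk_cst_odd (a : R) i j k : (i <= j)%N -> odd (i + j + k) ->
  walk (fun=> a) i j k = 0.
Proof.
elim: i j => [|i IHi] j ij h /=.
  by case: eqP => // jk; move: h; rewrite jk addnn odd_double.
by rewrite !IHi ?mulr0 ?addr0//; lia.
Qed.

(** Since i <= j, no step down is ever taken from 0, so the d steps down may be placed freely among
    the i steps. *)
Lemma walk_cst (a : R) i j k d : (i <= j)%N -> (j + i = k + d.*2)%N ->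
  walk (fun=> a) i j k = 'C(i, d)%:R * a ^+ d.
Proof.
elim: i j d => [|i IHi] j d ij h /=.
  case: d h => [|d] h; first by rewrite bin0 mul1r (_ : j == k)//; lia.
  by rewrite (_ : (j == k) = false) ?bin0n ?mul0r//; lia.
rewrite (IHi _ d); [|lia..].
case: d h => [|d] h; first by rewrite (@walk_far _ i j.-1) ?bin0 ?mulr0 ?addr0; [|lia].
rewrite (IHi _ d) ?binS ?natrD ?exprS; [|lia..].
by ring.
Qed.

End Walks.

Section JacobiMatrix.
Variable R : realFieldType.
Implicit Types (b c : nat -> R) (n : nat).

(** Monic normalisation: for positive b it is conjugate, by a diagonal matrix, to the symmetric
    Jacobi matrix with entries sqrt b_i, hence has the same traces. The value [b 0] does not occur
    in it. *)
Definition jacobi b n : 'M[R]_n.+1 :=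
  \matrix_(i, j) ((j == i.+1 :> nat)%:R + b i * (i == j.+1 :> nat)%:R).

(** The factor [(i < n)] is the mark of the truncation: it removes the step up from the last row. In
    row 0 the term with [i.-1] is killed by [b 0 = 0]. *)
Lemma jacobi_row b n (i : 'I_n.+1) (v : nat -> R) :
  b 0%N = 0 ->
  \sum_j jacobi b n i j * v j = (i < n)%:R * v i.+1 + b i * v i.-1.
Proof.
move=> b0; under eq_bigr do rewrite mxE mulrDl.
rewrite big_split /=; congr (_ + _).
  case: ltnP => hi; last first.
    rewrite mul0r big1// => j _; case: eqP => [e|]; last by rewrite mul0r.
    by have := ltn_ord j; lia.
  rewrite (bigD1 (Ordinal (hi : i.+1 < n.+1)%N))//= eqxx big1 ?addr0// => j hj.
  case: eqP => [e|]; last by rewrite mul0r.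
  by move: hj; rewrite -val_eqE /= e eqxx.
case: i => -[|i] hi /=.
  by rewrite b0 big1 ?mul0r// => j _; rewrite !mul0r.
rewrite (bigD1 (Ordinal (ltnW hi : i < n.+1)%N))//= eqxx mulr1 big1 ?addr0// => j hj.
case: eqP => [e|]; last by rewrite mulr0 mul0r.
by move: hj; rewrite -val_eqE /=; case: e => ->; rewrite eqxx.
Qed.

Lemma jacobi_walk b n p (i j : 'I_n.+1) : b 0%N = 0 -> (i + p <= n)%N ->
  (jacobi b n ^+ p) i j = walk b p i j.
Proof.
move=> b0; elim: p i => [|p IHp] i hi; first by rewrite expr0 mxE.
rewrite exprS mxE.
have key (s : 'I_n.+1) : jacobi b n i s * (jacobi b n ^+ p) s j = jacobi b n i s * walk b p s j.
  have [h|h] := leqP s i.+1; first by rewrite IHp//; lia.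
  rewrite mxE; have -> : (s == i.+1 :> nat) = false by lia.
  by rewrite (_ : (i == s.+1 :> nat) = false) ?mulr0 ?addr0 ?mul0r//; lia.
under eq_bigr do rewrite key.
rewrite (jacobi_row _ (fun s => walk b p s j))//=.
by rewrite (_ : (i < n)%N) ?mul1r//; lia.
Qed.

(** The operator norm for the sup norm on vectors: it is submultiplicative, dominates every entry,
    and for [jacobi] its bound does not depend on n. *)
Definition rowsum_le n (A : 'M[R]_n.+1) (K : R) := forall i, \sum_j `|A i j| <= K.

Lemma rowsum_leM n (A B : 'M[R]_n.+1) K M : 0 <= K -> 0 <= M ->
  rowsum_le A K -> rowsum_le B M -> rowsum_le (A * B) (K * M).
Proof.
move=> K0 M0 hA hB i.
apply: (@le_trans _ _ (\sum_j \sum_s `|A i s| * `|B s j|)).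
  apply: ler_sum => j _; rewrite mxE; apply: (le_trans (ler_norm_sum _ _ _)).
  by apply: ler_sum => s _; rewrite normrM.
rewrite exchange_big /=.
apply: (@le_trans _ _ (\sum_s `|A i s| * M)).
  by apply: ler_sum => s _; rewrite -mulr_sumr ler_wpM2l.
by rewrite -mulr_suml ler_wpM2r.
Qed.

Lemma rowsum_leX n (A : 'M[R]_n.+1) K p : 0 <= K ->
  rowsum_le A K -> rowsum_le (A ^+ p) (K ^+ p).
Proof.
move=> K0 hA; elim: p => [|p IHp].
  move=> i; rewrite !expr0 (bigD1 i)//= mxE eqxx normr1 big1 ?addr0// => j hj.
  by rewrite mxE eq_sym (negbTE hj) normr0.
by rewrite !exprS; apply: rowsum_leM => //; rewrite exprn_ge0.
Qed.

Lemma rowsum_le_entry n (A : 'M[R]_n.+1) K i j : rowsum_le A K -> `|A i j| <= K.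
Proof.
move=> /(_ i); apply: le_trans; rewrite (bigD1 j)//= lerDl sumr_ge0//.
Qed.

Lemma rowsum_jacobi b n K : b 0%N = 0 ->
  (forall s, (s <= n)%N -> `|b s| <= K) -> rowsum_le (jacobi b n) (1 + K).
Proof.
move=> b0 hb i.
apply: (@le_trans _ _ (\sum_j jacobi (fun s => `|b s|) n i j * 1)).
  apply: ler_sum => j _; rewrite mulr1 !mxE.
  by apply: (le_trans (ler_normD _ _)); rewrite normrM !normr_nat.
rewrite (jacobi_row _ (fun=> 1)) ?b0 ?normr0// !mulr1 lerD//.
  by case: ltnP => _; rewrite ?ler01.
by apply: hb; rewrite -ltnS.
Qed.

End JacobiMatrix.

(** * Monotonicity of the gradient of the trace *)

Section PathSums.
Variables (R : realType) (n : nat).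
Implicit Types (X Y D : 'M[R]_n.+1) (i j k : 'I_n.+1) (s : seq 'I_n.+1).

(** The vertices visited after i, neighbours or not: the vanishing entries of a matrix give weight 0
    to the inadmissible lists. Such an explicit enumeration turns the trace into a finite sum of
    exponentials. *)
Fixpoint paths p i j : seq (seq 'I_n.+1) :=
  if p is p'.+1 then flatten [seq [seq k :: s | s <- paths p' k j] | k <- enum 'I_n.+1]
  else if i == j then [:: [::]] else [::].

Fixpoint path_prod X i s : R := if s is k :: s' then X i k * path_prod X k s' else 1.

Fixpoint path_sum D i s : R := if s is k :: s' then D i k + path_sum D k s' else 0.

Lemma big_paths p i j (F : seq 'I_n.+1 -> R) :
  \sum_(s <- paths p.+1 i j) F s = \sum_k \sum_(s <- paths p k j) F (k :: s).
Proof.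
by rewrite /= big_flatten big_map big_enum /=; apply: eq_bigr => k _; rewrite big_map.
Qed.

Lemma sum_path_prod X p i j :
  \sum_(s <- paths p i j) path_prod X i s = (X ^+ p) i j.
Proof.
elim: p i => [|p IHp] i; first by rewrite /= expr0 mxE; case: eqP => _; rewrite ?big_seq1 ?big_nil.
rewrite big_paths exprS mxE; apply: eq_bigr => k _ /=.
by rewrite -mulr_sumr IHp.
Qed.

(** The product rule: summing D along a path marks one step at a time, and the marked step replaces
    one factor X by Z. This is the derivative of X^p in the direction Z. *)
Lemma sum_path_prod_sum X D p i j (Z := \matrix_(i, j) (X i j * D i j)) :
  \sum_(s <- paths p i j) path_prod X i s * path_sum D i s =
  (\sum_(a < p) X ^+ a * Z * X ^+ (p.-1 - a)) i j.
Proof.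
elim: p i => [|p IHp] i.
  by rewrite /= big_ord0 mxE; case: eqP => _; rewrite ?big_seq1 ?big_nil //= mulr0.
rewrite big_paths [in RHS]big_ord_recl /= expr0 mul1r subn0.
have -> : \sum_(a < p) X ^+ bump 0 a * Z * X ^+ (p - bump 0 a) =
    X * \sum_(a < p) X ^+ a * Z * X ^+ (p.-1 - a).
  rewrite mulr_sumr; apply: eq_bigr => a _.
  rewrite /bump add1n exprS !mulrA; congr (_ * X ^+ _); lia.
rewrite 3!mxE -big_split /=; apply: eq_bigr => k _.
rewrite -IHp -sum_path_prod !mxE !mulr_sumr -big_split /=.
by apply: eq_bigr => s _; ring.
Qed.

(** By cyclicity of the trace, all p positions of the marked factor contribute the same. *)
Lemma trace_path_sum X D p (Z := \matrix_(i, j) (X i j * D i j)) :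
  \sum_i \sum_(s <- paths p i i) path_prod X i s * path_sum D i s =
  p%:R * \tr (Z * X ^+ p.-1).
Proof.
under eq_bigr do rewrite sum_path_prod_sum.
rewrite -/(mxtrace _) linear_sum /=.
under eq_bigr => a _.
  rewrite -mulrA -!mulmxE mxtrace_mulC !mulmxE -mulrA -exprD subnK;
    last by case: p a => [[]|] //= p a; rewrite -ltnS.
over.
by rewrite sumr_const card_ord mulr_natl.
Qed.

Lemma path_prod_expR X Y D i s : (forall i j, X i j = Y i j * expR (D i j)) ->
  path_prod X i s = path_prod Y i s * expR (path_sum D i s).
Proof.
move=> h; elim: s i => [|k s IHs] i /=; first by rewrite expR0 mulr1.
by rewrite h IHs expRD; ring.
Qed.

Lemma path_prod_ge0 X i s : (forall i j, 0 <= X i j) -> 0 <= path_prod X i s.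
Proof. by move=> h; elim: s i => //= k s IHs i; rewrite mulr_ge0. Qed.

(** With d the sum of D along the path, the term is a nonnegative multiple of (e^d - 1) d. *)
Lemma path_term_ge0 X Y D i s : (forall i j, 0 <= Y i j) ->
  (forall i j, X i j = Y i j * expR (D i j)) ->
  0 <= (path_prod X i s - path_prod Y i s) * path_sum D i s.
Proof.
move=> Y0 h; rewrite (path_prod_expR i s h) -{2}[path_prod Y i s]mulr1 -mulrBr -mulrA.
rewrite mulr_ge0 ?path_prod_ge0//; set d := path_sum _ _ _.
have [d0|/ltW d0] := leP 0 d.
  by rewrite mulr_ge0// subr_ge0 -expR0 ler_expR.
by rewrite mulr_le0// subr_le0 -expR0 ler_expR.
Qed.

Definition zigzag_path p i j := flatten (nseq p [:: j; i]).

Lemma zigzag_path_in p i j : zigzag_path p i j \in paths p.*2 i i.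
Proof.
elim: p => [|p IHp]; first by rewrite /= eqxx inE.
rewrite doubleS /=; apply/flattenP; exists [seq j :: s | s <- paths p.*2.+1 j i].
  by apply/mapP; exists j; rewrite ?mem_enum.
apply/mapP; exists (i :: zigzag_path p i j) => //.
apply/flattenP; exists [seq i :: s | s <- paths p.*2 i i].
  by apply/mapP; exists i; rewrite ?mem_enum.
by apply/mapP; exists (zigzag_path p i j).
Qed.

Lemma zigzag_path_prod X p i j :
  path_prod X i (zigzag_path p i j) = (X i j * X j i) ^+ p.
Proof. by elim: p => //= p IHp; rewrite IHp exprS mulrA. Qed.

Lemma zigzag_path_sum D p i j :
  path_sum D i (zigzag_path p i j) = p%:R * (D i j + D j i).
Proof.
elim: p => [|p IHp]; first by rewrite mul0r.
by rewrite /= IHp -[p.+1]addn1 natrD; ring.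
Qed.

Lemma ler_sum_mem (T : eqType) (r : seq T) (F : T -> R) x :
  x \in r -> (forall y, 0 <= F y) -> F x <= \sum_(y <- r) F y.
Proof.
by move=> xr F0; rewrite (big_rem _ xr)/= lerDl sumr_ge0.
Qed.

(* The trace of the p-th power is a sum of exponentials of linear forms in the
   logarithms of the entries, so its gradient in these logarithms is monotone;
   the closed walks going to and fro along one edge give the lower bound. *)
Lemma jacobi_monotone (x y d : nat -> R) m :
  x 0%N = 0 -> y 0%N = 0 -> d 0%N = 0 -> (forall k, 0 <= y k) ->
  (forall k, x k = y k * expR (d k)) ->
  \sum_(k < n.+1) m%:R * d k * (x k ^+ m - y k ^+ m) <=
  m.*2%:R * \sum_(k < n.+1) d k *
     (x k * (jacobi x n ^+ m.*2.-1) (inord k.-1) k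
      - y k * (jacobi y n ^+ m.*2.-1) (inord k.-1) k).
Proof.
move=> x0 y0 d0 yge0 xyd.
(* Passing from y to x multiplies only the entries (k, k-1), so [D] carries [d k] there and 0
   elsewhere. *)
pose D : 'M[R]_n.+1 := \matrix_(i, j) ((i == j.+1 :> nat)%:R * d i).
have XYD i j : jacobi x n i j = jacobi y n i j * expR (D i j).
  rewrite !mxE; case: (i =P j.+1 :> nat) => [ij|_];
    last by rewrite /= !mulr0n !(mulr0, mul0r) expR0 mulr1.
  have -> : (j == i.+1 :> nat) = false by lia.
  by rewrite xyd /= !mulr1n mulr0n !add0r !mulr1 mul1r.
have Y0 i j : 0 <= jacobi y n i j by rewrite mxE addr_ge0 ?mulr_ge0.
have trE (z : nat -> R) : z 0%N = 0 -> \tr ((\matrix_(i,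
  j) (jacobi z n i j * D i j)) * jacobi z n ^+ m.*2.-1)
    = \sum_(k < n.+1) d k * (z k * (jacobi z n ^+ m.*2.-1) (inord k.-1) k).
  move=> z0; apply: eq_bigr => i _; rewrite mxE.
  case: (posnP i) => [i0|i0].
    rewrite i0 d0 mul0r big1// => j _; rewrite !mxE.
    by rewrite (_ : (i == j.+1 :> nat) = false) ?mul0r ?mulr0 ?mul0r//; lia.
  have vi : (inord i.-1 : 'I_n.+1) = i.-1 :> nat by rewrite inordK//; have := ltn_ord i; lia.
  rewrite (bigD1 (inord i.-1))//= big1 ?addr0; last first.
    move=> j jn; rewrite !mxE (_ : (i == j.+1 :> nat) = false) ?mul0r ?mulr0 ?mul0r//.
    apply/eqP => ij; case/eqP: jn; apply: val_inj; rewrite /= vi ij//.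
  rewrite !mxE vi (_ : (i == i.-1.+1 :> nat)); last by lia.
  rewrite (_ : (i.-1 == i.+1 :> nat) = false); last by lia.
  by rewrite /= !mulr1n mulr0n; ring.
have -> : m.*2%:R * \sum_(k < n.+1) d k *
     (x k * (jacobi x n ^+ m.*2.-1) (inord k.-1) k
      - y k * (jacobi y n ^+ m.*2.-1) (inord k.-1) k) =
   \sum_i \sum_(s <- paths m.*2 i i)
     (path_prod (jacobi x n) i s - path_prod (jacobi y n) i s) * path_sum D i s.
  under [RHS]eq_bigr do under eq_bigr do rewrite mulrBl.
  under [RHS]eq_bigr do rewrite sumrB.
  rewrite sumrB !trace_path_sum !trE// -mulrBr -sumrB; congr (_ * _).
  by apply: eq_bigr => k _; rewrite mulrBr.
(* Row by row: among the nonnegative contributions of the closed paths based at k, only that of the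
   path k, k-1, k, ... of length 2m is kept. *)
apply: ler_sum => k _.
case: (posnP k) => [k0|k0].
  rewrite k0 d0 mulr0 mul0r sumr_ge0// => s _; exact: path_term_ge0.
pose j : 'I_n.+1 := inord k.-1.
have vj : j = k.-1 :> nat by rewrite inordK//; have := ltn_ord k; lia.
have k_eq : (k == j.+1 :> nat) by lia.
have := ler_sum_mem (zigzag_path_in m k j) (fun s => path_term_ge0 k s Y0 XYD).
apply: le_trans.
rewrite !zigzag_path_prod zigzag_path_sum !mxE k_eq.
rewrite (_ : (j == k.+1 :> nat) = false); last by lia.
rewrite !(mulr0, mul0r, add0r, addr0, mulr1, mul1r) le_eqVlt; apply/orP; left; apply/eqP.
by ring.
Qed.

End PathSums.

(** * Elementary inequalities for powers, roots and logarithms *)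

Section PowerInequalities.
Variable R : realType.
Implicit Types (a b : R) (m n : nat).

Lemma exprD_ge m a b : (0 < m)%N -> 0 <= a -> 0 <= b -> a ^+ m + b ^+ m <= (a + b) ^+ m.
Proof.
move=> m0 a0 b0; case: m m0 => // m _; elim: m => [|m IHm]; first by rewrite !expr1.
rewrite [(a + b) ^+ _]exprS; apply: (@le_trans _ _ ((a + b) * (a ^+ m.+1 + b ^+ m.+1))).
  rewrite [a ^+ m.+2]exprS [b ^+ m.+2]exprS.
  have : 0 <= a * b ^+ m.+1 by rewrite mulr_ge0// exprn_ge0.
  have : 0 <= b * a ^+ m.+1 by rewrite mulr_ge0// exprn_ge0.
  lra.
by rewrite ler_wpM2l// addr_ge0.
Qed.

(** Superadditivity of the power, applied to a = (a - b) + b when b <= a. *)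
Lemma exprn_dist m a b : (0 < m)%N -> 0 <= a -> 0 <= b ->
  `|a - b| ^+ m <= `|a ^+ m - b ^+ m|.
Proof.
move=> m0; wlog ab : a b / b <= a => [hw a0 b0|a0 b0].
  have [ab|/ltW ab] := leP b a; first exact: hw.
  by rewrite distrC [`|a ^+ m - _|]distrC hw.
have ab0 : 0 <= a - b by rewrite subr_ge0.
have := exprD_ge m0 ab0 b0; rewrite subrK => h.
rewrite ger0_norm// ger0_norm ?lerBrDr// add0r lerXn2r ?nnegrE//.
Qed.

Definition natroot m n : R := n%:R `^ m%:R^-1.

Lemma natroot_ge0 m n : 0 <= natroot m n. Proof. exact: powR_ge0. Qed.

Lemma natrootK m n : (0 < m)%N -> natroot m n ^+ m = n%:R.
Proof.
move=> m0; rewrite -powR_mulrn ?natroot_ge0// -powRrM mulVf ?powRr1//.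
by rewrite pnatr_eq0 -lt0n.
Qed.

Lemma natroot0 m : (0 < m)%N -> natroot m 0 = 0.
Proof. by move=> m0; rewrite /natroot powR0// invr_eq0 pnatr_eq0 -lt0n. Qed.

Lemma natroot_gt0 m n : (0 < n)%N -> 0 < natroot m n.
Proof. by move=> n0; rewrite powR_gt0// ltr0n. Qed.

Lemma ler_natroot m n p : (n <= p)%N -> natroot m n <= natroot m p.
Proof. by move=> np; rewrite ge0_ler_powR// ?nnegrE// ler_nat. Qed.

Lemma natroot_ge1 m n : (0 < n)%N -> 1 <= natroot m n.
Proof. by move=> n0; have := @ler_natroot m 1 n n0; rewrite {1}/natroot powR1. Qed.

(** Hölder continuity of order 1/m: over a bounded window of indices the model moves by O(1) before
    scaling, hence by O(N^(-1/m)) after it. *)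
Lemma natroot_dist m n p q : (0 < m)%N -> (n <= p + q)%N -> (p <= n + q)%N ->
  `|natroot m n - natroot m p| <= natroot m q.
Proof.
move=> m0 np pn.
rewrite -(@ler_pXn2r _ m)// ?nnegrE ?natroot_ge0//.
apply: (le_trans (exprn_dist m0 (natroot_ge0 _ _) (natroot_ge0 _ _))).
rewrite !natrootK// ler_norml.
have h1 : n%:R <= p%:R + q%:R :> R by rewrite -natrD ler_nat.
have h2 : p%:R <= n%:R + q%:R :> R by rewrite -natrD ler_nat.
by apply/andP; split; lra.
Qed.

(** The slope of ln is at least 1/K on (0, K], so ln is strongly monotone there. *)
Lemma ln_monotone (a b K : R) : 0 < a -> 0 < b -> a <= K -> b <= K ->
  (a - b) ^+ 2 <= K * ((ln a - ln b) * (a - b)).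
Proof.
wlog ab : a b / b <= a => [hw a0 b0 aK bK|a0 b0 aK bK].
  have [ab|/ltW ab] := leP b a; first exact: hw.
  have := hw b a ab b0 a0 bK aK.
  rewrite (_ : (b - a) ^+ 2 = (a - b) ^+ 2); last by ring.
  by rewrite (_ : (ln b - ln a) * (b - a) = (ln a - ln b) * (a - b)) //; ring.
have h : (a - b) / a <= ln a - ln b.
  rewrite mulrDl mulNr divff ?gt_eqF// -ln_div ?posrE//.
  have ba0 : 0 < b / a by rewrite divr_gt0.
  have := @le_ln1Dx R (b / a - 1).
  rewrite [1 + _]addrC subrK; move=> /(_ ltac:(lra)).
  by rewrite !ln_div ?posrE//; lra.
rewrite mulrA expr2 ler_wpM2r ?subr_ge0//.
have K0 : 0 < K by lra.
rewrite -ler_pdivrMl// mulrC; apply: le_trans h.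
by rewrite ler_wpM2l ?subr_ge0// lef_pV2 ?posrE.
Qed.

Lemma norm_ln_bound (a lo hi : R) : 0 < lo -> lo <= a -> a <= hi ->
  `|ln a| <= `|ln lo| + `|ln hi|.
Proof.
move=> lo0 loa ahi; have a0 : 0 < a by lra.
have h1 : ln lo <= ln a by rewrite ler_ln ?posrE.
have h2 : ln a <= ln hi by rewrite ler_ln ?posrE//; lra.
have := ler_norm (ln hi); have := ler_norm (- ln lo); rewrite normrN.
have := normr_ge0 (ln hi); have := normr_ge0 (ln lo).
by case: (ger0P (ln a)); lra.
Qed.

End PowerInequalities.

Section BulkSum.
Variable R : realFieldType.

Lemma sum_lt_le n L : \sum_(k < n) ((k < L)%N%:R : R) <= L%:R.
Proof.
rewrite -natr_sum ler_nat (_ : (\sum_(k < n) (k < L) = minn n L)%N) ?geq_minr//.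
by elim: n => [|n IHn]; rewrite ?big_ord0 ?min0n// big_ord_recr /= IHn; case: ltnP; lia.
Qed.

(** Separates the bulk from the two boundary layers, where the identities for walks fail and a
    uniform bound has to do. *)
Lemma bulk_sum (f : nat -> R) n L C e : 0 <= C -> 0 <= e ->
  (forall k, (k <= n)%N -> `|f k| <= C) ->
  (forall k, (L <= k)%N -> (k + L <= n)%N -> `|f k| <= e) ->
  `|\sum_(k < n.+1) f k| <= n.+1%:R * e + L.*2%:R * C.
Proof.
move=> C0 e0 hC he.
apply: (le_trans (ler_norm_sum _ _ _)).
apply: (@le_trans _ _ (\sum_(k < n.+1) (e + (k < L)%N%:R * C + (n < k + L)%N%:R * C))).
  apply: ler_sum => k _.
  have hk := hC k ltac:(have := ltn_ord k; lia).
  case: (ltnP k L) => h1; case: (ltnP n (k + L)) => h2; rewrite /= ?mulr1n ?mulr0n; try lra.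
  by have := he k h1 h2; lra.
rewrite !big_split /= sumr_const card_ord -[e *+ _]mulr_natl -!mulr_suml -addrA lerD2l.
rewrite -mulrDl ler_wpM2r// -addnn natrD lerD ?sum_lt_le//.
rewrite (reindex_inj rev_ord_inj) /=.
apply: le_trans (sum_lt_le n.+1 L); apply: ler_sum => k _; rewrite ler_nat.
by have := ltn_ord k; case: (ltnP n) => //; case: ltnP => //; lia.
Qed.

End BulkSum.

(** * The Freud equation *)

(* [lia] is slow in contexts with many facts about reals. *)
Ltac natlia := repeat match goal with
  | H : is_true (@Order.le _ _ _ _) |- _ => clear H
  | H : is_true (@Order.lt _ _ _ _) |- _ => clear H
  | H : forall _, _ |- _ => clear H
  | H := _ : Real.sort _ |- _ => clearbody H
  | H := _ : nat -> Real.sort _ |- _ => clearbody H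
  end; lia.

Section FreudEquation.
Variables (R : realType) (m : nat) (t C0 c0 : R) (beta e : nat -> R).
Hypotheses (hm : (2 <= m)%N) (beta0 : beta 0%N = 0)
  (beta_gt0 : forall k, (0 < k)%N -> 0 < beta k)
  (c0_gt0 : 0 < c0)
  (e_le : forall k, `|e k| <= C0)
  (e_ge : forall k, c0 * k%:R <= k%:R + e k).

Definition freud_lhs (b : nat -> R) k : R := m.*2%:R * b k * walk b m.*2.-1 k.-1 k.

Hypothesis freud_eq : forall k, (0 < k)%N ->
  freud_lhs beta k = k%:R + e k + 2 * t * beta k.

Let m0 : (0 < m)%N. Proof. natlia. Qed.

Let beta_ge0 k : 0 <= beta k.
Proof. by case: k => [|k]; [rewrite beta0|exact/ltW/beta_gt0]. Qed.

Let C00 : 0 <= C0. Proof. exact: le_trans (e_le 0). Qed.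

(** The to-and-fro walk bounds [freud_lhs] below by 2m b_k^m. Either b_k is at most Q, or b_k > Q >=
    |2t| and then 2 t b_k <= b_k^2 <= b_k^m, which the factor 2m >= 4 absorbs. *)
Lemma beta_upper : exists2 K, 1 <= K & forall k, beta k ^+ m <= K * k%:R.
Proof.
pose Q := Num.max 1 `|2 * t|.
have hC0 := C00.
have Q1 : 1 <= Q by rewrite le_max lexx.
have Qt : `|2 * t| <= Q by rewrite le_max lexx orbT.
exists (Q ^+ m + C0 + 1); first by have := exprn_ege1 m Q1; lra.
move=> [|k]; first by rewrite beta0 expr0n mulr0 gtn_eqF.
have k1 : 1 <= k.+1%:R :> R by rewrite ler1n.
have b0 := beta_ge0 k.+1.
have [h|h] := leP (beta k.+1) Q.
  apply: (@le_trans _ _ (Q ^+ m)); first by rewrite lerXn2r// nnegrE; lra.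
  have := exprn_ege1 m Q1; nra.
have := freud_eq (ltn0Sn k); rewrite /freud_lhs.
have := walk_zigzag m.-1 k beta_ge0.
rewrite (_ : m.-1.*2.+1 = m.*2.-1); last by natlia.
rewrite -[k.+1.-1]/k.
set w := walk _ _ _ _ => hw hE.
have hw2 : beta k.+1 ^+ m <= beta k.+1 * w.
  by rewrite -[X in _ ^+ X](prednK m0) exprS ler_wpM2l.
have m4 : 4 <= m.*2%:R :> R by rewrite ler_nat; natlia.
have hb2 : 2 * t * beta k.+1 <= beta k.+1 ^+ m.
  apply: (@le_trans _ _ (beta k.+1 * beta k.+1)).
    by rewrite ler_wpM2r//; have := ler_norm (2 * t); lra.
  rewrite -expr2 ler_weXn2l//; lra.
have he := ler_norm (e k.+1); have he' := e_le k.+1.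
have bm : 0 <= beta k.+1 ^+ m by rewrite exprn_ge0.
have : 4 * beta k.+1 ^+ m <= k.+1%:R + C0 + beta k.+1 ^+ m.
  apply: (@le_trans _ _ (m.*2%:R * beta k.+1 * w)); last by rewrite hE; lra.
  by rewrite -mulrA ler_pM.
have Qm : 0 <= Q ^+ m by rewrite exprn_ge0//; lra.
have : C0 * 1 <= C0 * k.+1%:R by rewrite ler_wpM2l.
have : 0 <= Q ^+ m * k.+1%:R by rewrite mulr_ge0.
lra.
Qed.

Section Scaled.
Variables (K : R).
Hypotheses (K1 : 1 <= K) (betaK : forall k, beta k ^+ m <= K * k%:R).

(** The coefficients scale like the squares of the zeros, hence the root of order m where the zeros
    have order 2m. *)
Definition scaled_beta N k : R := beta k / natroot R m N.

Lemma scaled_beta0 N : scaled_beta N 0 = 0. Proof. by rewrite /scaled_beta beta0 mul0r. Qed.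

Lemma scaled_beta_ge0 N k : 0 <= scaled_beta N k.
Proof. by rewrite divr_ge0 ?natroot_ge0. Qed.

Lemma scaled_betaX N k : scaled_beta N k ^+ m = beta k ^+ m / N%:R.
Proof. by rewrite expr_div_n natrootK. Qed.

Lemma scaled_beta_le N k : (k <= N)%N -> scaled_beta N k <= K.
Proof.
move=> kN; case: (posnP N) => [N0|N0].
  move: kN; rewrite N0 leqn0 => /eqP ->; rewrite scaled_beta0. by have := K1; lra.
rewrite -(@ler_pXn2r _ m)// ?nnegrE ?scaled_beta_ge0//; last by have := K1; lra.
apply: (@le_trans _ _ K); last by rewrite ler_eXnr.
rewrite scaled_betaX ler_pdivrMr ?ltr0n// (le_trans (betaK k))//.
by rewrite ler_wpM2l ?ler_nat//; have := K1; lra.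
Qed.

(** A walk of 2m - 1 steps from k-1 to k makes m - 1 steps down, and [b k] supplies the m-th
    factor. *)
Lemma freud_lhs_scale (b : nat -> R) s k : b 0%N = 0 -> (0 < k)%N ->
  freud_lhs (fun j => s * b j) k = s ^+ m * freud_lhs b k.
Proof.
move=> b0 k0; rewrite /freud_lhs (@walk_scale _ b s _ _ _ m.-1)//; last natlia.
have -> : s ^+ m = s * s ^+ m.-1 by rewrite -exprS prednK.
by ring.
Qed.

Lemma freud_lhs_scaled N k : (0 < k)%N ->
  freud_lhs (scaled_beta N) k = freud_lhs beta k / N%:R.
Proof.
move=> k0; rewrite -(natrootK R N m0) [RHS]mulrC -exprVn -freud_lhs_scale//.
by congr freud_lhs; apply/funext => j; rewrite /scaled_beta mulrC.
Qed.

(** After scaling the walks involved are bounded, so the left-hand side of the Freud equation is at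
    most a constant times the scaled b_k. The right-hand side is at least c0 k up to the term in t,
    which is linear in b_k as well. *)
Lemma beta_lower : exists2 c, 0 < c & forall k, c * k%:R <= beta k ^+ m.
Proof.
pose Q := m.*2%:R * (1 + K) ^+ m.*2.-1 + `|2 * t| + 1.
have p0 : 0 <= (1 + K) ^+ m.*2.-1 by rewrite exprn_ge0//; have := K1; lra.
have Q1 : 0 < Q.
  have : 0 <= m.*2%:R * (1 + K) ^+ m.*2.-1 by rewrite mulr_ge0.
  by have := normr_ge0 (2 * t); rewrite /Q; lra.
pose c1 := c0 / (m.*2.+1%:R * Q).
have c10 : 0 < c1 by rewrite divr_gt0// mulr_gt0// ltr0n.
exists (c1 ^+ m); first by rewrite exprn_gt0.
move=> [|k]; first by rewrite beta0 expr0n mulr0 gtn_eqF.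
(* This N leaves room for the 2m - 1 steps of the walk, while N <= (2m + 1)(k + 1) keeps it
   comparable with the index. *)
pose N := (k.+1 + m.*2)%N; set b := scaled_beta N.
have hb : c1 <= b k.+1.
  have hw : `|walk b m.*2.-1 k k.+1| <= (1 + K) ^+ m.*2.-1.
    apply: walk_bound; first by have := K1; lra.
    by move=> s hs; rewrite ger0_norm ?scaled_beta_ge0// scaled_beta_le// /N; natlia.
  have bk0 : 0 <= b k.+1 by exact: scaled_beta_ge0.
  have N0 : 0 < N%:R :> R by rewrite ltr0n /N; natlia.
  have hE := freud_eq (ltn0Sn k).
  have hEs := freud_lhs_scaled N (ltn0Sn k).
  have rt1 : 1 <= natroot R m N by apply: natroot_ge1; rewrite /N; natlia.
  have betaE : beta k.+1 = b k.+1 * natroot R m N by rewrite /b /scaled_beta divfK// gt_eqF//;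
    have := K1; lra.
  have rtN : natroot R m N <= N%:R by rewrite -[X in _ <= X](natrootK R N m0) ler_eXnr.
  have h1 : freud_lhs b k.+1 <= b k.+1 * (m.*2%:R * (1 + K) ^+ m.*2.-1).
    rewrite /freud_lhs -[k.+1.-1]/k [m.*2%:R * b _]mulrC -mulrA ler_wpM2l// ler_wpM2l//.
    by apply: le_trans hw; exact: ler_norm.
  have h2 : freud_lhs beta k.+1 <= N%:R * (b k.+1 * (m.*2%:R * (1 + K) ^+ m.*2.-1)).
    by rewrite mulrC -ler_pdivrMr// -hEs.
  have h3 : - (2 * t * beta k.+1) <= N%:R * (b k.+1 * `|2 * t|).
    apply: (@le_trans _ _ (`|2 * t| * beta k.+1)).
      by rewrite -mulNr ler_wpM2r// -normrN ler_norm.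
    rewrite betaE; have -> : `|2 * t| * (b k.+1 * natroot R m N) = natroot R m N * (b k.+1 * `|2
      * t|) by ring.
    by rewrite ler_wpM2r// mulr_ge0.
  have h4 : c0 * k.+1%:R <= N%:R * (b k.+1 * Q).
    have : 0 <= N%:R * b k.+1 by rewrite mulr_ge0// ltW.
    by have := e_ge k.+1; rewrite /Q; lra.
  have h5 : N%:R <= m.*2.+1%:R * k.+1%:R :> R by rewrite -natrM ler_nat mulSn leq_add2l leq_pmulr.
  have k0 : 0 < k.+1%:R :> R by rewrite ltr0n.
  rewrite /c1 ler_pdivrMr; last by rewrite mulr_gt0// ltr0n.
  rewrite -(ler_pM2r k0); apply: (le_trans h4).
  rewrite (_ : b k.+1 * (m.*2.+1%:R * Q) * k.+1%:R = m.*2.+1%:R * k.+1%:R * (b k.+1 * Q));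
    last by ring.
  by rewrite ler_wpM2r// mulr_ge0// ltW.
have : c1 ^+ m <= b k.+1 ^+ m by rewrite lerXn2r// nnegrE ?scaled_beta_ge0// ltW.
have N0 : 0 < N%:R :> R by rewrite ltr0n /N; natlia.
rewrite /b scaled_betaX ler_pdivlMr// => h; apply: le_trans h.
by rewrite ler_wpM2l ?exprn_ge0 ?ltW// ltr_nat /N; natlia.
Qed.

End Scaled.

Variables (A : R).
Hypotheses (A0 : 0 < A) (AX : A ^+ m * (m.*2 * 'C(m.*2.-1, m.-1))%:R = 1).

(** By the normalisation of A, coefficients frozen at the value for k satisfy the Freud equation
    with right-hand side exactly k/N as soon as k >= 2m. *)
Definition model_beta N k : R := A * natroot R m k / natroot R m N.

Lemma model_betaX N k : model_beta N k ^+ m = A ^+ m * k%:R / N%:R.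
Proof. by rewrite expr_div_n exprMn !natrootK. Qed.

Lemma model_beta_ge0 N k : 0 <= model_beta N k.
Proof. by rewrite divr_ge0 ?mulr_ge0 ?natroot_ge0// ltW. Qed.

Lemma AX_le1 : A ^+ m <= 1.
Proof.
rewrite -[X in _ <= X]AX -[X in X <= _]mulr1 ler_wpM2l ?exprn_ge0 ?(ltW A0)//.
by rewrite ler1n muln_gt0 bin_gt0; natlia.
Qed.

Lemma model_beta0 N : model_beta N 0 = 0.
Proof. by rewrite /model_beta natroot0// mulr0 mul0r. Qed.

Lemma model_beta_le1 N k : (k <= N)%N -> model_beta N k <= 1.
Proof.
move=> kN; case: (posnP N) => [N0|N0].
  by move: kN; rewrite N0 leqn0 => /eqP ->; rewrite model_beta0.
rewrite -(@ler_pXn2r _ m)// ?nnegrE ?model_beta_ge0// expr1n model_betaX.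
have N0' : 0 < N%:R :> R by rewrite ltr0n.
rewrite ler_pdivrMr// mul1r.
apply: (@le_trans _ _ (1 * k%:R)); first by rewrite ler_wpM2r ?AX_le1.
by rewrite mul1r ler_nat.
Qed.

Lemma model_beta_dist N k s p : (s <= k + p)%N -> (k <= s + p)%N ->
  `|model_beta N s - model_beta N k| <= A * natroot R m p / natroot R m N.
Proof.
move=> h1 h2; rewrite /model_beta -mulrBl -mulrBr !normrM (ger0_norm (ltW A0)).
rewrite [`|_^-1|]ger0_norm ?invr_ge0 ?natroot_ge0// ler_wpM2r ?invr_ge0 ?natroot_ge0//.
by rewrite ler_wpM2l ?(ltW A0)// natroot_dist.
Qed.

Lemma freud_lhs_cst (a : R) k : (m.*2 <= k)%N ->
  freud_lhs (fun=> a) k = (m.*2 * 'C(m.*2.-1, m.-1))%:R * a ^+ m.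
Proof.
move=> hk; rewrite /freud_lhs (@walk_cst _ a _ _ _ m.-1); [|natlia..].
have -> : a ^+ m = a * a ^+ m.-1 by rewrite -exprS prednK.
by rewrite natrM; ring.
Qed.

(* The logarithms of the scaled coefficients and of the model are compared
   through [jacobi_monotone]; both gradients are k/N up to O(N^(-1/m)). *)
Lemma beta_model_dist : exists Q, forall n,
  \sum_(k < n.+1) `|scaled_beta n.+1 k - model_beta n.+1 k| ^+ m.*2 <=
  Q * n.+1%:R / natroot R m n.+1.
Proof.
have [K K1 betaK] := beta_upper.
have [c c1 betac] := beta_lower K1 betaK.
pose Am := A ^+ m; have Am0 : 0 < Am by rewrite exprn_gt0.
(* [Cw] bounds ln (x_k^m / y_k^m) = ln (b_k^m / (k A^m)), in which N cancels; the a priori bounds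
   place b_k^m / k in [c, K]. *)
pose Cw := `|ln (c / Am)| + `|ln (K / Am)|.
have Cw0 : 0 <= Cw by rewrite addr_ge0.
pose P := (1 + K) ^+ m.*2.-1.
have P0 : 0 <= P by rewrite exprn_ge0//; lra.
pose B := m.*2%:R * K * P.
have B0 : 0 <= B by rewrite !mulr_ge0//; lra.
(* [e1] collects the corrections e_k and 2 t b_k in the Freud equation for x; [e2] is the price of
   freezing the model at one index. *)
pose e1 := C0 + `|2 * t| * K.
have e10 : 0 <= e1 by rewrite addr_ge0// mulr_ge0//; lra.
pose e2 := m.*2%:R * (m.*2.-1%:R * P * (A * natroot R m m.*2)).
have e20 : 0 <= e2 by rewrite !mulr_ge0// ?ltW// natroot_gt0//; natlia.
exists (K * (Cw * (e1 + e2) + m.*2.*2%:R * (Cw * (B + B)))) => n.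
set N := n.+1; set x := scaled_beta N; set y := model_beta N.
have N0 : 0 < N%:R :> R by rewrite ltr0n.
set s := natroot R m N; have s1 : 1 <= s by exact: natroot_ge1.
have s0 : 0 < s by lra.
(* Here m >= 2 enters, through s^2 <= s^m = N. After division by N the correction 2 t b_k is O(s/N),
   and this makes it O(1/s). *)
have sN : s <= N%:R / s.
  rewrite ler_pdivlMr// -[X in _ <= X](natrootK R N m0) -/s -expr2.
  by rewrite ler_weXn2l.
have x0 : x 0%N = 0 by exact: scaled_beta0.
have y0 : y 0%N = 0 by exact: model_beta0.
have xge0 k : 0 <= x k by exact: scaled_beta_ge0.
have yge0 k : 0 <= y k by exact: model_beta_ge0.
have xgt0 k : (0 < k)%N -> 0 < x k by move=> k0; rewrite divr_gt0// beta_gt0.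
have ygt0 k : (0 < k)%N -> 0 < y k by move=> k0; rewrite divr_gt0// mulr_gt0// natroot_gt0.
pose d k := if k is 0 then 0 else ln (x k) - ln (y k).
have d0 : d 0%N = 0 by [].
have xyd k : x k = y k * expR (d k).
  case: k => [|k]; first by rewrite x0 y0 mul0r.
  by rewrite /d expRB !lnK ?posrE ?xgt0 ?ygt0// mulrC divfK// gt_eqF// ygt0.
have xK k : (k <= N)%N -> x k <= K by move=> kN; exact: scaled_beta_le.
have yK k : (k <= N)%N -> y k <= K by move=> kN; apply: le_trans K1; exact: model_beta_le1.
have dX k : (0 < k)%N -> m%:R * d k = ln (x k ^+ m) - ln (y k ^+ m).
  by case: k => // k _; rewrite !lnXn ?xgt0 ?ygt0// -mulrnBl mulr_natl.
have dCw k : `|d k| <= Cw.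
  case: (posnP k) => [->|k0]; first by rewrite d0 normr0.
  apply: (@le_trans _ _ `|m%:R * d k|).
    by rewrite normrM ler_peMl// ger0_norm// ler1n.
  have k0' : 0 < k%:R :> R by rewrite ltr0n.
  rewrite dX// -ln_div ?posrE ?exprn_gt0 ?xgt0 ?ygt0//.
  have -> : x k ^+ m / y k ^+ m = beta k ^+ m / k%:R / Am.
    rewrite scaled_betaX model_betaX /Am; field.
    by rewrite !gt_eqF.
  apply: norm_ln_bound; first exact: divr_gt0.
    by rewrite ler_pM2r ?invr_gt0// ler_pdivlMr.
  by rewrite ler_pM2r ?invr_gt0// ler_pdivrMr.
have key := @jacobi_monotone R n x y d m x0 y0 d0 yge0 xyd.
(* Two inequalities are chained: |x - y|^(2m) <= (x^m - y^m)^2, and the strong monotonicity of ln on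
   (0, K]. *)
have step1 : \sum_(k < n.+1) `|x k - y k| ^+ m.*2 <=
    K * \sum_(k < n.+1) m%:R * d k * (x k ^+ m - y k ^+ m).
  rewrite mulr_sumr; apply: ler_sum => k _.
  have kN : (k <= N)%N by have := ltn_ord k; natlia.
  have K0 : 0 <= K by lra.
  case: (posnP k) => [->|k0].
    rewrite x0 y0 subrr normr0 d0 mulr0 mul0r mulr0 expr0n.
    by rewrite (_ : (m.*2 == 0)%N = false)//; natlia.
  rewrite dX// -muln2 exprM.
  apply: (@le_trans _ _ ((x k ^+ m - y k ^+ m) ^+ 2)).
    rewrite -[X in _ <= X]ger0_norm ?sqr_ge0// normrX.
    by rewrite lerXn2r ?nnegrE ?exprn_ge0// exprn_dist.
  have xm : x k ^+ m <= K.
    rewrite scaled_betaX ler_pdivrMr// (le_trans (betaK k))//.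
    by rewrite ler_wpM2l// ler_nat.
  have ym : y k ^+ m <= K.
    by apply: le_trans K1; rewrite exprn_ile1// model_beta_le1.
  by apply: ln_monotone; rewrite ?exprn_gt0 ?xgt0 ?ygt0.
apply: (le_trans step1).
have -> : K * (Cw * (e1 + e2) + m.*2.*2%:R * (Cw * (B + B))) * N%:R / s =
  K * ((Cw * (e1 + e2) + m.*2.*2%:R * (Cw * (B + B))) * (N%:R / s)) by ring.
rewrite ler_wpM2l//; first lra.
apply: (le_trans key).
have entry_bound (z : nat -> R) k : z 0%N = 0 -> (forall j,
  (j <= n)%N -> `|z j| <= K) -> (k <= n)%N ->
   `|m.*2%:R * z k * (jacobi z n ^+ m.*2.-1) (inord k.-1) (inord k)| <= B.
  move=> z0 zK kn; rewrite /B /P !normrM normr_nat.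
  rewrite ler_pM ?mulr_ge0// ?ler_wpM2l ?zK//.
  apply: rowsum_le_entry; apply: rowsum_leX; first lra.
  exact: rowsum_jacobi.
(* The gradient of the truncated trace along log z_k. It is identified with [freud_lhs] only at
   distance at least 2m from the last row. *)
pose G (z : nat -> R) k := m.*2%:R * z k * (jacobi z n ^+ m.*2.-1) (inord k.-1) (inord k).
have GE (z : nat -> R) k : z 0%N = 0 -> (0 < k)%N -> (k + m.*2 <= n)%N -> G z k = freud_lhs z k.
  move=> z0 k0 kn; rewrite /G /freud_lhs jacobi_walk ?inordK//; natlia.
rewrite mulr_sumr.
have -> : \sum_(i < n.+1) m.*2%:R * (d i * (x i * (jacobi x n ^+ m.*2.-1) (inord i.-1) i -
      y i * (jacobi y n ^+ m.*2.-1) (inord i.-1) i)) = \sum_(i < n.+1) d i * (G x i - G y i).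
  by apply: eq_bigr => i _; rewrite /G inord_val; ring.
have Gx k : (m.*2 <= k)%N -> (k + m.*2 <= n)%N -> `|G x k - k%:R / N%:R| <= e1 / s.
  move=> h1 h2; rewrite GE//; last natlia.
  rewrite freud_lhs_scaled ?freud_eq//; [|natlia..].
  have -> : (k%:R + e k + 2 * t * beta k) / N%:R - k%:R / N%:R = (e k + 2 * t * beta k) / N%:R by
    ring.
  rewrite normrM [`|N%:R^-1|]ger0_norm ?invr_ge0//.
  rewrite ler_pdivrMr// (_ : e1 / s * N%:R = e1 * (N%:R / s)); last by ring.
  apply: (@le_trans _ _ (e1 * s)); last by rewrite ler_wpM2l.
  rewrite /e1 [X in _ <= X]mulrDl; apply: (le_trans (ler_normD _ _)); apply: lerD.
    by apply: (le_trans (e_le k)); rewrite ler_peMr.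
  rewrite normrM -mulrA ler_wpM2l// ger0_norm// -ler_pdivrMr//.
  by apply: xK; natlia.
have Gy k : (m.*2 <= k)%N -> (k + m.*2 <= n)%N -> `|G y k - k%:R / N%:R| <= e2 / s.
  move=> h1 h2; rewrite GE//; last natlia.
  (* The walk on the right has all its coefficients frozen at [y k]; by the choice of A it gives k/N
     without error. *)
  have -> : k%:R / N%:R = m.*2%:R * y k * walk (fun=> y k) m.*2.-1 k.-1 k.
    rewrite -[RHS]/(freud_lhs (fun=> y k) k) freud_lhs_cst// model_betaX.
    by rewrite -mulrA mulrA [_ * A ^+ m]mulrC AX mul1r.
  rewrite /freud_lhs -mulrBr normrM.
  have hy : `|m.*2%:R * y k| <= m.*2%:R.
    rewrite ger0_norm; last by rewrite mulr_ge0 ?yge0.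
    by rewrite ler_piMr// model_beta_le1//; natlia.
  have -> : e2 / s = m.*2%:R * (m.*2.-1%:R * P * (A * natroot R m m.*2 / s)) by rewrite /e2; ring.
  rewrite ler_pM//.
  apply: walk_dist; [lra|by rewrite divr_ge0 ?mulr_ge0 ?natroot_ge0// ltW|].
  move=> j hj1 hj2; split.
  - by rewrite ger0_norm// yK//; natlia.
  - by rewrite ger0_norm// yK//; natlia.
  - by apply: model_beta_dist; natlia.
have bd := @bulk_sum R (fun k => d k * (G x k - G y k)) n m.*2 (Cw * (B + B)) (Cw * ((e1 + e2) /
  s)).
apply: le_trans (ler_norm _) _.
apply: le_trans (bd _ _ _ _) _.
- by rewrite mulr_ge0// addr_ge0.
- by apply: mulr_ge0 => //; apply: divr_ge0; [exact: addr_ge0|exact: ltW].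
- move=> k kn; rewrite normrM ler_pM//.
  apply: (le_trans (ler_normB _ _)); apply: lerD; apply: entry_bound => // j jn.
    by rewrite ger0_norm// xK//; natlia.
  by rewrite ger0_norm// yK//; natlia.
- move=> k h1 h2; rewrite normrM ler_pM//.
  rewrite (_ : G x k - G y k = (G x k - k%:R / N%:R) - (G y k - k%:R / N%:R)); last by ring.
  apply: (le_trans (ler_normB _ _)).
  by rewrite mulrDl lerD ?Gx ?Gy.
(* The boundary rows cost O(1), absorbed into the claimed order by 1 <= N/s. *)
have : m.*2.*2%:R * (Cw * (B + B)) * 1 <= m.*2.*2%:R * (Cw * (B + B)) * (N%:R / s).
  by rewrite ler_wpM2l// ?mulr_ge0 ?addr_ge0//; lra.
rewrite (_ : N%:R * (Cw * ((e1 + e2) / s)) = Cw * (e1 + e2) * (N%:R / s)); last by ring.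
lra.
Qed.

End FreudEquation.

(** * Limits of the traces *)

Section TracePerturbation.
Variables (R : realFieldType) (n : nat) (x y : nat -> R).
Hypotheses (x0 : x 0%N = 0) (y0 : y 0%N = 0).
Let S := \sum_(k < n.+1) `|x k - y k|.

(** Each row of the difference has at most one nonzero entry, below the diagonal, which yields a
    bound in the l^1 norm of the coefficients. *)
Lemma trace_jacobi_diff (M : 'M[R]_n.+1) B : (forall i j, `|M i j| <= B) ->
  `|\tr ((jacobi x n - jacobi y n) * M)| <= S * B.
Proof.
move=> hM; rewrite /S mulr_suml /mxtrace.
apply: (le_trans (ler_norm_sum _ _ _)); apply: ler_sum => i _.
have -> : ((jacobi x n - jacobi y n) * M) i i = (x i - y i) * M (inord i.-1) i.
  have row z : z 0%N = 0 -> (jacobi z n * M) i i =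
     (i < n)%:R * M (inord i.+1) i + z i * M (inord i.-1) i.
    move=> z0; rewrite mxE -(jacobi_row i (fun s => M (inord s) i) z0).
    by apply: eq_bigr => j _; rewrite inord_val.
  by rewrite mulrBl [LHS]mxE [X in _ + X]mxE !row//; ring.
by rewrite normrM ler_wpM2l.
Qed.

Lemma trace_jacobiX_dist K p : 0 <= K ->
  (forall k, (k <= n)%N -> `|x k| <= K) -> (forall k, (k <= n)%N -> `|y k| <= K) ->
  `|\tr (jacobi x n ^+ p) - \tr (jacobi y n ^+ p)| <= p%:R * (1 + K) ^+ p.-1 * S.
Proof.
move=> K0 xK yK.
have K1 : 0 <= 1 + K by rewrite addr_ge0.
have S0 : 0 <= S by rewrite sumr_ge0.
(* The left factor [M] makes the telescoping induction on p possible: it absorbs the powers of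
   [jacobi x] that accumulate. *)
suff h (M : 'M[R]_n.+1) L : 0 <= L -> rowsum_le M L ->
    `|\tr (M * (jacobi x n ^+ p - jacobi y n ^+ p))| <= p%:R * (1 + K) ^+ p.-1 * S * L.
  have := h 1 1 ler01; rewrite mul1r mulr1 linearB /=; apply.
  by rewrite -(expr0 (jacobi x n)) -(expr0 (1 + K)); apply/rowsum_leX/rowsum_jacobi.
elim: p M L => [|p IHp] M L L0 hM.
  by rewrite !expr0 subrr mulr0 linear0 normr0 !mul0r.
have -> : M * (jacobi x n ^+ p.+1 - jacobi y n ^+ p.+1) =
   (M * jacobi x n) * (jacobi x n ^+ p - jacobi y n ^+ p) +
   M * (jacobi x n - jacobi y n) * jacobi y n ^+ p.
  by rewrite !exprS !mulrBr !mulrBl !mulrA subrKA.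
rewrite linearD /=; apply: (le_trans (ler_normD _ _)).
have h1 := IHp (M * jacobi x n) (L * (1 + K)) (mulr_ge0 L0 K1)
  (rowsum_leM L0 K1 hM (rowsum_jacobi x0 xK)).
have h2 : `|\tr (M * (jacobi x n - jacobi y n) * jacobi y n ^+ p)| <= S * ((1 + K) ^+ p * L).
  rewrite -mulrA -mulmxE mxtrace_mulC mulmxE -mulrA.
  apply: trace_jacobi_diff => i j; apply: rowsum_le_entry.
  by apply: rowsum_leM; rewrite ?exprn_ge0//; apply: rowsum_leX => //; exact: rowsum_jacobi.
apply: (le_trans (lerD h1 h2)).
have -> : p%:R * (1 + K) ^+ p.-1 * S * (L * (1 + K)) = p%:R * (1 + K) ^+ p * S * L.
  by case: p {IHp h1 h2} => [|p]; rewrite ?mul0r//= exprS; ring.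
by rewrite le_eqVlt -natr1 /=; apply/orP; left; apply/eqP; ring.
Qed.

End TracePerturbation.

Section RiemannSum.
Variable R : realType.

Lemma exprn_tangent (a b : R) m : 0 <= a -> 0 <= b ->
  m%:R * a ^+ m.-1 * (b - a) <= b ^+ m - a ^+ m.
Proof.
move=> a0 b0; elim: m => [|m IHm]; first by rewrite !mul0r subrr.
have -> : b ^+ m.+1 - a ^+ m.+1 = b * (b ^+ m - a ^+ m) + a ^+ m * (b - a).
  by rewrite !exprS; ring.
apply: (@le_trans _ _ (b * (m%:R * a ^+ m.-1 * (b - a)) + a ^+ m * (b - a))); last first.
  by rewrite lerD2r ler_wpM2l.
rewrite -subr_ge0.
have -> : b * (m%:R * a ^+ m.-1 * (b - a)) + a ^+ m * (b - a)
   - m.+1%:R * a ^+ m.+1.-1 * (b - a) = m%:R * a ^+ m.-1 * (b - a) ^+ 2.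
  by case: m {IHm} => [|m] /=; rewrite ?mulrS ?exprS; ring.
by rewrite mulr_ge0 ?sqr_ge0// mulr_ge0// exprn_ge0.
Qed.

(** Weighted AM-GM with integer weights, by induction on r; the induction step rests on the tangent
    inequality for the m-th power. *)
Lemma weighted_amgm (a b : R) m r : 0 <= a -> 0 <= b ->
  (m + r)%:R * (a ^+ m * b ^+ r) <= m%:R * a ^+ (m + r) + r%:R * b ^+ (m + r).
Proof.
move=> a0 b0; elim: r => [|r IHr]; first by rewrite addn0 expr0 mulr1 mul0r addr0.
have h1 := ler_wpM2r b0 IHr.
suff h2 : b ^+ r.+1 * (a ^+ m - b ^+ m) <= m%:R * a ^+ (m + r) * (a - b).
  rewrite addnS !mulrS; rewrite !exprSr.
  move: h1 h2; rewrite natrD !exprD exprSr.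
  set am := a ^+ m; set bm := b ^+ m; set ar := a ^+ r; set br := b ^+ r.
  lra.
apply: (@le_trans _ _ (a ^+ r.+1 * (a ^+ m - b ^+ m))).
  have [ab|/ltW ab] := leP b a.
    by rewrite ler_wpM2r ?subr_ge0 ?lerXn2r.
  by rewrite ler_wnM2r ?subr_le0 ?lerXn2r.
have -> : m%:R * a ^+ (m + r) * (a - b) = a ^+ r.+1 * (m%:R * a ^+ m.-1 * (a - b)).
  by case: m {IHr h1} => [|m]; rewrite ?mul0r ?mulr0//= exprD !exprS; ring.
rewrite ler_wpM2l ?exprn_ge0//; have := exprn_tangent m a0 b0; lra.
Qed.

(** A comparison of the sum of k^(r/m) with its integral, made without integrals: for u^m = N and
    v^m = N + 1, AM-GM applied to (v, u) and to (u, v) bounds the increment of N^(1 + r/m) from both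
    sides. *)
Lemma natroot_sum m r N : (0 < m)%N ->
  (m + r)%:R * \sum_(k < N) natroot R m k ^+ r <= m%:R * natroot R m N ^+ (m + r) /\
  m%:R * natroot R m N ^+ (m + r) <=
    (m + r)%:R * (\sum_(k < N) natroot R m k ^+ r + natroot R m N ^+ r).
Proof.
move=> m0; elim: N => [|N [IH1 IH2]].
  rewrite big_ord0 natroot0// mulr0 add0r expr0n addn_eq0 (gtn_eqF m0) /= mulr0.
  by split => //; rewrite mulr_ge0// exprn_ge0.
rewrite big_ord_recr /=; set S := \sum_(k < N) _ in IH1 IH2 *.
set u := natroot R m N in IH1 IH2 *; set v := natroot R m N.+1.
have u0 : 0 <= u by exact: natroot_ge0.
have v0 : 0 <= v by exact: natroot_ge0.
have uv : v ^+ m = u ^+ m + 1 by rewrite !natrootK// natr1.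
have h1 := weighted_amgm m r v0 u0.
have h2 := weighted_amgm m r u0 v0.
have e1 : v ^+ m * u ^+ r = u ^+ (m + r) + u ^+ r by rewrite uv exprD; ring.
have e2 : u ^+ m * v ^+ r = v ^+ (m + r) - v ^+ r by rewrite exprD uv; ring.
rewrite e1 in h1; rewrite e2 in h2; rewrite natrD in h1 h2 IH1 IH2 *.
by split; lra.
Qed.

Lemma natroot_mean m r N : (0 < m)%N -> (0 < N)%N ->
  `|(\sum_(k < N) natroot R m k ^+ r) / (natroot R m N ^+ r * N%:R) - m%:R / (m + r)%:R| <= N%:R^-1.
Proof.
move=> m0 N0; have [h1 h2] := natroot_sum r N m0.
set S := \sum_(k < N) _ in h1 h2 *; set u := natroot R m N in h1 h2 *.
have u0 : 0 < u ^+ r by rewrite exprn_gt0// natroot_gt0.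
have n0 : 0 < N%:R :> R by rewrite ltr0n.
have mr0 : 0 < (m + r)%:R :> R by rewrite ltr0n; lia.
have ue : u ^+ (m + r) = N%:R * u ^+ r by rewrite exprD natrootK.
rewrite ue in h1 h2.
have a1 : S / (u ^+ r * N%:R) <= m%:R / (m + r)%:R.
  rewrite ler_pdivrMr ?mulr_gt0// mulrAC ler_pdivlMr//; lra.
have a2 : m%:R / (m + r)%:R <= S / (u ^+ r * N%:R) + N%:R^-1.
  rewrite (_ : S / (u ^+ r * N%:R) + N%:R^-1 = (S + u ^+ r) / (u ^+ r * N%:R)); last first.
    by field; rewrite !gt_eqF.
  rewrite ler_pdivrMr// mulrAC ler_pdivlMr ?mulr_gt0//; lra.
by rewrite ler_norml; apply/andP; split; lra.
Qed.

End RiemannSum.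

Lemma natrootV_cvg0 (R : realType) m : (0 < m)%N ->
  (natroot R m n.+1)^-1 @[n --> \oo] --> (0 : R).
Proof.
move=> m0; apply/cvgr0Pnorm_le => /= e e0.
near=> n.
have rt0 : 0 < natroot R m n.+1 by exact: natroot_gt0.
rewrite ger0_norm ?invr_ge0 ?(ltW rt0)//.
rewrite -[X in _ <= X]invrK lef_pV2 ?posrE ?invr_gt0//.
rewrite -(@ler_pXn2r _ m)// ?nnegrE ?invr_ge0 ?(ltW e0) ?(ltW rt0)// natrootK//.
apply: (@le_trans _ _ n%:R); last by rewrite ler_nat.
by near: n; exact: nbhs_infty_ger.
Unshelve. all: by end_near. Qed.

Lemma ler_natrootV (R : realType) m N : (0 < m)%N -> (0 < N)%N ->
  N%:R^-1 <= (natroot R m N)^-1.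
Proof.
move=> m0 N0; have h : 1 <= natroot R m N by exact: natroot_ge1.
rewrite lef_pV2 ?posrE ?ltr0n ?natroot_gt0//.
by rewrite -[X in _ <= X](natrootK R N m0) ler_eXnr.
Qed.

Lemma cvg_dist_le (R : realType) (u v e : nat -> R) (l : R) :
  (forall n, `|u n - v n| <= e n) -> e @ \oo --> (0 : R) -> v @ \oo --> l -> u @ \oo --> l.
Proof.
move=> h he hv; rewrite (_ : u = (fun n => (u n - v n) + v n)); last first.
  by apply/funext => n; rewrite subrK.
rewrite -[l]add0r; apply: cvgD => //.
apply: norm_cvg0; apply: squeeze_cvgr he; last exact: cvg_cst.
by near=> n; rewrite normr_ge0 h.
Unshelve. all: by end_near. Qed.

(* With [A] as below, [ullman_moment m A i] is the i-th moment of the law of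
   zeros on the scale n^(1/2m): the mean over s in [0,1] of the moments of the
   arcsine laws on [-2 sqrt A s^(1/2m), 2 sqrt A s^(1/2m)]. *)
Definition ullman_moment (R : realType) m (A : R) i : R :=
  (~~ odd i)%:R * 'C(i, i./2)%:R * A ^+ i./2 * (m%:R / (m + i./2)%:R).

Section TraceLimit.
Variables (R : realType) (m : nat) (t C0 c0 : R) (beta e : nat -> R).
Hypotheses (hm : (2 <= m)%N) (beta0 : beta 0%N = 0)
  (beta_gt0 : forall k, (0 < k)%N -> 0 < beta k)
  (c0_gt0 : 0 < c0)
  (e_le : forall k, `|e k| <= C0)
  (e_ge : forall k, c0 * k%:R <= k%:R + e k)
  (freud_eq : forall k, (0 < k)%N ->
    freud_lhs m beta k = k%:R + e k + 2 * t * beta k).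
Variables (A : R).
Hypotheses (A0 : 0 < A) (AX : A ^+ m * (m.*2 * 'C(m.*2.-1, m.-1))%:R = 1).

Let x n := scaled_beta m beta n.+1.
Let y n := model_beta m A n.+1.
Let s n := (natroot R m n.+1)^-1.

Let m0 : (0 < m)%N. Proof. lia. Qed.
Let s_cvg : s @ \oo --> (0 : R). Proof. exact: natrootV_cvg0. Qed.
Let s_ge0 n : 0 <= s n. Proof. by rewrite invr_ge0 natroot_ge0. Qed.

(** The bound for powers 2m is turned into one for first powers by a <= d + a^(2m) / d^(2m-1), with
    the threshold d = eps/2 fixed as n grows. *)
Lemma mean_beta_dist :
  (\sum_(k < n.+1) `|x n k - y n k|) / n.+1%:R @[n --> \oo] --> (0 : R).
Proof.
have [Q hQ] := beta_model_dist hm beta0 beta_gt0 c0_gt0 e_le e_ge freud_eq A0 AX.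
apply/cvgr0Pnorm_le => /= eps eps0.
pose d := eps / 2; have d0 : 0 < d by rewrite divr_gt0.
have hs : Q * (d ^+ m.*2.-1)^-1 * s n @[n --> \oo] --> (0 : R).
  by rewrite -[X in _ --> X](mulr0 (Q * (d ^+ m.*2.-1)^-1)); apply: cvgMl_tmp.
have hs' : \forall n \near \oo, `|Q * (d ^+ m.*2.-1)^-1 * s n| <= d.
  by move/cvgr0Pnorm_le : hs; apply.
near=> n.
have N0 : 0 < n.+1%:R :> R by rewrite ltr0n.
have dp : 0 < d ^+ m.*2.-1 by rewrite exprn_gt0.
rewrite ger0_norm ?divr_ge0 ?sumr_ge0// ler_pdivrMr//.
have h1 : \sum_(k < n.+1) `|x n k - y n k| <=
   \sum_(k < n.+1) (d + `|x n k - y n k| ^+ m.*2 / d ^+ m.*2.-1).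
  apply: ler_sum => k _; set a := `|_|; have a0 : 0 <= a by exact: normr_ge0.
  have [ad|/ltW da] := leP a d; first by rewrite ler_wpDr// divr_ge0 ?exprn_ge0// ltW.
  apply: ler_wpDl; first exact: ltW.
  have -> : a ^+ m.*2 = a * a ^+ m.*2.-1 by rewrite -exprS prednK// double_gt0.
  rewrite ler_pdivlMr// ler_wpM2l//.
  by rewrite lerXn2r// nnegrE ltW.
apply: (le_trans h1); rewrite big_split /= sumr_const card_ord -mulr_suml.
have h2 := hQ n.
have h3 : (\sum_(k < n.+1) `|x n k - y n k| ^+ m.*2) / d ^+ m.*2.-1 <= d * n.+1%:R.
  apply: (@le_trans _ _ (Q * n.+1%:R / natroot R m n.+1 / d ^+ m.*2.-1)).
    by rewrite ler_wpM2r ?invr_ge0 ?(ltW dp)//.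
  have -> : Q * n.+1%:R / natroot R m n.+1 / d ^+ m.*2.-1 = (Q * (d ^+ m.*2.-1)^-1 * s n) * n.+1%:R.
    by rewrite /s; ring.
  rewrite ler_wpM2r//; apply: le_trans (ler_norm _) _.
  by near: n.
rewrite -[d *+ _]mulr_natr; apply: (le_trans (lerD (lexx _) h3)).
by rewrite -mulrDl /d -splitr.
Unshelve. all: by end_near. Qed.

Let K_ex : exists2 K, 1 <= K & forall n k, (k <= n)%N -> `|x n k| <= K /\ `|y n k| <= K.
Proof.
have [K K1 hK] := beta_upper hm beta0 beta_gt0 e_le freud_eq.
exists K => // n k kn; rewrite !ger0_norm; last 2 first.
- exact: model_beta_ge0.
- exact: scaled_beta_ge0.
split; first by apply: (scaled_beta_le hm beta0 beta_gt0 K1 hK); rewrite leqW.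
by apply: le_trans K1; apply: (model_beta_le1 hm A0 AX); rewrite leqW.
Qed.

Let x0 n : x n 0%N = 0. Proof. by rewrite /x /scaled_beta beta0 mul0r. Qed.
Let y0 n : y n 0%N = 0. Proof. exact: model_beta0. Qed.

Lemma trace_scaled_model i :
  (\tr (jacobi (x n) n ^+ i) - \tr (jacobi (y n) n ^+ i)) / n.+1%:R @[n --> \oo] --> (0 : R).
Proof.
have [K K1 hK] := K_ex.
have := mean_beta_dist.
move=> /(@cvgMl_tmp _ _ _ _ _ (i%:R * (1 + K) ^+ i.-1)); rewrite mulr0 => h.
apply: (@cvg_dist_le _ _ (fun=> 0) _ _ _ h); last exact: cvg_cst.
move=> n; rewrite subr0 normrM [`|_^-1|]ger0_norm ?invr_ge0// mulrA ler_wpM2r ?invr_ge0//.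
apply: trace_jacobiX_dist => //; first lra.
  by move=> k /hK[].
by move=> k /hK[].
Qed.

(** The diagonal entry of J^i for constant coefficients c, away from the boundary; for c >= 0 it is
    the i-th moment of the arcsine law on [-2 sqrt c, 2 sqrt c]. *)
Let V i (c : R) := (~~ odd i)%:R * 'C(i, i./2)%:R * c ^+ i./2.

(** In the bulk the model is frozen at the index of the row, at a cost of O(N^(-1/m)); the 2i
    boundary rows contribute O(1/N) to the mean. *)
Lemma trace_model i :
  (\tr (jacobi (y n) n ^+ i) - \sum_(k < n.+1) V i (y n k)) / n.+1%:R @[n --> \oo] --> (0 : R).
Proof.
pose P : R := (1 + 1) ^+ i.
have P0 : 0 <= P by rewrite exprn_ge0.
pose C1 : R := i%:R * P * (A * natroot R m i).
have C10 : 0 <= C1 by rewrite !mulr_ge0 ?natroot_ge0// ltW.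
pose C2 : R := P + 'C(i, i./2)%:R.
have C20 : 0 <= C2 by rewrite addr_ge0.
have := s_cvg.
move=> /(@cvgMl_tmp _ _ _ _ _ (C1 + i.*2%:R * C2)); rewrite mulr0 => h.
apply: (@cvg_dist_le _ _ (fun=> 0) _ _ _ h); last exact: cvg_cst.
move=> n; rewrite subr0 normrM [`|_^-1|]ger0_norm ?invr_ge0//.
have N0 : 0 < n.+1%:R :> R by rewrite ltr0n.
rewrite ler_pdivrMr// /mxtrace -sumrB.
have yge0 k : 0 <= y n k by exact: model_beta_ge0.
have yle1 k : (k <= n.+1)%N -> `|y n k| <= 1.
  by move=> kn; rewrite ger0_norm//; apply: model_beta_le1.
pose f k := (jacobi (y n) n ^+ i) (inord k) (inord k) - V i (y n k).
have -> : \sum_(k < n.+1) ((jacobi (y n) n ^+ i) k k - V i (y n k)) = \sum_(k < n.+1) f k.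
  by apply: eq_bigr => k _; rewrite /f inord_val.
apply: (le_trans (@bulk_sum R f n i C2 (C1 * s n) C20 (mulr_ge0 C10 (s_ge0 n)) _ _)).
- move=> k kn; apply: (le_trans (ler_normB _ _)); apply: lerD.
    apply: rowsum_le_entry; apply: rowsum_leX; first lra.
    by apply: rowsum_jacobi => // j jn; apply: yle1; rewrite leqW.
  rewrite /V normrM [`|y n k ^+ _|]ger0_norm ?exprn_ge0// ger0_norm ?mulr_ge0//.
  apply: (@le_trans _ _ ((~~ odd i)%:R * 'C(i, i./2)%:R)).
    rewrite ler_piMr ?mulr_ge0// exprn_ile1//.
    by have := yle1 k (leqW kn); rewrite ger0_norm.
  by rewrite ler_piMl//; case: odd.
- move=> k ik kin.
  have -> : f k = walk (y n) i k k - walk (fun=> y n k) i k k.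
    rewrite /f jacobi_walk ?inordK//; try lia; congr (_ - _).
    rewrite /V; case: (boolP (odd i)) => oi /=.
      by rewrite !mul0r walk_cst_odd//; lia.
    by rewrite mul1r (@walk_cst _ _ _ _ _ i./2)//; lia.
  have -> : C1 * s n = i%:R * P * (A * natroot R m i / natroot R m n.+1) by rewrite /C1 /s; ring.
  apply: walk_dist; [lra|by rewrite divr_ge0 ?mulr_ge0 ?natroot_ge0// ltW|].
  move=> j j1 j2; split; [apply: yle1; lia|apply: yle1; lia|].
  by apply: model_beta_dist.
have -> : (C1 + i.*2%:R * C2) * s n * n.+1%:R =
    n.+1%:R * (C1 * s n) + i.*2%:R * C2 * (s n * n.+1%:R) by ring.
rewrite lerD2l ler_peMr ?mulr_ge0// -ler_pdivrMr// mul1r.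
exact: ler_natrootV.
Qed.

Lemma model_mean i :
  (\sum_(k < n.+1) V i (y n k)) / n.+1%:R @[n --> \oo] --> ullman_moment m A i.
Proof.
pose c : R := (~~ odd i)%:R * 'C(i, i./2)%:R * A ^+ i./2.
have := s_cvg.
move=> /(@cvgMl_tmp _ _ _ _ _ `|c|); rewrite mulr0 => h.
apply: (@cvg_dist_le _ _ (fun=> ullman_moment m A i) _ _ _ h); last exact: cvg_cst.
move=> n; have rt0 : 0 < natroot R m n.+1 by exact: natroot_gt0.
have -> : (\sum_(k < n.+1) V i (y n k)) / n.+1%:R - ullman_moment m A i =
  c * ((\sum_(k < n.+1) natroot R m k ^+ i./2) / (natroot R m n.+1 ^+ i./2 * n.+1%:R) - m%:R / (m
    + i./2)%:R).
  rewrite /ullman_moment -/c mulrBr; congr (_ - _).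
  rewrite !mulr_suml mulr_sumr; apply: eq_bigr => k _.
  rewrite /V /y /model_beta expr_div_n exprMn /c invfM; ring.
rewrite normrM ler_wpM2l//.
apply: le_trans (ler_natrootV _ m0 (ltn0Sn n)).
exact: natroot_mean.
Qed.

Lemma trace_limit i :
  \tr (jacobi (x n) n ^+ i) / n.+1%:R @[n --> \oo] --> ullman_moment m A i.
Proof.
have := cvgD (cvgD (@trace_scaled_model i) (@trace_model i)) (@model_mean i).
rewrite !add0r => h.
apply: (@cvg_dist_le _ _ _ (fun=> 0) _ _ _ (h _ _)); last exact: cvg_cst.
by move=> n /=; rewrite -!mulrDl subrKA subrK subrr normr0.
Qed.

End TraceLimit.

(** * Orthogonal polynomials and their zeros *)

Section OrthogonalPolynomials.
Variables (R : realType) (L : {scalar {poly R}}) (P : nat -> {poly R}).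
Implicit Types (p q : {poly R}).
Hypotheses
  (L_gt0 : forall p : {poly R}, p != 0 -> (forall x, 0 <= p.[x]) -> 0 < L p)
  (P_monic : forall n, P n \is monic)
  (size_P : forall n, size (P n) = n.+1)
  (P_orth : forall i j, i <> j -> L (P i * P j) = 0).

Definition sqnorm n := L (P n * P n).

Lemma L_sqr_gt0 p : p != 0 -> 0 < L (p * p).
Proof.
by move=> p0; apply: L_gt0; rewrite ?mulf_neq0// => x; rewrite hornerM -expr2 sqr_ge0.
Qed.

Lemma P_neq0 n : P n != 0. Proof. exact: monic_neq0. Qed.

Lemma sqnorm_gt0 n : 0 < sqnorm n.
Proof. exact/L_sqr_gt0/P_neq0. Qed.

Lemma P_coef n : (P n)`_n = 1.
Proof. by have /monicP := P_monic n; rewrite lead_coefE size_P. Qed.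

Lemma size_subP n q : (size q <= n.+1)%N -> (size (q - q`_n *: P n)%R <= n)%N.
Proof.
move=> sq; apply/leq_sizeP => j nj; rewrite coefB coefZ.
case: (ltngtP j n) nj => // [nj _|-> _]; last by rewrite P_coef mulr1 subrr.
by rewrite (nth_default _ (leq_trans sq nj)) (@nth_default _ _ (P n)) ?size_P// mulr0 subrr.
Qed.

Lemma orth_lower n (q : {poly R}) : (size q <= n)%N -> L (P n * q) = 0.
Proof.
suff h k : (k <= n)%N -> forall q, (size q <= k)%N -> L (P n * q) = 0 by exact: h.
elim: k => [_|k IHk kn] {}q sq.
  by move: sq; rewrite leqn0 size_poly_eq0 => /eqP->; rewrite mulr0 linear0.
rewrite -[q](subrK (q`_k *: P k)) mulrDr linearD /= IHk ?size_subP//; last exact: ltnW.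
by rewrite -scalerAr linearZ /= P_orth ?mulr0 ?addr0//; lia.
Qed.

Lemma orth_coef n q : (size q <= n.+1)%N -> L (P n * q) = q`_n * sqnorm n.
Proof.
move=> sq; rewrite -{1}[q](subrK (q`_n *: P n)) mulrDr linearD /=.
by rewrite orth_lower ?size_subP// add0r -scalerAr linearZ.
Qed.

Lemma orth_eq0 n q : (size q <= n)%N -> (forall k, (k < n)%N -> L (P k * q) = 0) -> q = 0.
Proof.
move=> sq h; apply/eqP/negPn/negP => q0.
have sq0 : (0 < size q)%N by rewrite lt0n size_poly_eq0.
have := h (size q).-1 ltac:(lia).
rewrite orth_coef ?prednK// => /eqP; rewrite mulf_eq0 (gt_eqF (sqnorm_gt0 _)) orbF.
by rewrite -lead_coefE lead_coef_eq0 (negbTE q0).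
Qed.

Hypothesis L_even : forall p : {poly R}, L (p \Po - 'X) = L p.

Lemma comp_oppX_coef (p : {poly R}) i : (p \Po - 'X)`_i = (-1) ^+ i * p`_i.
Proof.
rewrite -scaleN1r -[_ *: 'X]mul_polyC.
have [ip|ip] := ltnP i (size p); last first.
  rewrite [p`_i]nth_default// mulr0 nth_default//.
  apply: leq_trans ip; rewrite mul_polyC size_comp_poly2 ?leqnn//.
  by rewrite size_scale ?oppr_eq0 ?oner_eq0// size_polyX.
rewrite comp_polyE coef_sum (bigD1 (Ordinal ip))//= big1 ?addr0.
  by rewrite exprMn -polyC_exp mul_polyC !coefZ coefXn eqxx mulr1 mulrC.
move=> j ji; rewrite exprMn -polyC_exp mul_polyC !coefZ coefXn.
by rewrite eq_sym -val_eqE /= in ji; rewrite (negbTE ji) !mulr0.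
Qed.

Lemma size_comp_oppX (p : {poly R}) : size (p \Po - 'X) = size p.
Proof. by rewrite size_comp_poly2// size_polyN size_polyX. Qed.

(** Both sides have leading coefficient (-1)^n, so their difference has degree below n; since L is
    even, it is orthogonal to every P_k with k < n. *)
Lemma P_even n : P n \Po - 'X = (-1) ^+ n *: P n.
Proof.
have sgnK : (-1) ^+ n * (-1) ^+ n = 1 :> R by rewrite -expr2 sqrr_sign.
apply/eqP; rewrite -subr_eq0; apply/eqP; apply: (@orth_eq0 n).
  apply/leq_sizeP => j nj; rewrite coefB comp_oppX_coef coefZ.
  case: (ltngtP j n) nj => // [nj _|-> _]; last by rewrite subrr.
  by rewrite nth_default ?size_P// !mulr0 subrr.
move=> k kn; rewrite mulrBr linearB /= -scalerAr linearZ /= P_orth; last lia.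
rewrite mulr0 subr0 -L_even comp_polyM -comp_polyA raddfN /= comp_polyX opprK comp_polyXr.
by rewrite mulrC orth_lower// size_comp_oppX size_P.
Qed.

(** The diagonal recurrence coefficients vanish by parity, which is why [jacobi] has a zero
    diagonal. *)
Lemma L_odd_eq0 n : L ('X * P n * P n) = 0.
Proof.
have : L ('X * P n * P n) = - L ('X * P n * P n).
  rewrite -{1}L_even !comp_polyM comp_polyX !P_even -!scalerAr -scalerAl scalerA.
  by rewrite -expr2 sqrr_sign scale1r !mulNr linearN.
lra.
Qed.

Definition rec_coef n := if n is k.+1 then sqnorm n / sqnorm k else 0.

Lemma rec_coef_gt0 n : (0 < n)%N -> 0 < rec_coef n.
Proof. by case: n => // n _; rewrite divr_gt0 ?sqnorm_gt0. Qed.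

Lemma three_term n : 'X * P n = P n.+1 + rec_coef n *: P n.-1.
Proof.
apply/eqP; rewrite -subr_eq0 opprD addrA; apply/eqP; apply: (@orth_eq0 n.+1).
  apply/leq_sizeP => j nj; rewrite !coefB coefXM coefZ.
  case: j nj => // j; rewrite ltnS => nj /=; rewrite [X in _ * X]nth_default ?mulr0 ?subr0;
    last first.
    by rewrite size_P; lia.
  case: (ltngtP j n) nj => // [nj _|-> _]; last by rewrite !P_coef subrr.
  by rewrite !nth_default ?subrr ?size_P.
move=> k kn; rewrite !mulrBr !linearB /= -scalerAr linearZ /= (@P_orth k n.+1) ?subr0; last lia.
rewrite mulrA [P k * 'X]mulrC.
have [kn'|kn'] := eqVneq k n.
  rewrite kn' L_odd_eq0; case: n {kn kn'} => [|n]; first by rewrite mul0r subrr.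
  by rewrite P_orth ?mulr0 ?subrr//=; lia.
have sXP : size ('X * P k) = k.+2 by rewrite mulrC size_mulX ?P_neq0// size_P.
have -> : L ('X * P k * P n) = ('X * P k)`_n * sqnorm n.
  by rewrite mulrC orth_coef// sXP; lia.
case: n kn kn' => [|n] kn kn' /=; first lia.
have [->|kn2] := eqVneq k n.
  by rewrite coefXM /= P_coef mul1r divfK ?gt_eqF ?sqnorm_gt0// subrr.
rewrite P_orth ?mulr0 ?subr0; last exact/eqP.
by rewrite nth_default ?mul0r// sXP; lia.
Qed.

(** Iterating the three-term recurrence expands x^i P_j in the P_k, and the coefficients obey the
    recursion of [walk]. *)
Lemma L_walk i j k : L ('X^i * P j * P k) = sqnorm k * walk rec_coef i j k.
Proof.
elim: i j => [|i IHi] j /=.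
  rewrite expr0 mul1r; case: eqP => [->|jk]; first by rewrite mulr1.
  by rewrite P_orth// mulr0.
rewrite exprSr -(mulrA _ 'X) three_term mulrDr mulrDl linearD /= IHi.
by rewrite -scalerAr -scalerAl linearZ /= IHi; ring.
Qed.

Lemma walk_sym i j k : sqnorm k * walk rec_coef i j k = sqnorm j * walk rec_coef i k j.
Proof. by rewrite -!L_walk mulrAC. Qed.

Variables (lam t : R) (m : nat).
Hypotheses (hm : (0 < m)%N)
  (L_virial : forall q : {poly R}, L ('X * q^`()) + (2 * lam + 2) * L q
     + L (((2 * t) *: 'X^2 - (2 * m)%:R *: 'X^(2 * m)) * q) = 0).

Lemma L_euler n : L ('X * (P n * P n)^`()) = n.*2%:R * sqnorm n.
Proof.
have e : L ('X * (P n)^`() * P n) = n%:R * sqnorm n.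
  rewrite mulrC orth_coef.
    by rewrite coefXM; case: n => [|n]; rewrite ?mul0r// coef_deriv P_coef.
  rewrite mulrC; have [->|d0] := eqVneq (P n)^`() 0; first by rewrite mul0r size_poly0.
  by rewrite size_mulX// -(size_P n) lt_size_deriv ?P_neq0.
have -> : 'X * (P n * P n)^`() = 'X * (P n)^`() * P n + 'X * (P n)^`() * P n.
  by rewrite derivM; ring.
by rewrite linearD /= e -addnn natrD mulrDl.
Qed.

(** [L_virial] is integration by parts against the dilation field. For q = P_n^2 the Euler term
    gives 2n times the squared norm, and the powers of x become diagonal walks. *)
Lemma freud_diag n : m%:R * walk rec_coef (2 * m) n n =
  n%:R + lam + 1 + t * walk rec_coef 2 n n.
Proof.
have h := L_virial (P n * P n).
have e : L (((2 * t) *: 'X^2 - (2 * m)%:R *: 'X^(2 * m)) * (P n * P n)) =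
    2 * t * L ('X^2 * P n * P n) - (2 * m)%:R * L ('X^(2 * m) * P n * P n).
  by rewrite mulrBl -!scalerAl linearB /=; congr (_ - _); rewrite [LHS]linearZ /= -?mulrA.
rewrite e L_euler !L_walk -/(sqnorm n) -muln2 !natrM in h.
have h0 := sqnorm_gt0 n.
apply: (mulfI (lt0r_neq0 h0)); move: h.
set w := walk _ (2 * m) _ _; set w2 := walk _ 2 _ _.
lra.
Qed.

(** A closed walk of length 2m from k starts along the edge above or below k, so the virial identity
    controls E_k + E_(k+1). Starting from E_0 = 0 this determines every E_k, and 2 lam + 1 survives
    at odd indices only. *)
Lemma freud_equation n : (0 < n)%N -> freud_lhs m rec_coef n =
  n%:R + (odd n)%:R * (2 * lam + 1) + 2 * t * rec_coef n.
Proof.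
move=> _; set E := freud_lhs m rec_coef.
have E0 : E 0%N = 0 by rewrite /E /freud_lhs mulr0 mul0r.
have step k : E k + E k.+1 = 2 * (k%:R + lam + 1 + t * (rec_coef k + rec_coef k.+1)).
  have := freud_diag k.
  have -> : walk rec_coef 2 k k = rec_coef k + rec_coef k.+1.
    rewrite /= !eqxx mulr1n; case: k => [|k] /=.
      by rewrite !mul0r; ring.
    rewrite eqxx !mulr1 (_ : (k.+3 == k.+1) = false); last by lia.
    case: k => [|k] /=; first by rewrite !mul0r; ring.
    by rewrite (_ : (k == k.+2) = false) ?(mulr0n, mulr0); [ring|lia].
  have -> : walk rec_coef (2 * m) k k = walk rec_coef m.*2.-1 k.+1 k + rec_coef k * walk rec_coef
    m.*2.-1 k.-1 k.
    by rewrite (_ : (2 * m)%N = m.*2.-1.+1)//; lia.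
  have -> : walk rec_coef m.*2.-1 k.+1 k = rec_coef k.+1 * walk rec_coef m.*2.-1 k k.+1.
    have h0 := sqnorm_gt0 k; apply: (mulfI (lt0r_neq0 h0)).
    by rewrite walk_sym /= mulrA mulrCA divff ?gt_eqF// mulr1.
  rewrite /E /freud_lhs /= -muln2 natrM; lra.
elim: n => [|n IHn]; first by rewrite E0 /=; ring.
have := step n; rewrite IHn /= -natr1.
by case: (odd n) => /=; lra.
Qed.

End OrthogonalPolynomials.

(** * A criterion for real and simple roots *)

Section RealSplitting.
Variable R : realType.
Local Notation toC := (real_complex R).

Lemma map_real_quadratic (z : R[i]) :
  map_poly toC (('X - (complex.Re z)%:P) ^+ 2 + (complex.Im z ^+ 2)%:P) =
  ('X - z%:P) * ('X - (conjc z)%:P).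
Proof.
case: z => a b /=.
rewrite rmorphD rmorphXn rmorphB /= map_polyX !map_polyC /= rmorphXn /=.
have -> : Complex a b = toC a + Complex 0 1 * toC b.
  by apply/eqP; rewrite eq_complex /=; apply/andP; split; apply/eqP; ring.
have -> : Complex a (- b) = toC a - Complex 0 1 * toC b.
  by apply/eqP; rewrite eq_complex /=; apply/andP; split; apply/eqP; ring.
have i2 : (Complex 0 1 : R[i]) ^+ 2 = -1 by rewrite sqr_i.
move: (toC a) (toC b) (Complex 0 1) i2 => A B I i2.
rewrite polyC_exp polyCD polyCB polyCM.
have I2 : (I%:P : {poly R[i]}) ^+ 2 = -1 by rewrite -polyC_exp i2 polyCN.
set x := 'X; set u := A%:P; set v := B%:P; set w := I%:P in I2 *.
have -> : (x - (u + w * v)) * (x - (u - w * v)) = (x - u) ^+ 2 - w ^+ 2 * v ^+ 2 by ring.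
by rewrite I2 mulN1r opprK.
Qed.

Lemma not_uniq_perm (T : eqType) (s : seq T) : ~~ uniq s ->
  exists z r, perm_eq s [:: z, z & r].
Proof.
elim: s => //= x s IHs; rewrite negb_and negbK; case/orP => [xs|/IHs[z [r h]]].
  by exists x, (rem x s); rewrite perm_cons perm_to_rem.
exists z, (x :: r); rewrite -(perm_cons x) in h; apply: (perm_trans h).
by rewrite -[[:: x, z, z & r]]/([:: x] ++ [:: z; z] ++ r) perm_catCA.
Qed.

(** One hypothesis excludes both a pair of conjugate roots, with b the imaginary part, and a double
    real root, with b = 0. *)
Lemma real_split (p : {poly R}) : p \is monic ->
  (forall a b q, p = q * (('X - a%:P) ^+ 2 + (b ^+ 2)%:P) -> False) ->
  exists2 zs, uniq zs & p = \prod_(z <- zs) ('X - z%:P).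
Proof.
move=> pmon hp.
have [r hr] := closed_field_poly_normal (map_poly toC p).
rewrite (monicP (monic_map _ pmon)) scale1r in hr.
have r_real z : z \in r -> complex.Im z = 0.
  move=> zr; apply/eqP/negPn/negP => imz.
  have rz : root (map_poly toC p) z by rewrite hr root_prod_XsubC.
  have rzc : root (map_poly toC p) (conjc z).
    rewrite -complex_root_conj -map_poly_comp (eq_map_poly (g := toC))// => x /=.
    by rewrite oppr0.
  suff : ('X - (complex.Re z)%:P) ^+ 2 + (complex.Im z ^+ 2)%:P %| p.
    by move=> /dvdpP[q] /hp.
  rewrite -(dvdp_map toC) map_real_quadratic Gauss_dvdp.
    by rewrite !dvdp_XsubCl rz rzc.
  apply: coprimep_XsubC2; rewrite subr_eq0; apply/eqP => zz.
  move: imz zz; case: z {zr rz rzc} => a b /= b0 [] bb.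
  have b00 : b = 0 by lra.
  by rewrite b00 eqxx in b0.
pose zs := map (@complex.Re R) r.
have pE : p = \prod_(z <- zs) ('X - z%:P).
  apply: (map_inj_poly (f := toC)) => //; first exact: complexI.
  rewrite hr rmorph_prod big_map /=; apply: eq_big_seq => z /r_real.
  by case: z => a b /= ->; rewrite rmorphB /= map_polyX map_polyC.
exists zs => //; apply/negPn/negP => /not_uniq_perm[z [s h]].
move: pE; rewrite (perm_big _ h) !big_cons /= mulrA mulrC => pE.
by apply: (hp z 0 _ _); rewrite expr0n /= polyC0 addr0 expr2; exact: pE.
Qed.

End RealSplitting.

(** * The zeros as eigenvalues of the truncated Jacobi matrix *)

Section Zeros.
Variables (R : realType) (L : {scalar {poly R}}) (P : nat -> {poly R}).
Hypotheses
  (L_gt0 : forall p : {poly R}, p != 0 -> (forall x, 0 <= p.[x]) -> 0 < L p)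
  (P_monic : forall n, P n \is monic)
  (size_P : forall n, size (P n) = n.+1)
  (P_orth : forall i j, i <> j -> L (P i * P j) = 0)
  (L_even : forall p : {poly R}, L (p \Po - 'X) = L p).

(* A quadratic factor g >= 0 of P_n would give q with P_n = q g, of degree less
   than n, and 0 = L(P_n q) = L(q^2 g) > 0. *)
Lemma orthogonal_zeros n :
  exists2 zs, uniq zs & P n = \prod_(z <- zs) ('X - z%:P).
Proof.
apply: real_split => // a b q pE.
have q0 : q != 0 by apply/eqP => q0; have := P_neq0 P_monic n; rewrite pE q0 mul0r eqxx.
set g := ('X - a%:P) ^+ 2 + (b ^+ 2)%:P in pE.
have sg : size g = 3.
  rewrite size_polyDl; first by rewrite size_exp_XsubC.
  by rewrite size_exp_XsubC (leq_ltn_trans (size_polyC_leq1 _)).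
have g0 : g != 0 by rewrite -size_poly_eq0 sg.
have sq : (size q <= n)%N.
  by have := size_P n; rewrite pE (size_mul q0 g0) sg addn3 /= => -[<-].
have := orth_lower P_monic size_P P_orth sq; rewrite pE.
have -> : q * g * q = q ^+ 2 * g by ring.
apply/eqP; rewrite gt_eqF// L_gt0 ?mulf_neq0 ?expf_neq0// => x.
by rewrite !hornerE mulr_ge0 ?addr_ge0 ?sqr_ge0.
Qed.

Local Notation beta := (rec_coef L P).

(** Coordinates of the eigenvector for z / s: dividing by s^k conjugates the Jacobi matrix so that
    b_k becomes b_k / s^2. *)
Definition scaled_value s z k := (P k).[z] / s ^+ k.

Lemma scaled_value_rec s z k : s != 0 ->
  z / s * scaled_value s z k =
  scaled_value s z k.+1 + beta k / s ^+ 2 * scaled_value s z k.-1.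
Proof.
move=> s0; rewrite /scaled_value.
have := three_term L_gt0 P_monic size_P P_orth L_even k => /(congr1 (horner^~ z)).
rewrite !hornerE => h.
have -> : (P k.+1).[z] = z * (P k).[z] - beta k * (P k.-1).[z] by rewrite h; ring.
case: k {h} => [|k] /=; first by rewrite !mul0r; field.
rewrite !exprS; have sk : s ^+ k != 0 by rewrite expf_neq0.
move: (s ^+ k) sk => S S0; field. apply/and3P; split => //.
exact/lt0r_neq0/(sqnorm_gt0 L_gt0 P_monic).
Qed.

Lemma jacobi_eigenvector s z n (x := fun k => beta k / s ^+ 2) : s != 0 ->
  root (P n.+1) z -> forall i : 'I_n.+1,
  \sum_j jacobi x n i j * scaled_value s z j = z / s * scaled_value s z i.
Proof.
move=> s0 rz i; rewrite jacobi_row /x ?mul0r// scaled_value_rec//.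
case: ltnP => hi; first by rewrite mul1r.
have -> : i = n :> nat by have := ltn_ord i; lia.
by rewrite (_ : scaled_value s z n.+1 = 0) ?mulr0 // /scaled_value (rootP rz) mul0r.
Qed.

(** The eigenvectors of the n+1 distinct zeros diagonalise the matrix. They are independent, because
    a relation between the rows of [V] is a polynomial of degree at most n with n+1 zeros. *)
Lemma zeros_trace n zs s i (x := fun k => beta k / s ^+ 2) : s != 0 ->
  uniq zs -> P n.+1 = \prod_(z <- zs) ('X - z%:P) ->
  \sum_(z <- zs) (z / s) ^+ i = \tr (jacobi x n ^+ i).
Proof.
move=> s0 zs_uniq PE.
have szs : size zs = n.+1 by have := size_P n.+1; rewrite PE size_prod_XsubC => -[].
pose J := jacobi x n.
pose D : 'M[R]_n.+1 := diag_mx (\row_j (zs`_j / s)).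
pose V : 'M[R]_n.+1 := \matrix_(k, j) scaled_value s zs`_j k.
have rz (j : 'I_n.+1) : root (P n.+1) zs`_j.
  by rewrite PE root_prod_XsubC mem_nth// szs.
have JV : J * V = V * D.
  apply/matrixP => k j; rewrite !mxE.
  under eq_bigr do rewrite [V _ _]mxE.
  rewrite jacobi_eigenvector// (bigD1 j)//= !mxE eqxx mulr1n big1 ?addr0 1?mulrC// => l lj.
  by rewrite !mxE (negbTE lj) mulr0n mulr0.
have Vu : V \in unitmx.
  rewrite -row_free_unit; apply: inj_row_free => v vV.
  pose q := \sum_k (v 0 k / s ^+ k) *: P k.
  have sq : (size q <= n.+1)%N.
    by apply: (leq_trans (size_sum _ _ _)); apply/bigmax_leqP => k _;
      rewrite (leq_trans (size_scale_leq _ _))// size_P.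
  have q0 : q = 0.
    apply/eqP/negPn/negP => qn0.
    have /max_poly_roots := qn0 => /(_ zs); rewrite szs => h.
    suff /h : all (root q) zs by move=> /(_ zs_uniq); rewrite ltnNge sq.
    apply/(all_nthP 0) => j; rewrite szs => hj; apply/rootP.
    have := congr1 (fun M : 'rV_n.+1 => M 0 (Ordinal hj)) vV; rewrite !mxE => e.
    apply: etrans e; rewrite horner_sum; apply: eq_bigr => k _.
    rewrite !mxE /scaled_value hornerZ /=; ring.
  (* The coefficients vanish from the top down: once those above k are gone, only P_k still has
     degree k. *)
  have v0 (k : nat) (hk : (k < n.+1)%N) : v 0 (Ordinal hk) = 0.
    have [l] := ubnP (n - k); elim: l k hk => // l IHl k hk hl.
    have := congr1 (fun p : {poly R} => p`_k) q0; rewrite coef0 coef_sum.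
    rewrite (bigD1 (Ordinal hk))//= big1 ?addr0.
      rewrite coefZ P_coef// mulr1 => /eqP;
        rewrite mulf_eq0 invr_eq0 expf_eq0 (negbTE s0) andbF orbF.
      by move/eqP.
    move=> j jk; rewrite coefZ.
    case: (ltngtP j k) => [h|h|h].
    - by rewrite nth_default ?mulr0// size_P.
    - have := IHl j (ltn_ord j) ltac:(have := ltn_ord j; lia).
      by rewrite (_ : Ordinal _ = j) ?mul0r ?mul0r//; [move=> ->; rewrite !mul0r|exact: val_inj].
    - by case/eqP: jk; exact: val_inj.
  apply/rowP => k; rewrite mxE -[RHS](v0 k (ltn_ord k)); congr (v 0 _); exact: val_inj.
have JiV p : J ^+ p * V = V * D ^+ p.
  elim: p => [|p IHp]; first by rewrite !expr0 mul1r mulr1.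
  by rewrite exprSr -mulrA JV mulrA IHp -mulrA -exprSr.
have Di p : D ^+ p = diag_mx (\row_j (zs`_j / s) ^+ p).
  elim: p => [|p IHp].
    by rewrite expr0; apply/matrixP => k j; rewrite !mxE.
  rewrite exprS IHp -mulmxE mulmx_diag; congr diag_mx.
  by apply/rowP => j; rewrite !mxE exprS.
have -> : J ^+ i = V * D ^+ i * invmx V by rewrite -JiV -mulrA -!mulmxE mulmxV// mulmx1.
rewrite -!mulmxE mxtrace_mulC mulmxA mulVmx// mul1mx Di mxtrace_diag.
by rewrite (big_nth 0) szs big_mkord; apply: eq_bigr => j _; rewrite mxE.
Qed.

(** The usual bound of an eigenvalue by row sums, read off at the largest coordinate of the
    eigenvector; that coordinate is nonzero because P_0 = 1. *)
Lemma zeros_bound n z s K (x := fun k => beta k / s ^+ 2) : s != 0 ->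
  root (P n.+1) z -> (forall k, (k <= n)%N -> `|x k| <= K) -> `|z / s| <= 1 + K.
Proof.
move=> s0 rz hK.
pose v (k : 'I_n.+1) := `|scaled_value s z k|.
have [k _ kmax] := @arg_maxP _ R 'I_n.+1 ord0 xpredT v isT.
have v0 : v ord0 = 1.
  rewrite /v /scaled_value /= expr0 divr1.
  have /size_poly1P[c c0 P0] : size (P 0%N) == 1%N by rewrite size_P.
  by have := P_coef P_monic size_P 0; rewrite P0 coefC /= hornerC => ->; rewrite normr1.
have vk : 0 < v k by apply: lt_le_trans (kmax ord0 isT); rewrite v0.
rewrite -(ler_pM2r vk) /v -normrM -(jacobi_eigenvector s0 rz).
apply: (le_trans (ler_norm_sum _ _ _)).
apply: (@le_trans _ _ (\sum_j `|jacobi x n k j| * v k)).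
  by apply: ler_sum => j _; rewrite normrM ler_wpM2l//; exact: kmax.
rewrite -mulr_suml ler_wpM2r//; first exact: ltW.
by apply: rowsum_jacobi => //; rewrite /x mul0r.
Qed.

End Zeros.

(** * The Freud weight *)

Section HalfLine.
Variables (R : realType) (t : R) (m : nat).
Hypothesis hm : (2 <= m)%N.
Notation mu := (@lebesgue_measure R).

Definition freud_exponent (x : R) : R := t * x ^+ 2 - x ^+ (2 * m).

Definition half_freud (s x : R) : R := x `^ s * expR (freud_exponent x).

Local Notation V := freud_exponent.
Local Notation g := half_freud.

Lemma continuous_freud_exponent : continuous V.
Proof.
by move=> x; apply: cvgB; [apply: cvgMl_tmp|]; exact: exprn_continuous.
Qed.

Lemma measurable_freud_exp : measurable_fun [set: R] (expR \o V).
Proof.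
apply: measurableT_comp => //; apply: continuous_measurable_fun; exact: continuous_freud_exponent.
Qed.

Lemma measurable_half_freud s : measurable_fun [set: R] (g s).
Proof.
apply: measurable_funM; first exact: measurable_powR.
exact: measurable_freud_exp.
Qed.

(** The interval is exhausted by [1/(n+2), 1], where the primitive x^(s+1) / (s+1) bounds the
    integrals by 1/(s+1). *)
Lemma powR_integrable01 (s : R) : -1 < s -> mu.-integrable `]0, 1] (fun x => (x `^ s)%:E).
Proof.
move=> s1; have s0 : 0 < s + 1 by lra.
have mp D : measurable_fun D (fun x : R => (x `^ s)%:E).
  by apply/measurable_EFinP/measurable_funTS; exact: measurable_powR.
apply/integrableP; split; first exact: mp.
rewrite (_ : (\int[mu]_(x in `]0%R, 1%R]) `|(x `^ s)%:E|)%E = (\int[mu]_(x in `]0%R,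
  1%R]) (x `^ s)%:E)%E); last first.
  by apply: eq_integral => x _; rewrite gee0_abs// lee_fin powR_ge0.
pose F n : set R := `[n.+2%:R^-1, 1]%classic.
have n2 n : 0 < n.+2%:R^-1 :> R by rewrite invr_gt0.
have FU : \bigcup_n F n = `]0, 1]%classic.
  apply/seteqP; split => [x [n _]|x]; rewrite /F /= !in_itv /=.
    by move=> /andP[nx x1]; rewrite x1 andbT (lt_le_trans _ nx).
  move=> /andP[x0 x1]; exists (Num.bound x^-1) => //=.
  rewrite in_itv /= x1 andbT -[X in _ <= X]invrK lef_pV2 ?posrE ?invr_gt0//.
  apply: ltW; apply: (lt_le_trans (archi_boundP _)); first by rewrite invr_ge0 ltW.
  by rewrite ler_nat; lia.
have Fnd : nondecreasing_seq F.
  move=> i j ij; rewrite subsetEset => x; rewrite /F /= !in_itv /= => /andP[ix ->].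
  by rewrite andbT (le_trans _ ix)// lef_pV2 ?posrE// ler_nat.
have mF i : measurable (F i) by exact: measurable_itv.
have f0 i x : F i x -> (0%:E <= (x `^ s)%:E)%E by move=> _; rewrite lee_fin powR_ge0.
have mfF i : measurable_fun (F i) (fun x : R => (x `^ s)%:E) by exact: mp.
have cvgF : (\int[mu]_(x in F i) (x `^ s)%:E @[i --> \oo] -->
    \int[mu]_(x in \bigcup_i F i) (x `^ s)%:E)%E.
  exact: ge0_nondecreasing_set_cvg_integral.
rewrite -FU -(cvg_lim _ cvgF)//.
apply: (@le_lt_trans _ _ ((s + 1)^-1)%:E); last exact: ltry.
apply: lime_le.
  by apply/cvg_ex; eexists; exact: cvgF.
near=> n.
pose H (x : R) : R := (s + 1)^-1 * x `^ (s + 1).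
have dH (x : R) : 0 < x -> is_derive x 1 H (x `^ s).
  move=> x0; have h := is_derive1_powR (s + 1) x0.
  apply: (@is_derive_eq _ _ _ _ _ _ _ _ (is_deriveZ (s + 1)^-1 h)).
  by rewrite /GRing.scale /= mulrA mulVf ?gt_eqF// mul1r addrK.
have cH (x : R) : 0 < x -> H y @[y --> x] --> H x.
  move=> x0; apply: differentiable_continuous; apply/derivable1_diffP.
  by case: (dH x x0).
rewrite (@continuous_FTC2 _ (fun x => x `^ s) H).
- rewrite -EFinB lee_fin /H powR1 mulr1 gerBl mulr_ge0 ?powR_ge0// invr_ge0 ltW//.
- by rewrite invf_lt1// ltr1n.
- apply: continuous_in_subspaceT => x; rewrite inE /= in_itv /= => /andP[nx _].
  have x0 : 0 < x by exact: lt_le_trans nx.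
  apply: differentiable_continuous; apply/derivable1_diffP.
  by case: (is_derive1_powR s x0).
- split.
  + move=> x; rewrite in_itv /= => /andP[nx _].
    by have [] := dH x (lt_trans (n2 n) nx).
  + by apply: cvg_at_right_filter; exact: cH.
  + by apply: cvg_at_left_filter; exact: cH.
- move=> x; rewrite in_itv /= => /andP[nx _].
  by rewrite derive1E; have [_ ->] := dH x (lt_trans (n2 n) nx).
Unshelve. all: by end_near. Qed.

(** For x >= 1, x^s is at most e^(p x) and x^(2m) at least x^4. With y = x^2 the constant comes from
    (p + t + 1) y - y^2 <= (p + t + 1)^2 / 4, which leaves e^(-y). *)
Lemma half_freud_tail (s : R) : exists C, forall x, 1 <= x -> g s x <= C * gauss_fun x.
Proof.
pose p := (Num.bound `|s|)%:R : R.
have sp : s <= p by apply: le_trans (ler_norm _) (ltW _); exact: archi_boundP.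
exists (expR ((p + t + 1) ^+ 2 / 4)) => x x1.
have x0 : 0 < x by lra.
have h1 : x `^ s <= expR (p * x).
  apply: (@le_trans _ _ (x `^ p)); first exact: ler_powR.
  rewrite /p powR_mulrn ?(ltW x0)// expRM_natl.
  by rewrite lerXn2r ?nnegrE ?expR_ge0 ?(ltW x0)//; have := expR_ge1Dx x; lra.
apply: (@le_trans _ _ (expR (p * x) * expR (V x))).
  by rewrite ler_wpM2r ?expR_ge0.
rewrite -expRD /gauss_fun -expRD ler_expR /V.
have x4 : x ^+ 4 <= x ^+ (2 * m) by apply: ler_weXn2l => //; lia.
have x2 : 1 <= x ^+ 2 by rewrite exprn_ege1.
have p0 : 0 <= p by [].
have px : p * x <= p * x ^+ 2 by rewrite ler_wpM2l// expr2 ler_peMr// ltW.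
have h2 : 0 <= (x ^+ 2 - (p + t + 1) / 2) ^+ 2 by exact: sqr_ge0.
have e4 : x ^+ 4 = x ^+ 2 * x ^+ 2 by rewrite -exprD.
by rewrite e4 in x4; move: x4 px h2; set y := x ^+ 2; set z := x ^+ (2 * m); lra.
Qed.

Lemma half_freud_ge0 s x : 0 <= g s x.
Proof. by rewrite mulr_ge0 ?powR_ge0 ?expR_ge0. Qed.

Lemma freud_exponent_le1 x : 0 <= x -> x <= 1 -> V x <= `|t|.
Proof.
move=> x0 x1; have h1 : 0 <= x ^+ (2 * m) by rewrite exprn_ge0.
have h2 : x ^+ 2 <= 1 by rewrite exprn_ile1.
have h3 : 0 <= x ^+ 2 by rewrite sqr_ge0.
have h4 : t * x ^+ 2 <= `|t| * x ^+ 2 by rewrite ler_wpM2r// ler_norm.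
have h5 : `|t| * x ^+ 2 <= `|t| by rewrite ler_piMr.
rewrite /V; lra.
Qed.

Lemma half_freud_integrable (s : R) : -1 < s ->
  mu.-integrable `]0, +oo[ (fun x => (g s x)%:E).
Proof.
move=> s1; have [C hC] := half_freud_tail s.
pose C1 := expR `|t|.
pose h := (fun x : R => (C1%:E * ((fun y : R => (y `^ s)%:E) \_ `]0%R,
  1%R]) x + `|C|%:E * (gauss_fun x)%:E)%E).
apply: (@le_integrable _ _ _ mu _ _ _ h) => //.
- by apply/measurable_EFinP/measurable_funTS; exact: measurable_half_freud.
- move=> x xD; have x0 : 0 < x by move: xD; rewrite /= in_itv /= andbT.
  have gx0 := gauss_fun_ge0 x.
  rewrite gee0_abs ?lee_fin ?half_freud_ge0//.
  apply: (@le_trans _ _ (h x)); last exact: lee_abs.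
  rewrite /h patchE; case: ifPn => [|].
    rewrite inE /= in_itv /= => /andP[_ x1].
    rewrite -!EFinM -EFinD lee_fin.
    rewrite ler_wpDr ?mulr_ge0// [C1 * _]mulrC /half_freud ler_wpM2l ?powR_ge0//.
    by rewrite ler_expR freud_exponent_le1// ltW.
  rewrite notin_setE /= in_itv /= x0 /= => /negP; rewrite -ltNge => x1.
  rewrite mule0 add0e -EFinM lee_fin.
  by apply: (le_trans (hC x (ltW x1))); rewrite ler_wpM2r// ler_norm.
- have i1 : mu.-integrable `]0%R, +oo[ ((fun y : R => (y `^ s)%:E) \_ `]0%R, 1%R]).
    apply: (@integrableS _ _ _ _ setT) => //.
    by apply: (integrable_mkcond _ _).1 => //; exact: powR_integrable01.
  have i2 : mu.-integrable `]0%R, +oo[ (fun x => (gauss_fun x)%:E).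
    by apply: (@integrableS _ _ _ _ setT) => //; exact: integrableT_gauss.
  have mD : measurable (`]0%R, +oo[ : set (measurableTypeR R)) by exact: measurable_itv.
  exact: (integrableD mD (integrableZl mD C1 i1) (integrableZl mD `|C| i2)).
Qed.

Definition half_moment (s : R) : R := \int[mu]_(x in `]0%R, +oo[) g s x.

Lemma half_freud_derive (s x : R) : 0 < x -> is_derive x 1 (g (s + 1))
  ((s + 1) * g s x + 2 * t * g (s + 2) x - (2 * m)%:R * g (s + (2 * m)%:R) x).
Proof.
move=> x0.
have h1 := is_derive1_powR (s + 1) x0.
have h2 : is_derive x 1 V (t * (2%:R * x ^+ 1) - (2 * m)%:R * x ^+ (2 * m).-1).
  have i2 := is_deriveB (is_deriveZ t (is_deriveX 2 (is_derive_id x (1 : R^o))))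
    (is_deriveX (2 * m) (is_derive_id x (1 : R^o))).
  rewrite (_ : V = t \*: ((@id R) ^+ 2) - (@id R) ^+ (2 * m)); last first.
    by apply/funext => y; rewrite /freud_exponent !exprfctE.
  by apply: (is_derive_eq i2); rewrite /GRing.scale /= !mulr1.
have h3 := is_derive1_comp (is_derive_expR (V x)) h2.
apply: (is_derive_eq (is_deriveM h1 h3)).
rewrite /GRing.scale /= /half_freud.
have p1 : x `^ (s + 1) = x `^ s * x by rewrite powRD ?powRr1 ?(ltW x0)// (gt_eqF x0) implybT.
have p2 : x `^ (s + 2) = x `^ s * x ^+ 2.
  by rewrite powRD ?(gt_eqF x0) ?implybT// powR_mulrn// ltW.
have pm : x `^ (s + (2 * m)%:R) = x `^ s * x ^+ (2 * m).
  by rewrite powRD ?(gt_eqF x0) ?implybT// powR_mulrn// ltW.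
have em : x ^+ (2 * m) = x * x ^+ (2 * m).-1 by rewrite -exprS prednK//; lia.
by rewrite addrK p1 p2 pm em; ring.
Qed.

Lemma half_freud_cvg0 (s : R) : 0 < s -> g s x @[x --> 0^'+] --> (0 : R).
Proof.
move=> s0; rewrite -[X in _ --> X](mul0r (expR (V 0))); apply: cvgM; first exact: powR_cvg0.
apply: cvg_at_right_filter; apply: continuous_comp; last exact: continuous_expR.
exact: continuous_freud_exponent.
Qed.

Lemma half_freud_cvgy (s : R) : g s x @[x --> +oo] --> (0 : R).
Proof.
have [C hC] := half_freud_tail s.
have h : C * gauss_fun x @[x --> +oo] --> (0 : R).
  by rewrite -[X in _ --> X](mulr0 C); apply: cvgMl_tmp; exact: cvg_gauss_fun.
apply: squeeze_cvgr h; last exact: cvg_cst.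
near=> x; rewrite half_freud_ge0 hC//; near: x; exact: nbhs_pinfty_ge.
Unshelve. all: by end_near. Qed.

End HalfLine.

Section HalfVirial.
Variables (R : realType) (t : R) (m : nat).
Hypothesis hm : (2 <= m)%N.
Notation mu := (@lebesgue_measure R).
Local Notation g := (half_freud t m).
Local Notation D := (`]0%R, +oo[%classic : set (measurableTypeR R)).

Let f (s x : R) : R := (s + 1) * g s x + 2 * t * g (s + 2) x - (2 * m)%:R * g (s + (2 * m)%:R) x.

Let mD : measurable D. Proof. exact: measurable_itv. Qed.

Let intg (c s : R) : -1 < s -> mu.-integrable D (EFin \o (fun x => c * g s x)).
Proof.
by move=> s1; exact: (integrableZl mD c (half_freud_integrable t hm s1)).
Qed.

Let sm (s : R) : -1 < s -> -1 < s + (2 * m)%:R.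
Proof. by move=> s1; rewrite ltr_wpDr. Qed.

Let intD (s : R) : -1 < s ->
  mu.-integrable D (EFin \o (fun x => (s + 1) * g s x + 2 * t * g (s + 2) x)).
Proof.
move=> s1; have s2 : -1 < s + 2 by lra.
exact: (integrableD mD (intg (s + 1) s1) (intg (2 * t) s2)).
Qed.

Let intf (s : R) : -1 < s -> mu.-integrable D (EFin \o f s).
Proof.
by move=> s1; exact: (integrableB mD (intD s1) (intg _ (sm s1))).
Qed.

Lemma half_freud_continuous (s x : R) : 0 < x -> g s y @[y --> x] --> g s x.
Proof.
move=> x0; apply: differentiable_continuous; apply/derivable1_diffP.
by have := half_freud_derive t hm (s - 1) x0; rewrite subrK => -[].
Qed.

(** The integrand [f s] is the derivative of x^(s+1) e^V, which tends to 0 at infinity, and at 0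
    because s + 1 > 0. Dominated convergence passes from [1/(n+2), n+2] to the half-line. *)
Lemma half_virial (s : R) : -1 < s ->
  (s + 1) * half_moment t m s + 2 * t * half_moment t m (s + 2)
  - (2 * m)%:R * half_moment t m (s + (2 * m)%:R) = 0.
Proof.
move=> s1.
have <- : \int[mu]_(x in D) f s x = (s + 1) * half_moment t m s +
    2 * t * half_moment t m (s + 2) - (2 * m)%:R * half_moment t m (s + (2 * m)%:R).
  rewrite /f RintegralB//; last 2 first.
  - exact: intD.
  - by apply: intg; exact: sm.
  rewrite RintegralD//; last 2 first.
  - exact: intg.
  - by apply: intg; lra.
  rewrite !RintegralZl//; apply: half_freud_integrable => //; [exact: sm|lra].
pose F n : set R := `[n.+2%:R^-1, n.+2%:R]%classic.
have n20 n : 0 < n.+2%:R^-1 :> R by rewrite invr_gt0.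
have n21 n : 1 < n.+2%:R :> R by rewrite ltr1n.
have FD n : F n `<=` D.
  by move=> x; rewrite /F /= !in_itv /= andbT => /andP[nx _]; exact: lt_le_trans nx.
have FTC n : (\int[mu]_(x in D) (((EFin \o f s) \_ (F n)) x) =
    (g (s + 1) n.+2%:R - g (s + 1) n.+2%:R^-1)%:E)%E.
  rewrite -integral_mkcondr setIidr// (@continuous_FTC2 _ (f s) (g (s + 1))) ?EFinB//.
  - by rewrite (lt_trans _ (n21 n))// invf_lt1.
  - apply: continuous_in_subspaceT => x; rewrite inE /= in_itv /= => /andP[nx _].
    have x0 : 0 < x by exact: lt_le_trans nx.
    by apply: cvgB; [apply: cvgD|]; apply: cvgMl_tmp; exact: half_freud_continuous.
  - split.
    + move=> x; rewrite in_itv /= => /andP[nx _].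
      by have [] := half_freud_derive t hm s (lt_trans (n20 n) nx).
    + by apply: cvg_at_right_filter; exact: half_freud_continuous.
    + by apply: cvg_at_left_filter; exact: half_freud_continuous.
  - move=> x; rewrite in_itv /= => /andP[nx _].
    by rewrite derive1E; have [_ ->] := half_freud_derive t hm s (lt_trans (n20 n) nx).
have mf : measurable_fun D (EFin \o f s) by exact: measurable_int (intf s1).
have [] := @dominated_convergence _ _ _ mu D _ (fun n => (EFin \o f s) \_ (F n)) (EFin \o f s)
  (fun x => `|(EFin \o f s) x|%E).
- by [].
- move=> n; apply/(measurable_restrict _ _ _) => //; first exact: measurable_itv.
  by apply: measurable_funS mf => //; exact: subIsetl.
- exact: mf.
- apply: aeW => x /=; rewrite in_itv /= andbT => x0.
  apply: cvg_near_cst; near=> n; rewrite patchE mem_set// /F /= in_itv /=.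
  apply/andP; split.
    rewrite -[X in _ <= X]invrK lef_pV2 ?posrE ?invr_gt0//.
    apply: (@le_trans _ _ n%:R); last by rewrite ler_nat; lia.
    by near: n; exact: nbhs_infty_ger.
  apply: (@le_trans _ _ n%:R); last by rewrite ler_nat; lia.
  by near: n; exact: nbhs_infty_ger.
- exact: integrable_abse (intf s1).
- apply: aeW => x /= n _; rewrite patchE; case: ifPn => // _.
  by rewrite abse0.
move=> _ _ h.
have h0 : (\int[mu]_(x in D) (((EFin \o f s) \_ (F n)) x) @[n --> \oo] --> 0%:E)%E.
  under eq_fun do rewrite FTC.
  apply: cvg_EFin; first by near=> n.
  rewrite -[X in _ --> X](subr0 0) /=; apply: cvgB.
    apply: (@cvg_comp _ _ _ (fun n => n.+2%:R) (g (s + 1)) _ +oo%R _); last exact: half_freud_cvgy.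
    apply/cvgryPge => A; near=> n; apply: (@le_trans _ _ n%:R); last by rewrite ler_nat; lia.
    by near: n; exact: nbhs_infty_ger.
  have s10 : 0 < s + 1 by lra.
  have [h1 _] := cvg_at_rightP (g (s + 1)) 0 0.
  apply: (h1 (half_freud_cvg0 t m s10)); split => //.
  apply: ((@gtr0_cvgV0 R nat \oo _ (fun n => n.+2%:R : R) _).2); first by near=> n.
  apply/cvgryPge => A; near=> n.
  apply: (@le_trans _ _ n%:R); last by rewrite ler_nat; lia.
  by near: n; exact: nbhs_infty_ger.
by rewrite /Rintegral (cvg_unique _ h h0).
Unshelve. all: by end_near. Qed.

End HalfVirial.

Section FreudFunctional.
Variables (R : realType) (lam t : R) (m : nat).
Hypotheses (hm : (2 <= m)%N) (hlam : -1 < lam).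
Notation mu := (@lebesgue_measure R).
Local Notation w := (freud_weight lam t m).
Local Notation a := (2 * lam + 1).
Local Notation Dpos := (`]0%R, +oo[%classic : set (measurableTypeR R)).
Local Notation Dneg := (`]-oo, 0%R]%classic : set (measurableTypeR R)).

Let s_gt k : -1 < a + k%:R :> R.
Proof. by have := hlam; have : 0 <= k%:R :> R by []; lra. Qed.

Lemma freud_weight_ge0 x : 0 <= w x.
Proof. by rewrite mulr_ge0 ?powR_ge0 ?expR_ge0. Qed.

Lemma freud_weight_even x : w (- x) = w x.
Proof. by rewrite /freud_weight normrN !exprM !sqrrN. Qed.

Lemma measurable_freud_weight : measurable_fun [set: R] w.
Proof.
apply: measurable_funM; last exact: (measurable_freud_exp t m).
by apply: (@measurableT_comp _ _ _ _ _ _ (fun y : R => y `^ a)) => //.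
Qed.

Lemma freud_weight_pos k x : 0 < x -> x ^+ k * w x = half_freud t m (a + k%:R) x.
Proof.
move=> x0; rewrite /freud_weight /half_freud /freud_exponent (gtr0_norm x0) mulrA.
congr (_ * _); rewrite [RHS]powRD ?(gt_eqF x0) ?implybT//.
by rewrite powR_mulrn ?(ltW x0)// mulrC.
Qed.

Let fk k (x : R) : R := `|x| ^+ k * w x.

Let mfk k D : measurable_fun D (fun x => (fk k x)%:E).
Proof.
apply/measurable_EFinP/measurable_funTS/measurable_funM; last exact: measurable_freud_weight.
by apply: measurable_funX; exact: normr_measurable.
Qed.

Let fk_ge0 k x : 0 <= fk k x.
Proof. by rewrite mulr_ge0 ?freud_weight_ge0// exprn_ge0. Qed.

Let half_integral k :
  (\int[mu]_(x in Dneg) (fk k x)%:E = (half_moment t m (a + k%:R))%:E)%E /\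
  (\int[mu]_(x in Dpos) (fk k x)%:E = (half_moment t m (a + k%:R))%:E)%E.
Proof.
have h2 : (\int[mu]_(x in Dpos) (fk k x)%:E = (half_moment t m (a + k%:R))%:E)%E.
  rewrite /half_moment /Rintegral fineK; last first.
    by apply: integrable_fin_num => //; exact: half_freud_integrable.
  apply: eq_integral => x; rewrite inE /= in_itv /= andbT => x0.
  by rewrite /fk (gtr0_norm x0) freud_weight_pos.
split => //; rewrite -h2.
have f0 r : (0%:E <= (fk k r)%:E)%E by rewrite lee_fin.
have := @ge0_integration_by_substitution0 R (fun x => (fk k x)%:E) (@mfk k setT) f0.
rewrite -integral_itv_obnd_cbnd; last exact: mfk.
move=> ->; apply: eq_integral => x _.
by rewrite /fk normrN freud_weight_even.
Qed.

Let setT_split : [set: measurableTypeR R] = Dneg `|` Dpos.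
Proof.
apply/seteqP; split => // x _ /=; rewrite !in_itv /= andbT.
by case: (leP x 0) => h; [left|right].
Qed.

Let disj : [disjoint Dneg & Dpos].
Proof.
apply/disj_setPS => x [] /=; rewrite !in_itv /= andbT => h1 h2.
by have := le_lt_trans h1 h2; rewrite ltxx.
Qed.

Let integrable_abs k : mu.-integrable setT (fun x => (fk k x)%:E).
Proof.
apply/integrableP; split; first exact: mfk.
rewrite (_ : (\int[mu]_x `|(fk k x)%:E|)%E = (\int[mu]_x (fk k x)%:E)%E); last first.
  by apply: eq_integral => x _; rewrite gee0_abs ?lee_fin.
have [h1 h2] := half_integral k.
rewrite setT_split ge0_integral_setU//=; last 2 first.
- exact: mfk.
- by move=> x _; rewrite lee_fin.
by rewrite h1 h2 -EFinD ltry.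
Qed.

Lemma integrable_monomial k : mu.-integrable setT (EFin \o (fun x => x ^+ k * w x)).
Proof.
apply: (le_integrable _ _ _ (integrable_abs k)) => //.
  apply/measurable_EFinP/measurable_funM; last exact: measurable_freud_weight.
  exact: exprn_measurable.
by move=> x _ /=; rewrite /fk lee_fin !normrM !normrX normr_id.
Qed.

Lemma moment_split k : \int[mu]_x (x ^+ k * w x) =
  (1 + (-1) ^+ k) * half_moment t m (a + k%:R).
Proof.
have [h1 h2] := half_integral k.
rewrite setT_split Rintegral_setU//; last by rewrite -setT_split; exact: integrable_monomial.
have -> : \int[mu]_(x in Dpos) (x ^+ k * w x) = half_moment t m (a + k%:R).
  apply: eq_Rintegral => x; rewrite inE /= in_itv /= andbT => x0.
  exact: freud_weight_pos.
have -> : \int[mu]_(x in Dneg) (x ^+ k * w x) = \int[mu]_(x in Dneg) ((-1) ^+ k * fk k x).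
  apply: eq_Rintegral => x; rewrite inE /= in_itv /= => x0.
  by rewrite /fk (ler0_norm x0) [RHS]mulrA -exprMn mulN1r opprK.
rewrite RintegralZl//; last first.
  by apply: (integrableS _ _ (@subsetT _ _) (integrable_abs k)).
rewrite (_ : \int[mu]_(x in Dneg) fk k x = half_moment t m (a + k%:R));
  last by rewrite /Rintegral h1.
by ring.
Qed.

Lemma integrable_poly (p : {poly R}) : mu.-integrable setT (EFin \o (fun x => p.[x] * w x)).
Proof.
rewrite (_ : EFin \o _ = (fun x => \sum_(i <- index_enum 'I_(size p)) ((p`_i)%:E * (x ^+ i * w
  x)%:E))%E).
  apply: integrable_sum => // i _.
  exact: (integrableZl measurableT p`_i (integrable_monomial i)).
apply/funext => x /=; rewrite horner_coef mulr_suml -sumEFin; apply: eq_bigr => i _.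
by rewrite -mulrA EFinM.
Qed.

Definition freud_functional (p : {poly R}) : R := \int[mu]_x (p.[x] * w x).
Local Notation L := freud_functional.

Lemma freud_functional_linear c p q : L (c *: p + q) = c * L p + L q.
Proof.
rewrite /L -RintegralZl//; last exact: integrable_poly.
rewrite -RintegralD//; last 2 first.
- exact: (integrableZl _ c (integrable_poly p)).
- exact: integrable_poly.
by apply: eq_Rintegral => x _; rewrite hornerD hornerZ; ring.
Qed.

Lemma freud_functionalXn k : L 'X^k = (1 + (-1) ^+ k) * half_moment t m (a + k%:R).
Proof.
by rewrite -moment_split; apply: eq_Rintegral => x _; rewrite hornerXn.
Qed.

(** A vanishing integral would force p w = 0 almost everywhere, whereas p w is nonzero off a finite
    set. *)
Lemma freud_functional_gt0 p : p != 0 -> (forall x, 0 <= p.[x]) -> 0 < L p.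
Proof.
move=> p0 pge0; rewrite lt_neqAle Rintegral_ge0 ?andbT; last first.
  by move=> x _; rewrite mulr_ge0 ?freud_weight_ge0.
apply/eqP => Lp0.
have pw0 x : (0 <= (p.[x] * w x)%:E)%E by rewrite lee_fin mulr_ge0 ?freud_weight_ge0.
have mpw := measurable_int _ (integrable_poly p).
have I0 : (\int[mu]_x `|(p.[x] * w x)%:E| = 0)%E.
  rewrite (_ : (\int[mu]_x _)%E = (\int[mu]_x (p.[x] * w x)%:E)%E); last first.
    by apply: eq_integral => x _; rewrite gee0_abs.
  have fin : (\int[mu]_x (p.[x] * w x)%:E)%E \is a fin_num.
    by apply: integrable_fin_num => //; exact: integrable_poly.
  by rewrite -(fineK fin) -[fine _]/(L p) -Lp0.
have [N [mN N0 sN]] := (ae_eq_integral_abs mu measurableT mpw).1 I0.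
(* The factor X puts 0 into the exceptional set, since the weight may vanish there. *)
pose q := 'X * p; have q0 : q != 0 by rewrite mulf_neq0 ?polyX_eq0.
pose Z : set R := [set` rootsR q].
have cZ : countable Z by apply: finite_set_countable; exact: finite_seq.
have mZ : measurable (Z : set (measurableTypeR R)).
  by apply: countable_measurable => // x; exact: measurable_set1.
have Z0 : mu Z = 0%E by exact: countable_lebesgue_measure0.
have cover : setT `<=` N `|` Z.
  move=> x _; have [xq|xq] := boolP (root q x).
    by right; rewrite /Z /= ; have := roots_on_rootsR q0 x; rewrite in_itv /= => <-.
  left; apply: sN => /= /(_ I) /eqP; rewrite eqe mulf_eq0.
  move: xq; rewrite /q rootM negb_or rootX => /andP[x0 px].
  move: px; rewrite rootE => /negbTE -> /=.
  by rewrite /freud_weight mulf_eq0 powR_eq0 normr_eq0 (negbTE x0) (gt_eqF (expR_gt0 _)).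
have NZ0 : mu (N `|` Z) = 0%E by exact: null_set_setU.
have : (mu `]0%R, 1%R]%classic <= mu (N `|` Z))%E.
  by apply: le_measure; rewrite ?inE//; [exact: measurableU|move=> x _; exact: cover].
by rewrite NZ0 lebesgue_measure_itv /= lte_fin ltr01 -EFinB subr0 lee_fin ler10.
Qed.

(* The functional is packed as a linear form only here, because its linearity
   depends on the integrability hypotheses. *)
Lemma freud_scalar : {L' : {scalar {poly R}} | L' =1 L}.
Proof.
have lin : GRing.linear_for *%R L by move=> c p q; exact: freud_functional_linear.
pose f : {scalar {poly R}} := HB.pack L (GRing.isLinear.Build R {poly R} R *%R L lin).
by exists f.
Qed.

Section PolynomialIdentities.
Variable L' : {scalar {poly R}}.
Hypothesis L'E : L' =1 L.

Let poly_lin_ind (T : {poly R} -> Prop) : T 0 -> (forall p q, T p -> T q -> T (p + q)) ->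
  (forall c k, T (c *: 'X^k)) -> forall p, T p.
Proof.
by move=> T0 TD TX p; rewrite -[p]coefK poly_def; apply: big_ind => // i _.
Qed.

Lemma freud_scalar_even p : L' (p \Po - 'X) = L' p.
Proof.
elim/poly_lin_ind: p => [|p q hp hq|c k]; first by rewrite comp_poly0.
  by rewrite comp_polyD !linearD /= hp hq.
rewrite comp_polyZ comp_Xn_poly !linearZ /= -[- 'X]scaleN1r exprZn linearZ /= !L'E.
rewrite freud_functionalXn; congr (_ * _).
have e : (-1) ^+ k * (-1) ^+ k = 1 :> R by rewrite -exprMn mulrNN mulr1 expr1n.
by rewrite mulrA mulrDr mulr1 e addrC.
Qed.

(** By linearity q may be a monomial x^k; the identity is then [half_virial] at s = 2 lam + 1 + k,
    times the common parity factor 1 + (-1)^k. *)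
Lemma freud_scalar_virial q : L' ('X * q^`()) + (2 * lam + 2) * L' q
  + L' (((2 * t) *: 'X^2 - (2 * m)%:R *: 'X^(2 * m)) * q) = 0.
Proof.
elim/poly_lin_ind: q => [|p q hp hq|c k].
- by rewrite deriv0 !mulr0 linear0; ring.
- by move: hp hq; rewrite derivD !mulrDr !linearD /=; lra.
have e1 : 'X * ('X^k)^`() = k%:R *: 'X^k :> {poly R}.
  by case: k => [|k]; rewrite derivXn ?mulr0n ?scale0r ?mulr0//= -scaler_nat -scalerAr -exprS.
have e3 : ((2 * t) *: 'X^2 - (2 * m)%:R *: 'X^(2 * m)) * (c *: 'X^k) =
    (c * (2 * t)) *: 'X^(2 + k) - (c * (2 * m)%:R) *: 'X^(2 * m + k) :> {poly R}.
  by rewrite -scalerAr mulrBl -!scalerAl -!exprD scalerBr !scalerA.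
have L'Z d p : L' (d *: p) = d * L' p by rewrite linearZ.
rewrite derivZ -scalerAr e1 scalerA e3 linearB /= !L'Z !L'E.
rewrite !freud_functionalXn.
have hv := half_virial t hm (s_gt k).
rewrite [(2 + k)%N]addnC [(2 * m + k)%N]addnC (natrD _ k 2) (natrD _ k (2 * m)).
have -> : (-1) ^+ (k + 2) = (-1) ^+ k :> R by rewrite exprD sqrrN expr1n mulr1.
have -> : (-1) ^+ (k + 2 * m) = (-1) ^+ k :> R by rewrite exprD exprM sqrrN !expr1n mulr1.
move: hv; rewrite !addrA; set M := half_moment _ _ _; set M2 := half_moment _ _ _.
set M3 := half_moment _ _ _; set sg := (-1) ^+ k => hv.
rewrite -[RHS](mulr0 (c * (1 + sg))) -hv; ring.
Qed.

End PolynomialIdentities.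

End FreudFunctional.

(** * The limit density *)

Section SemicircleMoments.
Variables (R : realType) (c : R).
Hypothesis c0 : 0 < c.
Notation mu := (@lebesgue_measure R).

(** The derivative is asked for on the open interval only, as the semicircle is not differentiable
    at -1 and 1. *)
Lemma Rintegral_scaled_FTC (phi h : R -> R) : continuous phi -> continuous h ->
  (forall y : R, -1 < y < 1 -> is_derive y 1 h (phi y)) ->
  \int[mu]_(x in `[- c, c]) phi (x / c) = c * (h 1 - h (-1)).
Proof.
move=> cphi ch dh.
have cdiv (x : R) : z / c @[z --> x] --> x / c by apply: cvgMr_tmp; exact: cvg_id.
have chc (x : R) : c * h (z / c) @[z --> x] --> c * h (x / c).
  by apply: cvgMl_tmp; apply: (cvg_comp _ _ (cdiv x)); exact: ch.
have dhc (x : R) : x \in `]- c, c[ -> is_derive x 1 (fun z => c * h (z / c)) (phi (x / c)).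
  rewrite in_itv /= => /andP[x1 x2].
  have xc : -1 < x / c < 1.
    by rewrite ltr_pdivlMr// mulN1r x1 ltr_pdivrMr// mul1r.
  have dd : is_derive x 1 (fun z : R => z / c) c^-1.
    have := is_deriveZ c^-1 (is_derive_id x (1 : R^o)).
    rewrite /GRing.scale /= mulr1 => hd; rewrite (_ : (fun z => z / c) = c^-1 \*: @id R)//.
    by apply/funext => z /=; rewrite mulrC.
  have := is_deriveZ c (@is_derive1_comp R h (fun z => z / c) x _ _ (dh _ xc) dd).
  move=> hd; apply: (is_derive_eq hd); rewrite /GRing.scale /=.
  by rewrite mulrCA divff ?gt_eqF// mulr1.
rewrite /Rintegral (@continuous_FTC2 _ _ (fun z => c * h (z / c))).
- by rewrite /= divff ?gt_eqF// mulNr divff ?gt_eqF// -mulrBr.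
- by have h0 := c0; lra.
- by apply: continuous_subspaceT => x; apply: (cvg_comp _ _ (cdiv x)); exact: cphi.
- split; first by move=> x /dhc[].
    by apply: cvg_at_right_filter; exact: chc.
  by apply: cvg_at_left_filter; exact: chc.
- by move=> x /dhc hd; rewrite derive1E; have [_ ->] := hd.
Qed.

Definition semicircle (y : R) : R := Num.sqrt (1 - y ^+ 2).
Local Notation u := semicircle.

Lemma semicircle_ge0 y : 0 <= u y. Proof. exact: sqrtr_ge0. Qed.

Lemma continuous_semicircle : continuous u.
Proof.
move=> y; apply: continuous_comp; last exact: sqrt_continuous.
by apply: cvgB; [exact: cvg_cst|exact: exprn_continuous].
Qed.

Lemma semicircle1 : u 1 = 0 /\ u (-1) = 0.
Proof. by rewrite /u sqrrN expr1n subrr sqrtr0. Qed.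

Lemma semicircle_sqr (y : R) : -1 < y < 1 -> 0 < u y /\ u y ^+ 2 = 1 - y ^+ 2.
Proof.
move=> /andP[y1 y2]; have h : 0 < 1 - y ^+ 2 by nra.
by rewrite /u sqrtr_gt0 h sqr_sqrtr// ltW.
Qed.

Lemma is_derive_semicircle (y : R) : -1 < y < 1 -> is_derive y 1 u (- y / u y).
Proof.
move=> yy; have [u0 u2] := semicircle_sqr yy.
have h : 0 < 1 - y ^+ 2 by rewrite -u2 exprn_gt0.
have d1 : is_derive y 1 (fun z : R => 1 - z ^+ 2) (0 - 2%:R * y ^+ 1).
  have := is_deriveB (is_derive_cst (1 : R) y (1 : R^o)) (is_deriveX 2 (is_derive_id y (1 : R^o))).
  move=> hd; rewrite (_ : (fun z => 1 - z ^+ 2) = cst 1 - (@id R) ^+ 2); last first.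
    by apply/funext => z; rewrite !fctE.
  by apply: (is_derive_eq hd); rewrite /GRing.scale /= mulr1.
have := @is_derive1_comp R Num.sqrt (fun z => 1 - z ^+ 2) y _ _ (is_derive1_sqrt h) d1.
move=> hd; apply: (is_derive_eq hd).
rewrite -[Num.sqrt (1 - y ^+ 2)]/(u y); field.
by rewrite gt_eqF.
Qed.

Lemma continuous_monoM k (f : R -> R) : continuous f -> continuous (fun y : R => y ^+ k * f y).
Proof. by move=> cf y; apply: cvgM; [exact: exprn_continuous|exact: cf]. Qed.

Lemma is_derive_mono k (y : R) : is_derive y 1 (fun z : R => z ^+ k) (k%:R * y ^+ k.-1).
Proof.
have hd := is_deriveX k (is_derive_id y (1 : R^o)).
rewrite (_ : (fun z => z ^+ k) = (@id R) ^+ k); last by rewrite exprfctE.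
by apply: (is_derive_eq hd); rewrite /GRing.scale /= mulr1.
Qed.

Definition semicircle_moment k : R := \int[mu]_(x in `[- c, c]) ((x / c) ^+ k * u (x / c)).
Local Notation I := semicircle_moment.

Lemma semicircle_moment_integrable k :
  mu.-integrable `[- c, c] (EFin \o (fun x => (x / c) ^+ k * u (x / c))).
Proof.
apply: continuous_compact_integrable; first exact: segment_compact.
apply: continuous_subspaceT => x.
have cdiv : z / c @[z --> x] --> x / c by apply: cvgMr_tmp; exact: cvg_id.
apply: (@cvg_comp _ _ _ (fun z => z / c) (fun y => y ^+ k * u y) _ _ _ cdiv);
  apply: continuous_monoM; exact: continuous_semicircle.
Qed.

Lemma semicircle_moment1 : I 1 = 0.
Proof.
pose h (y : R) := (- 3%:R^-1) * ((1 - y ^+ 2) * u y).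
transitivity (c * (h 1 - h (-1))); last first.
  by have [u1 u2] := semicircle1; rewrite /h u1 u2 !mulr0 subrr mulr0.
apply: (@Rintegral_scaled_FTC (fun y => y ^+ 1 * u y) h).
- by apply: continuous_monoM; exact: continuous_semicircle.
- move=> y; apply: cvgMl_tmp; apply: cvgM; last exact: continuous_semicircle.
  by apply: cvgB; [exact: cvg_cst|exact: exprn_continuous].
move=> y yy; have [u0 u2] := semicircle_sqr yy.
have d1 := is_deriveB (is_derive_cst (1 : R) y (1 : R^o)) (is_derive_mono 2 y).
have hd := is_deriveZ (- 3%:R^-1) (is_deriveM d1 (is_derive_semicircle yy)).
apply: (is_derive_eq hd); rewrite /GRing.scale /= !fctE.
rewrite -[1 - y ^+ 2]u2.
by field; rewrite gt_eqF.
Qed.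

(** The derivative of y^(k+1) (1 - y^2)^(3/2), a function that vanishes at both ends, combines the
    integrands of orders k and k+2. *)
Lemma semicircle_moment_rec k : k.+4%:R * I k.+2 = k.+1%:R * I k.
Proof.
pose h (y : R) := y ^+ k.+1 * ((1 - y ^+ 2) * u y).
pose phi (y : R) := k.+1%:R * (y ^+ k * u y) - k.+4%:R * (y ^+ k.+2 * u y).
have cmu j := continuous_monoM (k := j) continuous_semicircle.
have : \int[mu]_(x in `[- c, c]) phi (x / c) = c * (h 1 - h (-1)).
  apply: Rintegral_scaled_FTC.
  - by move=> y; apply: cvgB; apply: cvgMl_tmp; exact: cmu.
  - apply: continuous_monoM => y; apply: cvgM; last exact: continuous_semicircle.
    by apply: cvgB; [exact: cvg_cst|exact: exprn_continuous].
  move=> y yy; have [u0 u2] := semicircle_sqr yy.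
  have d1 := is_deriveB (is_derive_cst (1 : R) y (1 : R^o)) (is_derive_mono 2 y).
  have hd := is_deriveM (is_derive_mono k.+1 y) (is_deriveM d1 (is_derive_semicircle yy)).
  apply: (is_derive_eq hd); rewrite /GRing.scale /= !fctE /phi.
  have e2 : y ^+ 2 = 1 - u y ^+ 2 by rewrite u2; ring.
  rewrite (exprS y k.+1) (exprS y k) -!natr1.
  move: (u y) (y ^+ k) u0 e2 => U Y U0 e2.
  have -> : y * (y * Y) = y ^+ 2 * Y by ring.
  have -> : y * Y * ((1 - y ^+ 2) * (- y / U) + U * (0 - (0 + 1 + 1) * y ^+ 1)) =
    Y * (- (y ^+ 2) * (1 - y ^+ 2) / U - 2 * y ^+ 2 * U) by ring.
  by rewrite e2; field; rewrite gt_eqF.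
have [u1 u2] := semicircle1; rewrite /h u1 u2 !mulr0 subrr mulr0 /phi.
rewrite RintegralB//; last 2 first.
- exact: (integrableZl _ _ (semicircle_moment_integrable k)).
- exact: (integrableZl _ _ (semicircle_moment_integrable k.+2)).
rewrite !RintegralZl//; [|exact: semicircle_moment_integrable..].
by rewrite -/(I k) -/(I k.+2); lra.
Qed.

Lemma semicircle_moment0 : I 0 = c * (pi / 2).
Proof.
(* atan (y / (1 + u)) is half of arcsin y, so [h] is the primitive (y u + arcsin y) / 2 of u,
   continuous up to the ends. *)
pose v (y : R) := y / (1 + u y).
have u10 y : 0 < 1 + u y by have := semicircle_ge0 y; lra.
pose h (y : R) := 2^-1 * (y * u y) + atan (v y).
have cv : continuous v.
  move=> y; apply: cvgM; first exact: cvg_id.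
  apply: cvgV; first by rewrite gt_eqF.
  by apply: cvgD; [exact: cvg_cst|exact: continuous_semicircle].
transitivity (c * (h 1 - h (-1))); last first.
  have [u1 u2] := semicircle1; rewrite /h /v u1 u2 !mulr0 addr0 !divr1 !add0r atanN atan1.
  by congr (_ * _); field.
apply: (@Rintegral_scaled_FTC (fun y => y ^+ 0 * u y) h).
- by apply: continuous_monoM; exact: continuous_semicircle.
- move=> y; apply: cvgD.
    by apply: cvgMl_tmp; apply: cvgM; [exact: cvg_id|exact: continuous_semicircle].
  by apply: (cvg_comp _ _ (cv y)); exact: continuous_atan.
move=> y yy; have [u0 u2] := semicircle_sqr yy.
have d1 := is_deriveD (is_derive_cst (1 : R) y (1 : R^o)) (is_derive_semicircle yy).
have n0 : (cst 1 + u) y != 0 by rewrite fctE gt_eqF.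
have d2 := is_deriveM (is_derive_id y (1 : R^o)) (is_deriveV n0 d1).
have d3 := is_derive1_comp (is_derive1_atan (v y)) d2.
have d4 := is_deriveM (is_derive_id y (1 : R^o)) (is_derive_semicircle yy).
apply: (is_derive_eq (is_deriveD (is_deriveZ 2^-1 d4) d3)).
rewrite /GRing.scale /= !fctE expr0 mul1r /v /=.
have vv : (1 + (y / (1 + u y)) ^+ 2)^-1 = (1 + u y) / 2.
  apply: (mulfI (_ : 1 + (y / (1 + u y)) ^+ 2 != 0)).
    by rewrite gt_eqF// ltr_pwDl// sqr_ge0.
  rewrite divff ?gt_eqF//; last by rewrite ltr_pwDl// sqr_ge0.
  have -> : (y / (1 + u y)) ^+ 2 = (1 - u y ^+ 2) / (1 + u y) ^+ 2.
    by rewrite expr_div_n u2; congr (_ / _); ring.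
  by field; rewrite gt_eqF ?u10.
have e2 : y ^+ 2 = 1 - u y ^+ 2 by rewrite u2; ring.
rewrite vv; move: (u y) (u10 y) u0 e2 => U U1 U0 e2.
rewrite (_ : y * (- y / U) = - (y ^+ 2) / U); last by ring.
have -> : y * (- (1 + U) ^- 2 * (0 + - y / U)) = y ^+ 2 / ((1 + U) ^+ 2 * U).
  by field; rewrite !gt_eqF.
by rewrite e2; field; rewrite !gt_eqF.
Qed.

End SemicircleMoments.

Section DensityProbability.
Variables (R : realType) (f : R -> R).
Hypotheses (f_ge0 : forall x, 0 <= f x)
  (f_int : lebesgue_measure.-integrable setT (EFin \o f))
  (f1 : (\int[lebesgue_measure]_x (f x)%:E = 1)%E).
Local Open Scope ereal_scope.

Lemma density_probability : exists P : probability (measurableTypeR R) R,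
  forall A, measurable A -> P A = \int[lebesgue_measure]_(x in A) (f x)%:E.
Proof.
pose F (A : set (measurableTypeR R)) : \bar R := \int[lebesgue_measure]_(x in A) (f x)%:E.
have F0 : F set0 = 0 by rewrite /F integral_set0.
have Fge0 A : 0 <= F A by rewrite /F integral_ge0// => x _; rewrite lee_fin.
have Fsa : semi_sigma_additive F.
  move=> A mA tA mUA; rewrite /F integral_bigcup//=; last first.
    by apply: (integrableS _ _ (@subsetT _ _)) => //; exact: f_int.
  apply: is_cvg_ereal_nneg_natsum_cond => n _ _.
  by apply: integral_ge0 => /= x ?; rewrite lee_fin.
pose Pm : {measure set (measurableTypeR R) -> \bar R} :=
  HB.pack F (isMeasure.Build _ _ _ F F0 Fge0 Fsa).
have P1 : Pm setT = 1 by exact: f1.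
pose P : probability (measurableTypeR R) R :=
  HB.pack F (isMeasure.Build _ _ _ F F0 Fge0 Fsa) (Measure_isProbability.Build _ _ R Pm P1).
by exists P.
Qed.

(** The Radon-Nikodym derivative of P agrees with f almost everywhere, since both have the same
    integral over every measurable set. *)
Lemma integral_density (P : probability (measurableTypeR R) R) (g : measurableTypeR R -> R) :
  (forall A, measurable A -> P A = \int[lebesgue_measure]_(x in A) (f x)%:E) ->
  measurable_fun setT g -> (exists M, forall x, (`|g x| <= M)%R) ->
  \int[P]_x (g x)%:E = \int[lebesgue_measure]_x (g x * f x)%:E.
Proof.
move=> PE mg [M gM].
have dom : P `<< @lebesgue_measure R.
  apply/null_content_dominatesP => A mA muA0.
  rewrite PE//; apply: null_set_integral => //.
  by apply: measurable_funTS; exact: measurable_int f_int.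
have mgE : measurable_fun setT (fun x : measurableTypeR R => (g x)%:E) by exact/measurable_EFinP.
have Pg : P.-integrable setT (fun x => (g x)%:E).
  apply: measurable_bounded_integrable => //.
    by rewrite (le_lt_trans (probability_le1 P _)) ?ltry.
  exists M; split; first exact: num_real.
  by move=> r Mr x _ /=; exact: le_trans (gM x) (ltW Mr).
rewrite -(Radon_Nikodym_change_of_variables dom measurableT Pg).
have mfE : measurable_fun setT (fun x : measurableTypeR R => (f x)%:E) by exact:
  measurable_int f_int.
apply: ae_eq_integral => //.
- apply: emeasurable_funM => //; apply: (measurable_int lebesgue_measure).
- by under [X in measurable_fun _ X]eq_fun do rewrite EFinM; exact: emeasurable_funM.
rewrite (_ : (fun x => (g x * f x)%:E) = (fun x => (g x)%:E * (f x)%:E)); last first.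
  by apply/funext => x; rewrite EFinM.
apply: ae_eqe_mul2l; rewrite Radon_NikodymE//.
case: cid => /= h [h1 h2 h3].
apply: integral_ae_eq => //= A _ mA.
by rewrite -h3//= PE.
Qed.

End DensityProbability.

Section FreudDensity.
Variables (R : realType) (m : nat).
Hypothesis hm : (2 <= m)%N.
Notation mu := (@lebesgue_measure R).

Lemma pochhammerS (a : R) k : pochhammer a k.+1 = pochhammer a k * (a + k%:R).
Proof. by rewrite /pochhammer big_ord_recr. Qed.

Lemma pochhammer0 (a : R) : pochhammer a 0 = 1.
Proof. by rewrite /pochhammer big_ord0. Qed.

Lemma pochhammer1 k : pochhammer (1 : R) k = k`!%:R.
Proof.
elim: k => [|k IHk]; first by rewrite pochhammer0.
by rewrite pochhammerS IHk factS natrM -natr1; ring.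
Qed.

(** 3 + 2k is odd and 2m is even; hence no denominator of the hypergeometric series vanishes. *)
Lemma half_shift_neq0 k : 3 / 2 - m%:R + k%:R != 0 :> R.
Proof.
apply/eqP => h.
have : (3 + 2 * k)%:R = (2 * m)%:R :> R by rewrite natrD !natrM; lra.
by move/eqP; rewrite eqr_nat => /eqP; lia.
Qed.

Lemma pochhammer_half_neq0 k : pochhammer (3 / 2 - m%:R : R) k != 0.
Proof.
elim: k => [|k IHk]; first by rewrite pochhammer0 oner_neq0.
by rewrite pochhammerS mulf_neq0// half_shift_neq0.
Qed.

(** The coefficient of z^k in the hypergeometric series, where (1)_k has cancelled against k!. *)
Definition density_coef k : R := pochhammer (1 - m%:R) k / pochhammer (3 / 2 - m%:R) k.
Local Notation r := density_coef.

Lemma density_coef0 : r 0 = 1. Proof. by rewrite /r !pochhammer0 divr1. Qed.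

Lemma density_coef_rec k : r k.+1 * (3 / 2 - m%:R + k%:R) = r k * (1 - m%:R + k%:R).
Proof.
rewrite /r !pochhammerS; move: (pochhammer_half_neq0 k) (half_shift_neq0 k).
move: (pochhammer _ k) (3 / 2 - m%:R + k%:R) => q d q0 d0.
by field; rewrite q0 d0.
Qed.

Lemma density_coef_ge k : (m <= k)%N -> r k = 0.
Proof.
move=> mk; rewrite /r; suff -> : pochhammer (1 - m%:R : R) k = 0 by rewrite mul0r.
have mk' : (m.-1 < k)%N by lia.
rewrite /pochhammer (bigD1 (Ordinal mk'))//=.
have -> : 1 - m%:R + m.-1%:R = 0 :> R by rewrite -subn1 natrB; [ring|lia].
by rewrite mul0r.
Qed.

(** As long as k + 1 < m, the numerator and the denominator of the ratio of consecutive coefficients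
    are both negative. *)
Lemma density_coef_ge0 k : 0 <= r k.
Proof.
elim: k => [|k IHk]; first by rewrite density_coef0.
have [mk|mk] := leqP m k.+1; first by rewrite density_coef_ge.
have h1 : k%:R + 2 <= m%:R :> R by rewrite -natrD ler_nat; lia.
have d0 : 3 / 2 - m%:R + k%:R < 0 :> R by lra.
have n0 : 1 - m%:R + k%:R <= 0 :> R by lra.
have -> : r k.+1 = r k * (1 - m%:R + k%:R) / (3 / 2 - m%:R + k%:R).
  by rewrite -density_coef_rec mulfK// half_shift_neq0.
by rewrite -mulrA mulr_ge0// mulr_le0// invr_le0 ltW.
Qed.

Lemma hypergeometric2F1_sum (z : R) :
  hypergeometric2F1 1 (1 - m%:R) (3 / 2 - m%:R) z = \sum_(j < m) r j * z ^+ j.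
Proof.
apply/cvg_lim => //; apply: cvg_near_cst; exists m => // n /= mn.
rewrite /pseries /series /= -(big_mkord xpredT (fun j => r j * z ^+ j)).
rewrite (@big_cat_nat _ _ _ m)//= [X in _ + X]big_nat_cond [X in _ + X]big1 ?addr0.
  apply: eq_bigr => j _; rewrite pochhammer1 /r.
  have f0 : j`!%:R != 0 :> R by rewrite pnatr_eq0 -lt0n fact_gt0.
  have q0 := pochhammer_half_neq0 j.
  by move: (pochhammer (3 / 2 - _) j) q0 => q q0; field; rewrite f0 q0.
move=> j /andP[/andP[mj _] _]; have := density_coef_ge mj; rewrite /r => /eqP.
rewrite mulf_eq0 invr_eq0 (negbTE (pochhammer_half_neq0 j)) orbF => /eqP ->.
by rewrite mulr0 !mul0r.
Qed.

(** The moment of order 2k of the arcsine law on [-1, 1]. *)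
Definition arcsine_coef k : R := 'C(k.*2, k)%:R / 4 ^+ k.
Local Notation gam := arcsine_coef.

Lemma arcsine_coef_rec k : gam k.+1 * (2 * k.+1%:R) = gam k * (2 * k%:R + 1).
Proof.
clear hm.
have h1 : (k.+1 * 'C(k.+1.*2, k.+1) = k.+1.*2 * 'C(k.*2.+1, k))%N.
  by rewrite -mul_bin_diag doubleS.
have h2 : (k.+1 * 'C(k.*2.+1, k) = k.*2.+1 * 'C(k.*2, k))%N.
  rewrite -(@bin_sub k.*2.+1 k); last by lia.
  by rewrite (_ : (k.*2.+1 - k)%N = k.+1); [rewrite -mul_bin_diag|lia].
have e1 : k.+1%:R * 'C(k.+1.*2, k.+1)%:R = 2 * k.+1%:R * 'C(k.*2.+1, k)%:R :> R.
  by rewrite -!natrM h1 mul2n.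
have e2 : k.+1%:R * 'C(k.*2.+1, k)%:R = (2 * k%:R + 1) * 'C(k.*2, k)%:R :> R.
  by rewrite -natrM h2 natrM -natr1 -muln2 natrM [k%:R * 2]mulrC.
have k0 : k.+1%:R != 0 :> R by rewrite pnatr_eq0.
have f0 : (4 : R) ^+ k != 0 by rewrite expf_neq0.
rewrite /gam [4 ^+ k.+1]exprS; move: e1 e2 k0 f0.
move: ('C(k.+1.*2, k.+1)%:R) ('C(k.*2.+1, k)%:R) ('C(k.*2,
  k)%:R) (k.+1%:R) (4 ^+ k) => X Y Z K F e1 e2 K0 F0.
have -> : X / (4 * F) * (2 * K) = (K * X) / (2 * F) by field.
rewrite e1; have -> : 2 * K * Y = 2 * (K * Y) by ring.
by rewrite e2; field.
Qed.

(* With g_j the central binomial ratios, the j-th term is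
   [r_(j+1) (j+3/2-m) g_(p+j+1) - r_j (j+1/2-m) g_(p+j)], up to a factor 2. *)
Lemma density_coef_sum p :
  (m + p)%:R * \sum_(j < m) r j * (gam (p + j) / (p + j).+1%:R) = (2 * m%:R - 1) * gam p.
Proof.
pose K j := r j * (j%:R + 2^-1 - m%:R) * gam (p + j).
have step j : (m + p)%:R * (r j * (gam (p + j) / (p + j).+1%:R)) = 2 * (K j.+1 - K j).
  have hr := density_coef_rec j; have hg := arcsine_coef_rec (p + j).
  rewrite /K addnS.
  have -> : r j.+1 * (j.+1%:R + 2^-1 - m%:R) = r j * (1 - m%:R + j%:R).
    by rewrite -hr -natr1; field.
  have p0 : (p + j).+1%:R != 0 :> R by rewrite pnatr_eq0.
  have -> : gam (p + j).+1 = gam (p + j) * (2 * (p + j)%:R + 1) / (2 * (p + j).+1%:R).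
    by rewrite -hg mulfK// mulf_neq0// pnatr_eq0.
  move: p0; rewrite -natr1 !natrD => p0.
  by field.
rewrite mulr_sumr; under eq_bigr do rewrite step.
rewrite -mulr_sumr -(big_mkord xpredT (fun j => K j.+1 - K j)) telescope_sumr// /K
  density_coef_ge// density_coef0 addn0.
by field.
Qed.

Section Moments.
Variables (l : R).
Hypothesis l0 : 0 < l.
Local Notation c := (freud_c m l).
Local Notation f := (freud_density m l).
Local Notation kappa := ((2 * m)%:R / (c * pi * (2 * m%:R - 1))).
Local Notation I := (semicircle_moment c).

Lemma pochhammer_half_gt0 k : 0 < pochhammer (2^-1 : R) k.
Proof. by apply: prodr_gt0 => i _; rewrite ltr_pwDl// invr_gt0. Qed.

Lemma freud_c_gt0 : 0 < c.
Proof.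
rewrite /freud_c /freud_a !mulr_gt0// ?invr_gt0// powR_gt0//.
by rewrite divr_gt0 ?pochhammer_half_gt0// ltr0n fact_gt0.
Qed.

Let c0 := freud_c_gt0.

Let kappa0 : 0 <= kappa.
Proof.
have h1 : 1 <= m%:R :> R by rewrite ler1n; lia.
have h2 : 0 <= 2 * m%:R - 1 :> R by lra.
by rewrite divr_ge0// mulr_ge0// mulr_ge0 ?pi_ge0// ltW ?c0.
Qed.

Lemma freud_density_sum x :
  f x = kappa * \sum_(j < m) r j * ((x / c) ^+ j.*2 * semicircle (x / c)).
Proof.
rewrite /freud_density -expr_div_n hypergeometric2F1_sum -mulrA; congr (_ * _).
rewrite mulr_sumr; apply: eq_bigr => j _.
by rewrite /semicircle -mul2n exprM; ring.
Qed.

Lemma freud_density_ge0 x : 0 <= f x.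
Proof.
rewrite freud_density_sum mulr_ge0// sumr_ge0// => j _.
by rewrite mulr_ge0 ?density_coef_ge0// mulr_ge0 ?semicircle_ge0// -muln2 exprM sqr_ge0.
Qed.

(** [Num.sqrt] is 0 on nonpositive arguments. Integrals of the density over the interval may
    therefore be taken over the whole line. *)
Lemma freud_density_out x : x \notin `]- c, c[ -> f x = 0.
Proof.
move=> xc; rewrite freud_density_sum big1 ?mulr0// => j _.
rewrite /semicircle ler0_sqrtr ?mulr0// subr_le0.
have : 1 <= `|x / c|.
  rewrite normrM (gtr0_norm (_ : 0 < c^-1)) ?invr_gt0// ler_pdivlMr// mul1r.
  by move: xc; rewrite in_itv /= -ltr_norml -leNgt.
by move=> h; rewrite -[X in _ <= X]ger0_norm ?sqr_ge0// normrX exprn_ege1.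
Qed.

Lemma continuous_freud_density : continuous f.
Proof.
rewrite (_ : f = fun x => kappa * \sum_(j < m) r j * ((x / c) ^+ j.*2 * semicircle (x / c)));
  last first.
  by apply/funext => x; exact: freud_density_sum.
move=> x; apply: cvgMl_tmp; apply: cvg_big => [|j _]; [exact: add_continuous|apply: cvgMl_tmp].
have cdiv : z / c @[z --> x] --> x / c by apply: cvgMr_tmp; exact: cvg_id.
apply: (@cvg_comp _ _ _ (fun z => z / c) (fun y => y ^+ j.*2 * semicircle y) _ _ _ cdiv).
by apply: continuous_monoM; exact: continuous_semicircle.
Qed.

Lemma semicircle_moment_odd k : odd k -> I k = 0.
Proof.
elim/ltn_ind: k => -[|[|k]] IHk //= ok; first exact: semicircle_moment1.
have := semicircle_moment_rec c0 k; rewrite (IHk k)//; last by move: ok; rewrite negbK.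
by move=> /eqP; rewrite mulr0 mulf_eq0 pnatr_eq0 /= => /eqP.
Qed.

(** Up to the total mass c pi / 2 these are the even moments of the semicircle law, Catalan numbers
    over 4^p. *)
Lemma semicircle_moment_even p : I p.*2 = c * (pi / 2) * (gam p / p.+1%:R).
Proof.
elim: p => [|p IHp]; first by rewrite semicircle_moment0// /gam bin0 expr0 !divr1 mulr1.
have h4 : p.*2.+4%:R != 0 :> R by rewrite pnatr_eq0.
apply: (mulfI h4); rewrite doubleS semicircle_moment_rec// IHp.
have hg := arcsine_coef_rec p.
have p1 : p.+1%:R != 0 :> R by rewrite pnatr_eq0.
have p2 : p.+2%:R != 0 :> R by rewrite pnatr_eq0.
have -> : gam p.+1 = gam p * (2 * p%:R + 1) / (2 * p.+1%:R) by rewrite -hg mulfK// mulf_neq0.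
have -> : p.*2.+4%:R = 2 * p.+2%:R :> R by rewrite -natrM; congr (_%:R); lia.
have -> : p.*2.+1%:R = 2 * p%:R + 1 :> R by rewrite -natr1 -muln2 natrM mulrC.
move: (p.+1%:R) (p.+2%:R) p1 p2 => a b a0 b0.
by field; rewrite a0 b0.
Qed.

(** Each term of the density contributes a semicircle moment; [density_coef_sum] adds them up, and
    its factor 2m - 1 cancels the one in the normalising constant. *)
Lemma freud_density_moment k : \int[mu]_(x in `[- c, c]) (x ^+ k * f x) =
  (~~ odd k)%:R * (c ^+ k * gam k./2 * (m%:R / (m + k./2)%:R)).
Proof.
have cn0 : c != 0 by rewrite gt_eqF.
have e x : x ^+ k * f x = \sum_(j < m) (kappa * c ^+ k * r j) * ((x / c) ^+ (k + j.*2) *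
  semicircle (x / c)).
  rewrite freud_density_sum mulrCA -mulrA !mulr_sumr; apply: eq_bigr => j _.
  rewrite -{1}[x](divfK cn0) exprMn exprD; ring.
under eq_Rintegral do rewrite e.
have intS (s : seq 'I_m) : \int[mu]_(x in `[- c, c])
    \sum_(j <- s) (kappa * c ^+ k * r j) * ((x / c) ^+ (k + j.*2) * semicircle (x / c)) =
    \sum_(j <- s) (kappa * c ^+ k * r j) * I (k + j.*2).
  have ij (j : 'I_m) : mu.-integrable `[- c, c] (EFin \o
     (fun x => kappa * c ^+ k * r j * ((x / c) ^+ (k + j.*2) * semicircle (x / c)))).
    exact: (integrableZl _ _ (semicircle_moment_integrable c _)).
  elim: s => [|j s IHs].
    by rewrite big_nil; under eq_Rintegral do rewrite big_nil; rewrite Rintegral_cst// mul0r.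
  rewrite big_cons -IHs; under eq_Rintegral do rewrite big_cons.
  rewrite RintegralD//; last first.
    rewrite (_ : _ \o _ = (fun x => \sum_(j <- s) (kappa * c ^+ k * r j * ((x / c) ^+ (k + j.*2)
      * semicircle (x / c)))%:E)%E).
      by apply: integrable_sum => // i _; exact: ij.
    by apply/funext => x /=; rewrite sumEFin.
  rewrite RintegralZl//; exact: semicircle_moment_integrable.
rewrite intS; case: (boolP (odd k)) => ok /=.
  by rewrite mul0r big1// => j _; rewrite semicircle_moment_odd ?mulr0// oddD odd_double addbF.
have kE : k = k./2.*2 by rewrite -[LHS]odd_double_half (negbTE ok).
set p := k./2 in kE *.
have hs := density_coef_sum p.
have step (j : 'I_m) : kappa * c ^+ k * r j * I (k + j.*2) =
    kappa * c ^+ k * (c * (pi / 2)) * (r j * (gam (p + j) / (p + j).+1%:R)).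
  by rewrite [in I _]kE -doubleD semicircle_moment_even; ring.
rewrite (eq_bigr _ (fun j _ => step j)).
rewrite -mulr_sumr mul1r.
have mp0 : (m + p)%:R != 0 :> R by rewrite pnatr_eq0; lia.
have -> : \sum_(j < m) r j * (gam (p + j) / (p + j).+1%:R) = (2 * m%:R - 1) * gam p / (m + p)%:R.
  by rewrite -hs mulrAC divff// mul1r.
have h1 : 1 <= m%:R :> R by rewrite ler1n; lia.
have m1 : 2 * m%:R - 1 != 0 :> R by rewrite gt_eqF//; lra.
have pi0 : pi != 0 :> R by rewrite gt_eqF// pi_gt0.
rewrite natrM; move: ((m + p)%:R) (c ^+ k) mp0 => D ck D0.
move: (m%:R) m1 => M m1; move: c cn0 => C cn0.
move: (@pi R) pi0 => q q0.
by field; rewrite D0 m1 q0 cn0.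
Qed.

End Moments.

End FreudDensity.

(** * Weierstrass approximation and the method of moments *)

Section Bernstein.
Variable R : realType.
Implicit Types (phi psi : nat -> R) (n k : nat) (x : R).

(* [(bernstein n phi).[x]] is the expectation of [phi] under the binomial law
   with parameters n and x. *)
Fixpoint bernstein n phi : {poly R} :=
  if n is n'.+1 then 'X * bernstein n' (fun k => phi k.+1) + (1 - 'X) * bernstein n' phi
  else (phi 0%N)%:P.

Lemma bernsteinS n phi x : (bernstein n.+1 phi).[x] =
  x * (bernstein n (fun k => phi k.+1)).[x] + (1 - x) * (bernstein n phi).[x].
Proof. by rewrite /= !hornerE. Qed.

Lemma ler_bernstein n phi psi x : 0 <= x -> x <= 1 ->
  (forall k, phi k <= psi k) -> (bernstein n phi).[x] <= (bernstein n psi).[x].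
Proof.
move=> x0 x1; elim: n phi psi => [|n IHn] phi psi h; first by rewrite !hornerC.
rewrite !bernsteinS lerD// ler_wpM2l ?subr_ge0//; first by apply: IHn => k.
exact: IHn.
Qed.

Lemma bernstein_affine n phi (a b : R) x :
  (bernstein n (fun k => a * phi k + b)).[x] = a * (bernstein n phi).[x] + b.
Proof.
elim: n phi => [|n IHn] phi; first by rewrite !hornerC.
by rewrite !bernsteinS (IHn (fun k => phi k.+1)) IHn; ring.
Qed.

(** Variance of the binomial law plus squared bias. *)
Lemma bernstein_sqr n (a : R) x :
  (bernstein n (fun k => (k%:R - a) ^+ 2)).[x] = n%:R * x * (1 - x) + (n%:R * x - a) ^+ 2.
Proof.
elim: n a => [|n IHn] a; first by rewrite hornerC; ring.
rewrite bernsteinS IHn (_ : (fun k => (k.+1%:R - a) ^+ 2) = (fun k => (k%:R - (a - 1)) ^+ 2)).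
  by rewrite IHn -natr1; ring.
by apply/funext => k; rewrite -natr1; ring.
Qed.

Lemma bernstein_shift n phi (b : R) x :
  (bernstein n (fun k => phi k - b)).[x] = (bernstein n phi).[x] - b.
Proof.
have := bernstein_affine n phi 1 (- b) x; rewrite mul1r => <-.
by congr (bernstein _ _).[_]; apply/funext => k; rewrite mul1r.
Qed.

Lemma bernstein_opp n phi x : (bernstein n (fun k => - phi k)).[x] = - (bernstein n phi).[x].
Proof.
have := bernstein_affine n phi (-1) 0 x; rewrite addr0 mulN1r => <-.
by congr (bernstein _ _).[_]; apply/funext => k; rewrite mulN1r addr0.
Qed.

Lemma bernstein_dist n (f : R -> R) (e M : R) x : 0 <= M -> 0 <= x -> x <= 1 ->
  (forall u, `|f u - f x| <= e + M * (u - x) ^+ 2) ->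
  `|(bernstein n.+1 (fun k => f (k%:R / n.+1%:R))).[x] - f x| <= e + M / n.+1%:R.
Proof.
move=> M0 x0 x1 h; set N := n.+1%:R.
have N0 : 0 < N :> R by rewrite ltr0n.
have E : (bernstein n.+1 (fun k => M / N ^+ 2 * (k%:R - N * x) ^+ 2 + e)).[x] <= e + M / N.
  rewrite bernstein_affine bernstein_sqr subrr expr0n addr0 addrC lerD2l.
  rewrite (_ : M / N ^+ 2 * (N * x * (1 - x)) = M / N * (x * (1 - x))); last by field;
    rewrite gt_eqF.
  rewrite ler_piMr ?divr_ge0 ?(ltW N0)//; nra.
have hk k : `|f (k%:R / N) - f x| <= M / N ^+ 2 * (k%:R - N * x) ^+ 2 + e.
  rewrite (_ : M / N ^+ 2 * (k%:R - N * x) ^+ 2 = M * (k%:R / N - x) ^+ 2); last by field;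
    rewrite gt_eqF.
  by rewrite [X in _ <= X]addrC h.
rewrite -bernstein_shift ler_norml lerNl -bernstein_opp; apply/andP; split;
  apply: le_trans E; apply: ler_bernstein => // k; apply: le_trans (hk k).
  by rewrite -normrN ler_norm.
exact: ler_norm.
Qed.

(** Near x, uniform continuity applies; for |u - x| >= d the crude bound 2K is at most 2K (u - x)^2
    / d^2. The point u is unrestricted because [ler_bernstein] compares the data at every k, also
    beyond n. *)
Lemma quadratic_modulus (f : R -> R) (a b K e : R) : continuous f ->
  (forall x, `|f x| <= K) -> 0 < e ->
  exists2 M, 0 <= M & forall x u, a <= x <= b -> `|f u - f x| <= e + M * (u - x) ^+ 2.
Proof.
move=> cf fK e0.
have /compact_near_coveringP cov := @segment_compact R a b.
have e2 : 0 < e / 2 by rewrite divr_gt0.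
have : \forall d \near 0^'+, `[a, b]%classic `<=` [set x | forall u,
  `|u - x| < d -> `|f u - f x| <= e].
  apply: cov.
  move=> x0 _; have /cvgrPdist_le /(_ _ e2) := cf x0.
  move=> /nbhs_ballP[eta /= eta0 heta].
  exists (ball x0 (eta / 2), [set d | 0 < d < eta / 2]).
    split => /=; first by apply: nbhsx_ballx; rewrite divr_gt0.
    by near=> d; apply/andP; split; near: d; [exact: nbhs_right_gt|apply: nbhs_right_lt;
      rewrite divr_gt0].
  move=> [y d] /= [yx /andP[d0 de]] u uy.
  have y1 : `|x0 - y| < eta / 2 by exact: yx.
  have u1 : `|x0 - u| < eta.
    by rewrite (le_lt_trans (ler_distD y _ _))// [eta]splitr ltrD// distrC (lt_trans uy).
  have h1 := heta u u1.
  have h2 : `|f x0 - f y| <= e / 2 by apply: heta;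
    rewrite /ball /= (lt_trans y1)// gtr_pMr// invf_lt1// ltr1n.
  rewrite (le_trans (ler_distD (f x0) _ _))// [e]splitr lerD//.
  by rewrite distrC.
move=> near_d.
have [d [d0 hd]] : exists d : R, 0 < d /\ (forall x, a <= x <= b -> forall u,
  `|u - x| < d -> `|f u - f x| <= e).
  have [] := @filter_ex _ (0^'+) _ _ (filterI near_d (nbhs_right_gt (0 : R))).
  by move=> d [hd d0]; exists d; split => // x xab; apply: hd; rewrite /= in_itv.
have K0 : 0 <= K by apply: le_trans (fK 0).
exists (2 * K / d ^+ 2); first by rewrite divr_ge0 ?mulr_ge0 ?exprn_ge0// ltW.
move=> x u xab; have [ud|du] := ltP `|u - x| d.
  apply: (le_trans (hd x xab u ud)); rewrite lerDl mulr_ge0 ?sqr_ge0//.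
  by rewrite divr_ge0 ?mulr_ge0 ?exprn_ge0// ltW.
have h1 : `|f u - f x| <= 2 * K.
  by apply: (le_trans (ler_normB _ _)); have := fK u; have := fK x; lra.
apply: (le_trans h1); apply: ler_wpDl; first exact: ltW.
have K2 : 0 <= 2 * K by rewrite mulr_ge0.
have -> : 2 * K / d ^+ 2 * (u - x) ^+ 2 = 2 * K * ((u - x) ^+ 2 / d ^+ 2) by ring.
rewrite ler_peMr// ler_pdivlMr ?exprn_gt0// mul1r.
by rewrite -(ger0_norm (sqr_ge0 (u - x))) normrX lerXn2r ?nnegrE// ltW.
Unshelve. all: by end_near. Qed.

Lemma weierstrass (f : R -> R) (B K e : R) : 0 < B -> continuous f ->
  (forall x, `|f x| <= K) -> 0 < e ->
  exists p : {poly R}, forall x, - B <= x <= B -> `|f x - p.[x]| <= e.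
Proof.
move=> B0 cf fK e0; pose g y := f (2 * B * y - B).
have e2 : 0 < e / 2 by rewrite divr_gt0.
have cg : continuous g.
  move=> y; apply: (@cvg_comp _ _ _ (fun y => 2 * B * y - B) f _ _ _ _ (cf _)).
  by apply: cvgB; [apply: cvgMl_tmp; exact: cvg_id|exact: cvg_cst].
have [M M0 hM] := quadratic_modulus 0 1 cg (fun x => fK _) e2.
pose n := Num.bound (M / (e / 2)).
have hn : M / n.+1%:R <= e / 2.
  rewrite ler_pdivrMr ?ltr0n// mulrC -ler_pdivrMr//.
  apply: (le_trans (ltW (archi_boundP _))); first by rewrite divr_ge0// ltW.
  by rewrite ler_nat.
exists (bernstein n.+1 (fun k => g (k%:R / n.+1%:R)) \Po ((2 * B)^-1 *: ('X + B%:P))).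
move=> x /andP[x1 x2]; pose y := (2 * B)^-1 * (x + B).
rewrite horner_comp (_ : (_ *: _).[x] = y); last by rewrite !hornerE.
have B2 : 0 < 2 * B by rewrite mulr_gt0.
have y0 : 0 <= y by rewrite mulr_ge0 ?invr_ge0 ?(ltW B2)//; lra.
have y1 : y <= 1 by rewrite /y mulrC ler_pdivrMr//; lra.
have gy : g y = f x by rewrite /g /y mulrA divff ?gt_eqF// mul1r addrK.
have y01 : 0 <= y <= 1 by rewrite y0.
have := @bernstein_dist n g (e / 2) M y M0 y0 y1 (fun u => hM y u y01).
rewrite gy distrC => h; apply: (le_trans h).
by rewrite [X in _ <= X]splitr lerD2l.
Qed.

End Bernstein.

Section ZeroCounting.
Variable R : realType.
Implicit Types (s : seq R) (g : R -> R).

(** For the empty list the inverse of 0 is 0, so the mean is 0, in agreement with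
    [zero_counting_measure]. *)
Definition seq_mean s g : R := (\sum_(z <- s) g z) / (size s)%:R.

Lemma ge0_integral_zero_counting s g : measurable_fun [set: measurableTypeR R] g -> (forall x,
    0 <= g x) ->
  (\int[zero_counting_measure s]_x (g x)%:E = (seq_mean s g)%:E)%E.
Proof.
move=> mg g0.
have mgE : measurable_fun [set: measurableTypeR R] (fun x => (g x)%:E) by exact/measurable_EFinP.
have g0E (x : measurableTypeR R) : setT x -> (0 <= (g x)%:E)%E by rewrite lee_fin.
rewrite /zero_counting_measure ge0_integral_mscale//.
rewrite ge0_integral_measure_sum//.
under eq_bigr do rewrite integral_dirac// diracT mul1e.
rewrite sumEFin -EFinM /= /seq_mean mulrC; congr (_ * _)%:E.
by rewrite (big_nth 0) big_mkord.
Qed.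

Lemma integral_zero_counting s g : measurable_fun [set: measurableTypeR R] g ->
  (\int[zero_counting_measure s]_x (g x)%:E = (seq_mean s g)%:E)%E.
Proof.
move=> mg; rewrite integralE.
rewrite (_ : (\int[zero_counting_measure s]_x (fun x => (g x)%:E)^\+ x)%E = (seq_mean s (fun x =>
  Num.max (g x) 0))%:E); last first.
  rewrite -ge0_integral_zero_counting; last 2 first.
  - exact: measurable_funrpos.
  - by move=> x; rewrite le_max lexx orbT.
  by apply: eq_integral => x _; rewrite funeposE EFin_max.
rewrite (_ : (\int[zero_counting_measure s]_x (fun x => (g x)%:E)^\- x)%E = (seq_mean s (fun x =>
  Num.max (- g x) 0))%:E); last first.
  rewrite -ge0_integral_zero_counting; last 2 first.
  - exact: measurable_funrneg.
  - by move=> x; rewrite le_max lexx orbT.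
  by apply: eq_integral => x _; rewrite funenegE EFin_max.
rewrite -EFinB /seq_mean -mulrBl -sumrB; congr (_ / _)%:E.
apply: eq_bigr => z _; case: (leP (g z) 0) => h.
  by rewrite (max_idPl _) ?oppr_ge0//; ring.
by rewrite (max_idPr _) ?oppr_le0 ?ltW//; ring.
Qed.

Lemma seq_mean_poly s (p : {poly R}) :
  seq_mean s (horner p) = \sum_(i < size p) p`_i * seq_mean s (fun z => z ^+ i).
Proof.
rewrite /seq_mean; under eq_bigr do rewrite horner_coef.
rewrite exchange_big mulr_suml; apply: eq_bigr => i _.
by rewrite -mulr_sumr mulrA.
Qed.

Lemma seq_mean_dist s g h e : 0 <= e -> (forall z, z \in s -> `|g z - h z| <= e) ->
  `|seq_mean s g - seq_mean s h| <= e.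
Proof.
move=> e0 gh; rewrite /seq_mean -mulrBl -sumrB normrM [`|_^-1|]ger0_norm ?invr_ge0//.
case: s gh => [|z0 s] gh; first by rewrite big_nil normr0 mul0r.
rewrite ler_pdivrMr ?ltr0n//; apply: (le_trans (ler_norm_sum _ _ _)).
rewrite -sum1_size natr_sum mulr_sumr big_seq [X in _ <= X]big_seq.
by apply: ler_sum => z zs; rewrite mulr1 gh.
Qed.

End ZeroCounting.

Section MethodOfMoments.
Variables (R : realType) (xs : nat -> seq R) (f : R -> R) (B : R) (M : nat -> R).
Notation mu := (@lebesgue_measure R).
Hypotheses (B0 : 0 < B) (f_ge0 : forall x, 0 <= f x) (cf : continuous f)
  (f1 : \int[mu]_(x in `[- B, B]) f x = 1)
  (fM : forall i, \int[mu]_(x in `[- B, B]) (x ^+ i * f x) = M i)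
  (xsB : \forall k \near \oo, forall z, z \in xs k -> `|z| <= B)
  (xsM : forall i, seq_mean (xs k) (fun z => z ^+ i) @[k --> \oo] --> M i).

Let integrableM (g : R -> R) : continuous g ->
  mu.-integrable `[- B, B] (EFin \o (fun x => g x * f x)).
Proof.
move=> cg; apply: continuous_compact_integrable; first exact: segment_compact.
by apply: continuous_subspaceT => x; apply: cvgM; [exact: cg|exact: cf].
Qed.

Let integral_poly (p : {poly R}) :
  \int[mu]_(x in `[- B, B]) (p.[x] * f x) = \sum_(i < size p) p`_i * M i.
Proof.
have intX i c : mu.-integrable `[- B, B] (EFin \o (fun x => c * (x ^+ i * f x))).
  exact: (integrableZl _ _ (integrableM (@exprn_continuous _ i))).
have step (s : seq 'I_(size p)) : mu.-integrable `[- B,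
  B] (EFin \o (fun x => \sum_(i <- s) p`_i * (x ^+ i * f x))) /\
   \int[mu]_(x in `[- B, B]) (\sum_(i <- s) p`_i * (x ^+ i * f x)) = \sum_(i <- s) p`_i * M i.
  elim: s => [|i s [IH1 IH2]].
    rewrite big_nil; under eq_Rintegral do rewrite big_nil.
    rewrite Rintegral_cst// mul0r; split => //.
    rewrite (_ : EFin \o _ = cst 0%E); first exact: integrable0.
    by apply/funext => x /=; rewrite big_nil.
  rewrite big_cons -IH2; under eq_Rintegral do rewrite big_cons.
  rewrite RintegralD// RintegralZl//; last exact: (integrableM (@exprn_continuous _ i)).
  rewrite fM; split => //.
  rewrite (_ : EFin \o _ = EFin \o (fun x => p`_i * (x ^+ i * f x) + \sum_(j <- s) p`_j * (x ^+ j
    * f x))).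
    exact: (integrableD _ (intX i p`_i) IH1).
  by apply/funext => x /=; rewrite big_cons.
have [_ <-] := step (index_enum _); apply: eq_Rintegral => x _.
by rewrite horner_coef mulr_suml; apply: eq_bigr => i _; rewrite mulrA.
Qed.

(** Three errors of size e/3: replacing g by a polynomial in the mean, where all zeros must
    eventually lie in [-B, B]; doing so in the integral, where f has mass 1; and the convergence of
    moments. *)
Lemma moments_weak (g : R -> R) (C : R) : continuous g -> (forall x, `|g x| <= C) ->
  seq_mean (xs k) g @[k --> \oo] --> \int[mu]_(x in `[- B, B]) (g x * f x).
Proof.
move=> cg gC; apply/cvgrPdist_le => /= e e0.
have e3 : 0 < e / 3 by rewrite divr_gt0.
have [p hp] := weierstrass B0 cg gC e3.
have cp : continuous (horner p) by exact: continuous_horner.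
have pcvg : seq_mean (xs k) (horner p) @[k --> \oo] --> \int[mu]_(x in `[- B, B]) (p.[x] * f x).
  rewrite integral_poly; under eq_fun do rewrite seq_mean_poly.
  by apply: cvg_big => [|i _]; [exact: add_continuous|apply: cvgMl_tmp; exact: xsM].
have Tdist : `|\int[mu]_(x in `[- B, B]) (g x * f x) - \int[mu]_(x in `[- B,
  B]) (p.[x] * f x)| <= e / 3.
  rewrite -RintegralB//; [|exact: integrableM..].
  have gp_int : mu.-integrable `[- B, B] (EFin \o (fun x => g x * f x - p.[x] * f x)).
    exact: (integrableB _ (integrableM cg) (integrableM cp)).
  apply: (le_trans (le_normr_Rintegral _ gp_int)) => //.
  have -> : e / 3 = e / 3 * \int[mu]_(x in `[- B, B]) f x by rewrite f1 mulr1.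
  rewrite -RintegralZl//; last first.
    rewrite (_ : EFin \o f = EFin \o (fun x => cst 1 x * f x)).
      by apply: integrableM; exact: cst_continuous.
    by apply/funext => x /=; rewrite mul1r.
  apply: le_Rintegral => //.
  - exact: integrable_norm.
  - by apply: (@integrableM (cst (e / 3))); exact: cst_continuous.
  - move=> x; rewrite /= in_itv /= => xB.
    by rewrite -mulrBl normrM (ger0_norm (f_ge0 x)) ler_wpM2r// hp.
near=> k.
have h1 : `|seq_mean (xs k) g - seq_mean (xs k) (horner p)| <= e / 3.
  apply: seq_mean_dist; first exact: ltW.
  have hk : forall z, z \in xs k -> `|z| <= B by near: k.
  by move=> z /hk; rewrite ler_norml; exact: hp.
have h2 : `|\int[mu]_(x in `[- B, B]) (p.[x] * f x) - seq_mean (xs k) (horner p)| <= e / 3.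
  by near: k; move/cvgrPdist_le : pcvg => /(_ _ e3).
have tri (a b a' b' : R) : `|b - b'| <= e / 3 -> `|a' - b'| <= e / 3 ->
    `|a - a'| <= e / 3 -> `|a - b| <= e.
  move=> h3 h4 h5; have -> : a - b = (a - a') + ((a' - b') - (b - b')) by ring.
  apply: (le_trans (ler_normD _ _)); apply: (@le_trans _ _ (e / 3 + (e / 3 + e / 3))); last by lra.
  by apply: lerD => //; apply: (le_trans (ler_normB _ _)); apply: lerD.
exact: tri h1 h2 Tdist.
Unshelve. all: by end_near. Qed.

End MethodOfMoments.

(** * The zeros of the Freud polynomials *)

Section Constants.
Variables (R : realType) (m : nat).

Lemma arcsine_coef_pochhammer k : pochhammer (2^-1 : R) k = arcsine_coef R k * k`!%:R.
Proof.
elim: k => [|k IHk]; first by rewrite pochhammer0 /arcsine_coef bin0 expr0 divr1 mul1r.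
rewrite pochhammerS IHk factS natrM.
have := arcsine_coef_rec R k; move: (arcsine_coef R k) (arcsine_coef R k.+1) (k`!%:R) => g g' F h.
have -> : g' * (k.+1%:R * F) = (g' * (2 * k.+1%:R)) * F / 2 by field.
by rewrite h; field.
Qed.

Lemma powR_rootX (a : R) n : (0 < n)%N -> 0 <= a -> (a `^ n%:R^-1) ^+ n = a.
Proof.
by move=> n0 a0; rewrite -powR_mulrn ?powR_ge0// -powRrM mulVf ?powRr1// pnatr_eq0 -lt0n.
Qed.

Lemma freud_scale_sqr n : freud_scale R m n ^+ 2 = natroot R m n.
Proof.
rewrite /freud_scale /natroot -powR_mulrn ?powR_ge0// -powRrM; congr (_ `^ _).
by rewrite natrM invfM mulrAC mulVf ?mul1r.
Qed.

Hypothesis hm : (2 <= m)%N.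

Lemma freud_a_gt0 : 0 < freud_a R m.
Proof.
by rewrite mulr_gt0// ?invr_gt0// powR_gt0// divr_gt0 ?pochhammer_half_gt0// ltr0n fact_gt0.
Qed.

(** Since (1/2)_m = C(2m, m) m! / 4^m and 2m C(2m-1, m-1) = m C(2m, m), the powers of 4 cancel and
    a^2 is the constant A of the model. *)
Lemma freud_aX : (freud_a R m ^+ 2) ^+ m * (m.*2 * 'C(m.*2.-1, m.-1))%:R = 1.
Proof.
have p0 := pochhammer_half_gt0 R m.
have m0 : (0 < m)%N by exact: ltnW.
rewrite -exprM /freud_a exprMn powR_rootX; last 2 first.
- by rewrite muln_gt0.
- by rewrite divr_ge0// ltW.
have hb : (m.*2 * 'C(m.*2.-1, m.-1) = m * 'C(m.*2, m))%N.
  by have h := mul_bin_diag m.*2 m.-1; rewrite prednK in h.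
have hf : m`! = (m * (m.-1)`!)%N by case: (m) m0.
rewrite hb arcsine_coef_pochhammer /arcsine_coef hf !natrM exprVn exprM.
have -> : (2 : R) ^+ 2 = 4 by ring.
have C0 : 'C(m.*2, m)%:R != 0 :> R by rewrite pnatr_eq0 -lt0n bin_gt0; lia.
have F0 : (m.-1)`!%:R != 0 :> R by rewrite pnatr_eq0 -lt0n fact_gt0.
have M0 : m%:R != 0 :> R by rewrite pnatr_eq0 -lt0n.
have H0 : (4 : R) ^+ m != 0 by rewrite expf_neq0.
move: C0 F0 M0 H0; move: ('C(m.*2, m)%:R) ((m.-1)`!%:R) (m%:R) (4 ^+ m) => C F M H C0 F0 M0 H0.
by field; rewrite C0 F0 M0 H0.
Qed.

End Constants.

Lemma freud_zeros (R : realType) (lam t : R) (m : nat) (P : nat -> {poly R}) :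
  -1 < lam -> (2 <= m)%N ->
  monic_orthogonal_polynomials (freud_weight lam t m) P ->
  exists (Z : nat -> seq R) (K : R),
  [/\ 0 <= K, forall n, P n = \prod_(z <- Z n) ('X - z%:P),
      forall n z, z \in Z n -> `|z| <= K * freud_scale R m n
    & forall i, seq_mean (Z n) (fun z => (z / freud_scale R m n) ^+ i) @[n --> \oo]
        --> ullman_moment m (freud_a R m ^+ 2) i].
Proof.
move=> hlam hm [hP1 hP2].
have m0 : (0 < m)%N by exact: ltnW.
have [L LE] := freud_scalar t hm hlam.
have L_gt0 p : p != 0 -> (forall x, 0 <= p.[x]) -> 0 < L p.
  by rewrite LE; exact: freud_functional_gt0.
have P_monic n : P n \is monic by have [] := hP1 n.
have size_P n : size (P n) = n.+1 by have [] := hP1 n.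
have P_orth i j : i <> j -> L (P i * P j) = 0.
  move=> ij; rewrite LE /freud_functional /Rintegral.
  by under eq_integral do rewrite hornerM; rewrite hP2.
have L_even := freud_scalar_even hm hlam LE.
have L_virial := freud_scalar_virial hm hlam LE.
pose beta := rec_coef L P.
pose e k : R := (odd k)%:R * (2 * lam + 1).
have beta0 : beta 0%N = 0 by [].
have beta_gt0 k : (0 < k)%N -> 0 < beta k by exact: rec_coef_gt0.
have e_le k : `|e k| <= `|2 * lam + 1|.
  by rewrite /e normrM normr_nat; case: (odd k); rewrite ?mul1r ?mul0r.
(* For odd k the right-hand side k + 2 lam + 1 equals (k - 1) + (2 lam + 2), hence is at least c0 k;
   lam > -1 makes c0 positive. *)
pose c0 := Num.min 1 (2 * lam + 2).
have c0_gt0 : 0 < c0 by rewrite lt_min ltr01/=; move: hlam; lra.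
have c0_le1 : c0 <= 1 by rewrite ge_min lexx.
have c0_le2 : c0 <= 2 * lam + 2 by rewrite ge_min lexx orbT.
have e_ge k : c0 * k%:R <= k%:R + e k.
  case: k => [|k]; first by rewrite /e mulr0 mul0r addr0.
  have h : c0 * k%:R <= k%:R by rewrite ler_piMl.
  rewrite /e -natr1; case: (odd _); rewrite ?mul1r ?mul0r ?addr0; move: h c0_le1 c0_le2; lra.
have freud_eq k : (0 < k)%N -> freud_lhs m beta k = k%:R + e k + 2 * t * beta k.
  exact: (freud_equation L_gt0 P_monic size_P P_orth L_even m0 L_virial).
have [K1 K1_ge1 betaK] := beta_upper hm beta0 beta_gt0 e_le freud_eq.
have sb n k : beta k / freud_scale R m n ^+ 2 = scaled_beta m beta n k.
  by rewrite freud_scale_sqr.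
have s0 n : freud_scale R m n.+1 != 0.
  by rewrite gt_eqF// powR_gt0// ltr0n.
have /choice[Z hZ] n : exists zs, uniq zs /\ P n = \prod_(z <- zs) ('X - z%:P).
  by have [zs u pz] := orthogonal_zeros L_gt0 P_monic size_P P_orth n; exists zs.
have Zprod n : P n = \prod_(z <- Z n) ('X - z%:P) by have [] := hZ n.
have sizeZ n : size (Z n) = n.
  by apply: eq_add_S; rewrite -(size_prod_XsubC (Z n) id) /= -Zprod size_P.
exists Z, (1 + K1); split => //.
- by move: K1_ge1; lra.
- case=> [|n] z zZ; first by move: (sizeZ 0%N) zZ => /size0nil ->.
  rewrite -ler_pdivrMr ?powR_gt0 ?ltr0n//.
  rewrite -[X in _ / X]ger0_norm ?powR_ge0// -normf_div.
  apply: (zeros_bound L_gt0 P_monic size_P P_orth L_even (n := n) (s0 n)).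
    by rewrite Zprod root_prod_XsubC.
  move=> k kn; rewrite -/(beta k) sb ger0_norm.
    exact: (scaled_beta_le hm beta0 beta_gt0 K1_ge1 betaK (leqW kn)).
  exact: scaled_beta_ge0.
- move=> i; rewrite -cvg_shiftS /=.
  have := trace_limit hm beta0 beta_gt0 c0_gt0 e_le e_ge freud_eq
    (exprn_gt0 2 (freud_a_gt0 R m)) (freud_aX R hm) (i := i).
  apply: cvg_trans; apply: near_eq_cvg; near=> n.
  rewrite /seq_mean sizeZ; congr (_ / _).
  rewrite (zeros_trace L_gt0 P_monic size_P P_orth L_even i (s0 n) (hZ n.+1).1 (hZ n.+1).2).
  by congr (\tr (jacobi _ _ ^+ _)); apply/funext => k; rewrite -/(beta k) sb.
Unshelve. all: by end_near.
Qed.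

Lemma continuous_powR_left (R : realType) (r x : R) : 0 < x ->
  {for x, continuous (fun y => y `^ r)}.
Proof.
move=> x0; apply: differentiable_continuous; apply/derivable1_diffP.
by apply: derivable_powR; rewrite in_itv /= x0.
Qed.

Lemma freud_scale_ratio (R : realType) (m : nat) (n N : nat -> nat) (l : R) :
  0 < l -> N k @[k --> \oo] --> \oo ->
  (n k)%:R / (N k)%:R @[k --> \oo] --> l ->
  freud_scale R m (n k) / freud_scale R m (N k) @[k --> \oo] --> l `^ (2 * m)%:R^-1.
Proof.
move=> l0 hN hl.
have h := @cvg_comp _ _ _ _ (fun y : R => y `^ (2 * m)%:R^-1) _ _ _ hl (continuous_powR_left l0).
apply: cvg_trans h; apply: near_eq_cvg; near=> k => /=.
have N0 : (0 < N k)%N by near: k; exact: (hN _ (nbhs_infty_gt 0)).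
have N0' : 0 < (N k)%:R :> R by rewrite ltr0n.
rewrite /freud_scale; move: ((2 * m)%:R^-1) => r.
have <- : ((n k)%:R / (N k)%:R) `^ r * (N k)%:R `^ r = (n k)%:R `^ r.
  by rewrite -powRM ?divr_ge0// mulfVK// gt_eqF.
by rewrite mulfK// gt_eqF// powR_gt0.
Unshelve. all: by end_near.
Qed.

Lemma prod_XsubC_scale (R : fieldType) (s : R) (zs : seq R) : s != 0 ->
  s ^- (size zs) *: ((\prod_(z <- zs) ('X - z%:P)) \Po (s *: 'X)) =
  \prod_(z <- [seq z / s | z <- zs]) ('X - z%:P).
Proof.
move=> s0; elim: zs => [|z zs IH].
  by rewrite !big_nil invr1 scale1r comp_polyC.
rewrite /= !big_cons -IH comp_polyM exprS invfM -scalerA -!scalerAr scalerA mulrC -scalerA;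
  congr (_ *: _).
rewrite scalerAl; congr (_ * _).
by rewrite comp_polyB comp_polyX comp_polyC scalerBr scalerA mulVf// scale1r polyCM mulrC
  -mul_polyC.
Qed.

Lemma integral_restrict_support (R : realType) (D E : set R) (h : R -> \bar R) :
  (forall x, E x -> ~ D x -> h x = 0%E) ->
  (\int[lebesgue_measure]_(x in E `&` D) h x = \int[lebesgue_measure]_(x in E) h x)%E.
Proof.
move=> hD; rewrite [LHS]integral_mkcond [RHS]integral_mkcond; congr (integral _ _ _).
apply/funext => x; rewrite !patchE.
have [xE|xE] := boolP (x \in E); last first.
  by rewrite ifF//; apply/negbTE; apply: contra xE => /set_mem[xE _]; exact/mem_set.
have [xD|xD] := boolP (x \in D); first by rewrite ifT// in_setI xE.
rewrite ifF ?in_setI ?xE ?(negbTE xD)// hD//; first exact: set_mem.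
by move=> /mem_set; exact/negP.
Qed.

Section FreudDensity.
Variables (R : realType) (m : nat) (l : R).
Hypotheses (hm : (2 <= m)%N) (l0 : 0 < l).
Notation mu := (@lebesgue_measure R).
Local Notation c := (freud_c m l).
Local Notation f := (freud_density m l).

Lemma integral_freud_density_restrict (D E : set R) (g : R -> R) : `]- c, c[ `<=` D ->
  (\int[mu]_(x in E `&` D) (g x * f x)%:E = \int[mu]_(x in E) (g x * f x)%:E)%E.
Proof.
move=> cD; apply: integral_restrict_support => x _ xD.
rewrite freud_density_out ?mulr0//; apply/negP => xc; exact/xD/cD.
Qed.

Lemma integral_freud_density_segment B (g : R -> R) : c <= B ->
  (\int[mu]_(x in `[(- B)%R, B]) (g x * f x)%:E = \int[mu]_x (g x * f x)%:E)%E.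
Proof.
move=> cB; rewrite -(@integral_freud_density_restrict `[- B, B]%classic setT) ?setTI//.
move=> x /=; rewrite !in_itv /= => /andP[h1 h2]; apply/andP; split; move: cB h1 h2; lra.
Qed.

Lemma integrable_freud_density (g : R -> R) : continuous g ->
  mu.-integrable setT (EFin \o (fun x => g x * f x)).
Proof.
move=> cg.
have : mu.-integrable `[- c, c] (EFin \o (fun x => g x * f x)).
  apply: continuous_compact_integrable; first exact: segment_compact.
  by apply: continuous_subspaceT => x; apply: cvgM; [exact: cg|exact: continuous_freud_density].
move=> h; have := iffLR (@integrable_mkcond _ _ R mu _ (EFin \o (fun x => g x * f x))
  (measurable_itv `[- c, c])) h; congr (integrable _ _ _).
apply/funext => x; rewrite patchE; case: ifPn => // xc /=.
rewrite freud_density_out ?mulr0//; apply: contra xc => xc; apply/mem_set.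
by move: xc; rewrite /= !in_itv /= => /andP[/ltW -> /ltW ->].
Qed.

Lemma freud_density_mass : (\int[mu]_x (f x)%:E = 1)%E.
Proof.
have h1 : \int[mu]_(x in `[- c, c]) (x ^+ 0 * f x) = 1.
  rewrite freud_density_moment//= /arcsine_coef double0 bin0 addn0 !expr0 divr1 !mul1r divff//.
  by rewrite pnatr_eq0; case: (m) hm.
have hf := integrable_freud_density (@cst_continuous _ _ (1 : R)).
have -> : (\int[mu]_x (f x)%:E = \int[mu]_x (1 * f x)%:E)%E.
  by apply: eq_integral => x _; rewrite mul1r.
rewrite -[LHS]fineK; last exact: integrable_fin_num hf.
rewrite -(@integral_freud_density_segment c)//; congr (_%:E).
rewrite -[RHS]h1 /Rintegral; congr fine; apply: eq_integral => x _; rewrite expr0.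
Qed.

End FreudDensity.

Section FreudMoments.
Variables (R : realType) (m : nat) (l : R).
Hypotheses (hm : (2 <= m)%N) (l0 : 0 < l).
Notation mu := (@lebesgue_measure R).
Local Notation c := (freud_c m l).
Local Notation f := (freud_density m l).

(** With L = l^(1/2m) one has c = 2 a L, so c^(2r) / 4^r = (a^2)^r L^(2r). *)
Lemma freud_density_ullman B i : c <= B ->
  \int[mu]_(x in `[- B, B]) (x ^+ i * f x) =
  (l `^ (2 * m)%:R^-1) ^+ i * ullman_moment m (freud_a R m ^+ 2) i.
Proof.
move=> cB; transitivity (\int[mu]_(x in `[- c, c]) (x ^+ i * f x)).
  by rewrite /Rintegral !(@integral_freud_density_segment _ _ _ hm _ _ (fun x => x ^+ i)).
rewrite freud_density_moment// /ullman_moment /arcsine_coef /freud_c.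
have [oi|ei] := boolP (odd i); first by rewrite !mul0r mulr0.
have -> : i = i./2.*2 by rewrite even_halfK.
move: (i./2) (freud_a R m) (l `^ _) => r a L; rewrite doubleK !mul1r -!mul2n !exprM.
have -> : (2 * a * L) ^+ 2 = 4 * (a ^+ 2 * L ^+ 2) by ring.
rewrite (exprMn r 4) (exprMn r (a ^+ 2)).
have F0 : (4 : R) ^+ r != 0 by rewrite expf_neq0.
have M0 : (m + r)%:R != 0 :> R by rewrite pnatr_eq0; lia.
move: ((L ^+ 2) ^+ r) ((a ^+ 2) ^+ r) ('C(_, _)%:R) (4 ^+ r) F0 (m%:R) ((m + r)%:R) M0.
by move=> x y z F F0 p q q0; field; rewrite F0 q0.
Qed.

End FreudMoments.

Theorem theorem6p1 (R : realType) (lam t : R) (m : nat)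
    (P : nat -> {poly R}) (n N : nat -> nat) (l : R)
    (hlam : -1 < lam) (hm : (2 <= m)%N)
    (hP : monic_orthogonal_polynomials (freud_weight lam t m) P)
    (hn : n k @[k --> \oo] --> \oo) (hN : N k @[k --> \oo] --> \oo)
    (hl : 0 < l)
    (hnN : (n k)%:R / (N k)%:R @[k --> \oo] --> l) :
  asymptotic_zero_density
    (fun k => scaled_polynomial (freud_scale R m) P (n k) (N k))
    `](- freud_c m l), (freud_c m l)[%classic
    (freud_density m l).
Proof.
have [Z [K [K0 Zprod ZK Zcvg]]] := freud_zeros hlam hm hP.
pose phi := freud_scale R m; pose c := freud_c m l; pose f := freud_density m l.
pose L := l `^ (2 * m)%:R^-1.
have L0 : 0 < L by exact: powR_gt0.
have c0 : 0 < c by exact: freud_c_gt0.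
have ratio : phi (n k) / phi (N k) @[k --> \oo] --> L by exact: freud_scale_ratio.
have phi0 k : (0 < k)%N -> 0 < phi k by move=> k0; rewrite powR_gt0// ltr0n.
have sizeZ k : size (Z k) = k.
  by apply: eq_add_S; rewrite -(size_prod_XsubC (Z k) id) /= -Zprod; have [_ ->] := hP.1 k.
pose xs k := [seq z / phi (N k) | z <- Z (n k)].
have f0 : forall x, 0 <= f x by exact: freud_density_ge0.
have cf : continuous f by exact: continuous_freud_density.
have fint : (@lebesgue_measure R).-integrable setT (EFin \o f).
  have := integrable_freud_density hm hl (@cst_continuous _ _ (1 : R)).
  by congr (integrable _ _ _); apply/funext => x /=; rewrite mul1r.
have [mu muE] := density_probability f0 fint (freud_density_mass hm hl).
exists xs, mu; split.
- near=> k; have Nk : (0 < N k)%N by near: k; exact: (hN _ (nbhs_infty_gt 0)).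
  rewrite /scaled_polynomial Zprod -[X in _ ^- X]sizeZ prod_XsubC_scale//.
  by rewrite gt_eqF// phi0.
- move=> A mA; rewrite muE//.
  have := @integral_freud_density_restrict R m l hm hl `]- c, c[%classic A (fun=> 1) (fun _ => id).
  by under eq_integral do rewrite mul1r; under [in RHS]eq_integral do rewrite mul1r.
- move=> g cg [C gC].
  have mg : measurable_fun [set: measurableTypeR R] g by exact: continuous_measurable_fun.
  (* K (L + 1) bounds the rescaled zeros once phi(n)/phi(N) <= L + 1; the maximum with c makes the
     segment contain the support of the density. *)
  pose B := Num.max c (K * (L + 1)).
  have cB : c <= B by rewrite le_max lexx.
  have B0 : 0 < B by exact: lt_le_trans cB.
  have f1 : \int[lebesgue_measure]_(x in `[- B, B]) f x = 1.
    have := freud_density_ullman hm hl 0 cB; rewrite /ullman_moment !expr0 addn0 bin0 !mul1r divff.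
      by move=> <-; apply: eq_Rintegral => x _; rewrite mul1r.
    by rewrite pnatr_eq0; case: (m) hm.
  have xsB : \forall k \near \oo, forall z, z \in xs k -> `|z| <= B.
    near=> k => z /mapP[y yZ ->].
    have Nk : (0 < N k)%N by near: k; exact: (hN _ (nbhs_infty_gt 0)).
    rewrite normf_div [X in _ / X]ger0_norm ?(ltW (phi0 _ Nk))//.
    rewrite le_max; apply/orP; right.
    apply: (@le_trans _ _ (K * (phi (n k) / phi (N k)))).
      by rewrite mulrA ler_pM2r ?invr_gt0 ?phi0// ZK.
    rewrite ler_wpM2l//; near: k.
    apply: (cvgr_le _ ratio); by rewrite ltrDl.
  (* From z / phi(N) = (phi(n)/phi(N)) (z / phi(n)): the moment is a factor tending to L^i times the
     moment of the zeros on their own scale. *)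
  have xsM i : seq_mean (xs k) (fun z => z ^+ i) @[k --> \oo] --> L ^+ i * ullman_moment m
    (freud_a R m ^+ 2) i.
    have h1 : (phi (n k) / phi (N k)) ^+ i @[k --> \oo] --> L ^+ i.
      exact: (@cvg_comp _ _ _ _ (fun x : R => x ^+ i) _ _ _ ratio (@exprn_continuous _ i L)).
    have h2 := @cvg_comp _ _ _ n (fun k => seq_mean (Z k) (fun z => (z / phi k) ^+ i)) _ _ _ hn
      (Zcvg i).
    apply: cvg_trans (cvgM h1 h2); apply: near_eq_cvg; near=> k => /=.
    have nk : (0 < n k)%N by near: k; exact: (hn _ (nbhs_infty_gt 0)).
    rewrite /seq_mean size_map big_map mulrA mulr_sumr; congr (_ / _).
    apply: eq_bigr => z _; rewrite -exprMn; congr (_ ^+ _).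
    have := phi0 _ nk; move: (phi (n k)) => p p0.
    by move: (phi _)^-1 => q; field; rewrite gt_eqF.
  have fM i : \int[lebesgue_measure]_(x in `[- B,
    B]) (x ^+ i * f x) = L ^+ i * ullman_moment m (freud_a R m ^+ 2) i.
    exact: freud_density_ullman.
  rewrite (integral_density fint muE mg); last by exists C.
  rewrite -(integral_freud_density_segment hm hl g cB).
  under eq_fun do rewrite integral_zero_counting//.
  have gint : (@lebesgue_measure R).-integrable `[- B, B] (EFin \o (fun x => g x * f x)).
    by apply: (integrableS _ _ (@subsetT _ _)) => //; exact: integrable_freud_density.
  rewrite -(fineK (integrable_fin_num _ gint))//.
  apply: cvg_EFin; first by near=> k.
  exact: (moments_weak B0 f0 cf f1 fM xsB xsM cg gC).
Unshelve. all: by end_near.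
Qed.
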